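(* Let $\Phi(s)=\frac{1}{\pi^2}\sin^2(\pi s)$. For an arbitrary $f\in L_2(\mathbb{R}_+)$ the formula $$G(x)=\int_0^\infty \frac{\log(x)-\log(t)}{x-t}\,f(t)\,dt,\qquad x>0, \tag{A}$$ defines everywhere on $\mathbb{R}_+$ a function $G\in L_2^{(\Phi)}(\mathbb{R}_+)$. Moreover, for almost every $x>0$ the reciprocal inversion formula $$f(x)=\frac{1}{\pi^2}\left[G(x)+\frac{1}{2\sqrt{x}}\sum_{k=1}^\infty \frac{(-1)^k}{(2k)!}\left(2\pi x\frac{d}{dx}\right)^{2k}\left(\sqrt{x}\,G(x)\right)\right] \tag{B}$$ holds, where the operator series converges in the mean square with respect to the norm in $L_2(\mathbb{R}_+)$. Conversely, for any $G\in L_2^{(\Phi)}(\mathbb{R}_+)$ formula (B) defines almost everywhere on $\mathbb{R}_+$ a function $f\in L_2(\mathbb{R}_+)$, and the reciprocal formula (A) holds.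
   Context: $\mathbb{R}_+=(0,\infty)$; functions are complex-valued. The kernel $\frac{\log x-\log t}{x-t}$ has a removable singularity at $t=x$ (value $1/x$), and the integral is a Lebesgue integral. Write $\sigma_s=\{s\in\mathbb{C}:\mathrm{Re}\,s=1/2\}$. Definition of $L_2^{(\Phi)}(\mathbb{R}_+)$. Let $\Phi(s)=\sum_{k=0}^\infty d_k s^k$ be an entire function having on the line $\sigma_s$ the expansion $\Phi(\frac12+i\tau)=\sum_{k=0}^\infty c_k\tau^{2k}$ with $c_0>0$ and $c_k\ge 0$ for $k\geq 1$ (the function $\Phi(s)=\pi^{-2}\sin^2(\pi s)$ is of this kind). One says $f\in L_2^{(\Phi)}(\mathbb{R}_+)$ if: (1) $f$ is infinitely differentiable on $\mathbb{R}_+$ and $\left(-x\frac{d}{dx}\right)^k f(x)\in L_2(\mathbb{R}_+)$ for all $k=0,1,2,\dots$; (2) the equality $\Phi\left(-x\frac{d}{dx}\right)f(x)=\sum_{k=0}^\infty d_k\left(-x\frac{d}{dx}\right)^k f(x)$ holds, where the operator series on the right converges in the mean square with respect to the norm in $L_2(\mathbb{R}_+)$. *)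

(* Defs.v *)
From HB Require Import structures.
From mathcomp Require Import all_boot all_order all_algebra.
From mathcomp Require Import all_classical all_reals all_analysis.
From mathcomp Require Import complex.

Set Implicit Arguments.
Unset Strict Implicit.
Unset Printing Implicit Defensive.

Import Order.TTheory GRing.Theory Num.Theory.
Import numFieldNormedType.Exports.
Import ComplexField.

Local Open Scope classical_set_scope.
Local Open Scope complex_scope.
Local Open Scope ring_scope.

(* Functions on (0, +oo) are represented by total functions R -> R[i]; every
   notion below depends only on their values at positive arguments.
   R[i] is not a normed module over R in the library, so that measurability,
   integrals and derivatives are taken on real and imaginary parts. *)

Section ComplexValuedFunctions.
Variable R : realType.
Implicit Types (f g : R -> R[i]).

Definition halfline : set R := `]0, +oo[.

Definition ReF f : R -> R := fun x => complex.Re (f x).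
Definition ImF f : R -> R := fun x => complex.Im (f x).

Definition cmeasurable f : Prop :=
  measurable_fun halfline (ReF f) /\ measurable_fun halfline (ImF f).

Definition cintegrable f : Prop :=
  (@lebesgue_measure R).-integrable halfline (EFin \o ReF f) /\
  (@lebesgue_measure R).-integrable halfline (EFin \o ImF f).

Definition cintegral f : R[i] :=
  (\int[@lebesgue_measure R]_(t in halfline) ReF f t)
  +i* (\int[@lebesgue_measure R]_(t in halfline) ImF f t).

Definition L2norm f : \bar R :=
  'N[@lebesgue_measure R]_2%:E [(fun x => (Normc.normc (f x))%:E) \_ halfline]%E.

Definition L2 f : Prop := cmeasurable f /\ (L2norm f < +oo)%E.

Definition ms_sum (u : nat -> R -> R[i]) (S : R -> R[i]) : Prop :=
  [/\ forall k, L2 (u k), L2 S &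
      L2norm (fun x => \sum_(k < n) u k x - S x) @[n --> \oo] --> 0%E].

Definition cderiv f : R -> R[i] := fun x => derive1 (ReF f) x +i* derive1 (ImF f) x.

Definition smooth f : Prop := forall (n : nat) (x : R), 0 < x ->
  derivable (derive1n n (ReF f)) x 1 /\ derivable (derive1n n (ImF f)) x 1.

(* a x d/dx *)
Definition euler_op (a : R) f : R -> R[i] := fun x => (a * x)%:C * cderiv f x.

End ComplexValuedFunctions.

Section Symbols.
Variable R : realType.
Implicit Types (Phi : R[i] -> R[i]) (d : nat -> R[i]) (c : nat -> R).

Definition entire_expansion Phi d : Prop := forall s : R[i],
  Normc.normc (\sum_(k < n) d k * s ^+ k - Phi s) @[n --> \oo] --> (0 : R).

Definition critical_line_expansion Phi c : Prop := forall tau : R,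
  Normc.normc ((\sum_(k < n) c k * tau ^+ k.*2)%:C - Phi (2^-1 +i* tau))
    @[n --> \oo] --> (0 : R).

Definition L2Phi Phi (f : R -> R[i]) : Prop :=
  exists d c,
    [/\ entire_expansion Phi d,
        critical_line_expansion Phi c,
        0 < c 0%N /\ (forall k, (1 <= k)%N -> 0 <= c k),
        smooth f /\ (forall k, L2 (iter k (euler_op (-1)) f)) &
        (* Phi (- x d/dx) f is by definition the mean-square sum of this
           series, so that membership asks for that sum to exist. *)
        exists g, ms_sum (fun k x => d k * iter k (euler_op (-1)) f x) g].

Definition cexp (z : R[i]) : R[i] :=
  (expR (complex.Re z))%:C *
  (cos (complex.Im z) +i* sin (complex.Im z)).

Definition csin (z : R[i]) : R[i] :=
  (cexp ('i%C * z) - cexp (- ('i%C * z))) / (2 * 'i%C).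

Definition sin2_symbol (s : R[i]) : R[i] :=
  (pi ^- 2)%:C * csin (pi%:C * s) ^+ 2.

End Symbols.

Section LogTransform.
Variable R : realType.
Implicit Types (f G : R -> R[i]).

Definition log_kernel (x t : R) : R :=
  if t == x then x^-1 else (ln x - ln t) / (x - t).

Definition log_integrand f (x t : R) : R[i] := (log_kernel x t)%:C * f t.

Definition log_transform f : R -> R[i] := fun x => cintegral (log_integrand f x).

Definition sqrt_mul G : R -> R[i] := fun x => (Num.sqrt x)%:C * G x.

Definition inversion_term G (k : nat) : R -> R[i] := fun x =>
  ((2 * Num.sqrt x)^-1)%:C * (((-1) ^+ k / (k.*2)`!%:R)%:C *
    iter k.*2 (euler_op (2 * pi)) (sqrt_mul G) x).

(* The factor 1 / (2 sqrt x) belongs to the terms whose series converges in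
   mean square: sqrt x * G(x) itself need not be square integrable. *)
Definition inversion_formula G f : Prop :=
  exists2 S : R -> R[i], ms_sum (fun k => inversion_term G k.+1) S &
    {ae @lebesgue_measure R, forall x : R, 0 < x ->
       f x = (pi ^- 2)%:C * (G x + S x)}.

End LogTransform.

(* Main.v *)
Require Import Defs.
From mathcomp Require Import all_boot all_order all_algebra.
From mathcomp Require Import all_classical all_reals all_analysis.
From mathcomp Require Import measurable_realfun complex ring lra zify.

(** Let theta = x d/dx + 1/2, a skew-symmetric operator on L_2(0, +oo), and let
    S f(x) be the integral of f(t) / (x + t), the Carleman operator.  Integrating
    1 / ((x + s) (s + t)) over s gives the logarithmic kernel, so that the
    transform is G = T f with T = S^2.  The Mellin transform would diagonalize
    everything: theta becomes - i tau and S becomes pi / ch(pi tau), that is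
    S = pi / cos(pi theta).  Hence f = pi^-2 cos^2(pi theta) G.  Both series of the
    theorem are this operator: - x d/dx = 1/2 - theta, so that
    Phi(- x d/dx) = pi^-2 sin^2(pi (1/2 - theta)), and conjugation by sqrt x turns
    x d/dx into theta, so that the inversion formula is the Taylor series of
    cos^2 = (1 + cos (2 .)) / 2.  Real-variable arguments make this rigorous.

    First, a strong inverse of S.  On kernels P(x/(x+t)) / (x+t), with P a polynomial,
    theta acts by an explicit operation on P.  The n-th partial Euler product of
    cos(pi theta) sends 1/(x+t) to a multiple of x^n t^n / (x+t)^(2n+1)
    (opact_eprod), a kernel that concentrates on the diagonal.  Divided by pi these
    operators En are contractions, by the Schur test with weight t^(-1/2), and they
    tend strongly to the identity (En_cvg_sqint).  So the square of the n-th product,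
    applied to T f, is pi^2 En (En f) and tends to pi^2 f (act_eprod2).

    Secondly, the Euler products are replaced by the partial sums of the series.
    Skew-symmetry makes <theta^i G, theta^j G> a signed Hankel matrix (gram_hankel),
    and the alternating signs of the Euler products cancel its signs
    (sqnorm_act_alt).  So the bounds on En become bounds on sums of nonnegative
    terms, and the Euler product formula for ch, coefficient by coefficient
    (eprodp_cvg), yields at the limit that the sum of (4 pi)^k / k! times the Hankel
    weights is finite (hankel_wt_summable).  This is exactly the domination that
    lets one exchange polynomials with coefficients O((2 pi)^k / k!) which have the
    same limits coefficientwise (act_to0).  The outcome, inversion_cvg, says that any
    such approximation of cos^2(pi X) inverts T; the partial sums of Phi (sympoly)
    and of the inversion formula (cospoly) are of this kind.

    Thirdly, the converse needs no further analysis.  If p_n(theta) G tends to f,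
    p_n being the partial sums of the symbol, then p_n(theta) T G = T p_n(theta) G
    tends to T f, while the direct theorem applied to G says that it tends to G.
    Therefore G = T f (carleman2_of_symbol_series).  The inverse f is unique because
    the mean-square sum of the series is.

    Complex functions are treated through real and imaginary parts; this is
    possible since the coefficients of Phi are real, and they are determined by Phi
    (symcoef_unique). *)

Set Implicit Arguments.
Unset Strict Implicit.
Unset Printing Implicit Defensive.

Import Order.TTheory GRing.Theory Num.Theory.
Import numFieldNormedType.Exports.

Local Open Scope classical_set_scope.
Local Open Scope ring_scope.

(** * Calculus and integration on the half-line *)

Section Calculus.
Variable R : realType.
Implicit Types (f g : R -> R) (x : R).

Lemma dcst (k : R) x : is_derive x 1 (fun=> k) 0.
Proof. exact: is_derive_cst. Qed.

Lemma did x : is_derive x 1 (fun y : R => y) 1.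
Proof. exact: is_derive_id. Qed.

Lemma dD f g x df dg : is_derive x 1 f df -> is_derive x 1 g dg ->
  is_derive x 1 (fun y => f y + g y) (df + dg).
Proof. by move=> hf hg; exact: is_deriveD. Qed.

Lemma dB f g x df dg : is_derive x 1 f df -> is_derive x 1 g dg ->
  is_derive x 1 (fun y => f y - g y) (df - dg).
Proof. by move=> hf hg; exact: is_deriveB. Qed.

Lemma dM f g x df dg : is_derive x 1 f df -> is_derive x 1 g dg ->
  is_derive x 1 (fun y => f y * g y) (df * g x + f x * dg).
Proof.
move=> hf hg; apply: is_derive_eq (is_deriveM hf hg) _.
by rewrite addrC /GRing.scale /= [g x * _]mulrC.
Qed.

Lemma dZ (k : R) f x df : is_derive x 1 f df -> is_derive x 1 (fun y => k * f y) (k * df).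
Proof.
by move=> hf; apply: is_derive_eq (dM (dcst k x) hf) _; rewrite mul0r add0r.
Qed.

Lemma dV f x df : f x != 0 -> is_derive x 1 f df ->
  is_derive x 1 (fun y => (f y)^-1) (- df / f x ^+ 2).
Proof.
move=> fx hf; apply: is_derive_eq (is_deriveV fx hf) _.
by rewrite /GRing.scale /= !mulNr mulrC.
Qed.

Lemma dX f x df n : is_derive x 1 f df ->
  is_derive x 1 (fun y => f y ^+ n) (n%:R * f x ^+ n.-1 * df).
Proof.
move=> hf; elim: n => [|n IH].
  by rewrite !mul0r; exact: dcst.
rewrite (_ : (fun _ => _) = fun y => f y * f y ^+ n); last first.
  by apply/funext => y; rewrite exprS.
apply: is_derive_eq (dM hf IH) _ => /=.
case: n {IH} => [|n] /=; first by rewrite !mul0r mulr0 mul1r addr0 mulrC.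
by rewrite exprS -[in RHS]natr1; ring.
Qed.

Lemma dcomp f g x df dg : is_derive (g x) 1 f df -> is_derive x 1 g dg ->
  is_derive x 1 (fun y => f (g y)) (df * dg).
Proof. by move=> hf hg; exact: is_derive1_comp. Qed.

Lemma dsum n (f : nat -> R -> R) df x :
  (forall k, (k < n)%N -> is_derive x 1 (f k) (df k)) ->
  is_derive x 1 (fun y => \sum_(k < n) f k y) (\sum_(k < n) df k).
Proof.
elim: n => [|n IH] h.
  rewrite big_ord0 (_ : (fun _ => _) = fun=> 0); first exact: dcst.
  by apply/funext => y; rewrite big_ord0.
rewrite big_ord_recr /= (_ : (fun _ => _) = fun y => \sum_(k < n) f k y + f n y).
  by apply: dD; [apply: IH => k kn; exact/h/ltnW|exact: h].
by apply/funext => y; rewrite big_ord_recr.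
Qed.

Lemma derive_cont f df x : is_derive x 1 f df -> {for x, continuous f}.
Proof. by case=> df1 _; exact/differentiable_continuous/derivable1_diffP. Qed.

Lemma derive_ext f g x df : 0 < x -> (forall y, 0 < y -> f y = g y) ->
  is_derive x 1 f df -> is_derive x 1 g df.
Proof.
move=> x0 fg; apply: near_eq_is_derive.
near=> y; apply: fg; near: y; exact: lt_nbhsr.
Unshelve. all: by end_near. Qed.

End Calculus.

Section HalfLineIntegral.
Variable R : realType.
Implicit Types (f g F : R -> R).
Local Notation mu := (@lebesgue_measure R).
Local Notation D := (@halfline R).

Definition integ f := mu.-integrable D (EFin \o f).
(** Real-valued, hence 0 for a function of infinite integral: integrability is
    carried separately throughout. *)
Definition hint f : R := \int[mu]_(x in D) f x.
Definition meas f := measurable_fun D f.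

Lemma halflineE (x : R) : D x = ((0 < x) : Prop).
Proof. by rewrite /halfline /= in_itv /= andbT. Qed.

Lemma in_halfline (x : R) : x \in D -> 0 < x.
Proof. by rewrite inE halflineE. Qed.

Lemma measurable_halfline : measurable D.
Proof. exact: measurable_itv. Qed.
Lemma measurable_halfline_lebesgue : measurable (D : set (measurableTypeR R)).
Proof. exact: measurable_itv. Qed.
Hint Resolve measurable_halfline measurable_halfline_lebesgue : core.

Lemma integ_meas f : integ f -> meas f.
Proof. by move=> /integrableP[/measurable_EFinP]. Qed.

Lemma meas_EFin f : meas f ->
  measurable_fun (D : set (measurableTypeR R)) (EFin \o f).
Proof. by move=> mf; apply/measurable_EFinP. Qed.

Lemma integ_ext f g : (forall x, 0 < x -> f x = g x) -> integ f -> integ g.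
Proof. by move=> fg; apply: eq_integrable => // x /in_halfline x0 /=; rewrite fg. Qed.

Lemma hint_ext f g : (forall x, 0 < x -> f x = g x) -> hint f = hint g.
Proof. by move=> fg; apply: eq_Rintegral => x /in_halfline; exact: fg. Qed.

Lemma meas_ext f g : (forall x, 0 < x -> f x = g x) -> meas f -> meas g.
Proof. by move=> fg; apply: eq_measurable_fun => x /in_halfline; exact: fg. Qed.

Lemma integD f g : integ f -> integ g -> integ (fun x => f x + g x).
Proof.
by move=> hf hg; exact: (integrableD measurable_halfline_lebesgue hf hg).
Qed.

Lemma integZ k f : integ f -> integ (fun x => k * f x).
Proof.
by move=> hf; exact: (integrableZl measurable_halfline_lebesgue k hf).
Qed.

Lemma integB f g : integ f -> integ g -> integ (fun x => f x - g x).
Proof.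
by move=> hf hg; exact: (integrableB measurable_halfline_lebesgue hf hg).
Qed.

Lemma integ_norm f : integ f -> integ (fun x => `|f x|).
Proof. exact: integrable_norm. Qed.

Lemma integ_le f g : meas f -> (forall x, 0 < x -> `|f x| <= g x) ->
  integ g -> integ f.
Proof.
move=> mf fg; apply: le_integrable => //; first exact: meas_EFin.
move=> x; rewrite halflineE => x0; rewrite lee_fin.
by apply: (le_trans (fg _ x0)); exact: ler_norm.
Qed.

Lemma hintD f g : integ f -> integ g -> hint (fun x => f x + g x) = hint f + hint g.
Proof. by move=> *; exact: RintegralD. Qed.

Lemma hintB f g : integ f -> integ g -> hint (fun x => f x - g x) = hint f - hint g.
Proof. by move=> *; exact: RintegralB. Qed.

Lemma hintZ k f : integ f -> hint (fun x => k * f x) = k * hint f.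
Proof. by move=> *; exact: RintegralZl. Qed.

Lemma hint_ge0 f : (forall x, 0 < x -> 0 <= f x) -> 0 <= hint f.
Proof. by move=> f0; apply: Rintegral_ge0 => x; rewrite halflineE; exact: f0. Qed.

Lemma hint_le f g : integ f -> integ g -> (forall x, 0 < x -> f x <= g x) ->
  hint f <= hint g.
Proof.
by move=> hf hg fg; apply: le_Rintegral => // x; rewrite halflineE; exact: fg.
Qed.

Lemma hint_norm f : integ f -> `|hint f| <= hint (fun x => `|f x|).
Proof. by move=> *; exact: le_normr_Rintegral. Qed.

Lemma integ0 : integ (fun=> 0).
Proof. exact: integrable0. Qed.

Lemma hint0 : hint (fun=> 0) = 0.
Proof. by rewrite /hint /Rintegral integral0. Qed.

Lemma integ_sum n (f : nat -> R -> R) : (forall k, (k < n)%N -> integ (f k)) ->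
  integ (fun x => \sum_(k < n) f k x).
Proof.
elim: n => [|n IH] hf.
  by apply: integ_ext integ0 => x _; rewrite big_ord0.
have := integD (IH (fun k kn => hf k (ltnW kn))) (hf n (ltnSn n)).
by apply: integ_ext => x _; rewrite big_ord_recr.
Qed.

Lemma hint_sum n (f : nat -> R -> R) : (forall k, (k < n)%N -> integ (f k)) ->
  hint (fun x => \sum_(k < n) f k x) = \sum_(k < n) hint (f k).
Proof.
elim: n => [|n IH] hf.
  by rewrite big_ord0 -[RHS]hint0; apply: hint_ext => x _; rewrite big_ord0.
rewrite big_ord_recr /= -IH => [|k kn]; last exact/hf/ltnW.
rewrite -hintD ?hf//; last by apply: integ_sum => k kn; exact/hf/ltnW.
by apply: hint_ext => x _; rewrite big_ord_recr.
Qed.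

Lemma EFin_hint f : integ f -> (hint f)%:E = (\int[mu]_(x in D) (f x)%:E)%E.
Proof. by move=> hf; rewrite /hint /Rintegral fineK//; exact: integrable_fin_num. Qed.

Lemma integ_ge0P f : meas f -> (forall x, 0 < x -> 0 <= f x) ->
  (\int[mu]_(x in D) (f x)%:E < +oo)%E -> integ f.
Proof.
move=> mf f0 lt; apply/integrableP; split; first exact: meas_EFin.
apply: le_lt_trans lt; rewrite le_eqVlt; apply/orP; left; apply/eqP.
by apply: eq_integral => x /in_halfline x0 /=; rewrite ger0_norm// f0.
Qed.

Lemma hint_dct (f : nat -> R -> R) g F :
  (forall n, meas (f n)) -> meas F ->
  (forall x, 0 < x -> f n x @[n --> \oo] --> F x) ->
  integ g -> (forall n x, 0 < x -> `|f n x| <= g x) ->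
  integ F /\ hint (f n) @[n --> \oo] --> hint F.
Proof.
move=> mf mF cv ig fg.
have [|||||iF _ cvI] := @dominated_convergence _ _ _ mu D measurable_halfline_lebesgue
  (fun n x => (f n x)%:E) (EFin \o F) (EFin \o g).
- by move=> n; exact: meas_EFin.
- exact: meas_EFin.
- apply: aeW => x; rewrite halflineE => x0.
  by apply: cvg_EFin; [exact: nearW|exact: cv].
- by [].
- by apply: aeW => x n; rewrite halflineE => x0; rewrite lee_fin fg.
split => //; apply: fine_cvg.
by rewrite fineK//; exact: integrable_fin_num.
Qed.

Lemma meas_cont f : (forall x, 0 < x -> {for x, continuous f}) -> meas f.
Proof.
move=> cf; apply: open_continuous_measurable_fun.
  by rewrite /halfline; exact: interval_open.
by move=> x /in_halfline; exact: cf.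
Qed.

Lemma meas_derive f f' : (forall x : R, 0 < x -> is_derive x 1 f (f' x)) -> meas f.
Proof.
move=> df; apply: meas_cont => x /df [df1 _].
exact/differentiable_continuous/derivable1_diffP.
Qed.

Lemma measM f g : meas f -> meas g -> meas (fun x => f x * g x).
Proof. exact: measurable_funM. Qed.

Lemma measD f g : meas f -> meas g -> meas (fun x => f x + g x).
Proof. exact: measurable_funD. Qed.

Lemma measB f g : meas f -> meas g -> meas (fun x => f x - g x).
Proof. exact: measurable_funB. Qed.

Lemma meas_cst (k : R) : meas (fun=> k).
Proof. exact: measurable_cst. Qed.

Lemma measX f n : meas f -> meas (fun x => f x ^+ n).
Proof. by move=> mf; exact: measurable_funX. Qed.

Lemma meas_norm f : meas f -> meas (fun x => `|f x|).
Proof. by move=> mf; exact: measurableT_comp. Qed.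

Lemma ftc_segment f F (a b : R) : 0 < a -> a < b ->
  (forall x : R, 0 < x -> is_derive x 1 F (f x)) ->
  (forall x : R, 0 < x -> {for x, continuous f}) ->
  (\int[mu]_(x in `[a, b]) (f x)%:E)%E = (F b - F a)%:E.
Proof.
move=> a0 ab dF cf.
have cF x : 0 < x -> {for x, continuous F}.
  by move=> /dF; exact: derive_cont.
rewrite (@continuous_FTC2 _ f F)//.
- apply: (@continuous_in_subspaceT _ _ `[a, b]%classic f) => x.
  by rewrite inE /= in_itv /= => /andP[ax _]; apply/cf/(lt_le_trans a0).
- split => /=.
  + by move=> x; rewrite in_itv /= => /andP[ax _]; have [] := dF _ (lt_trans a0 ax).
  + exact: cvg_at_right_filter (cF _ a0).
  + exact: cvg_at_left_filter (cF _ (lt_trans a0 ab)).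
- move=> x; rewrite in_itv /= => /andP[ax _]; rewrite derive1E.
  by have [_] := dF _ (lt_trans a0 ax).
Qed.

Lemma itv_halfline (a b : R) : 0 < a -> `[a, b] `<=` D.
Proof.
by move=> a0 x; rewrite halflineE /= in_itv /= => /andP[+ _]; exact: lt_le_trans.
Qed.

Lemma meas_patch f (a b : R) : meas f -> meas (f \_ `[a, b]).
Proof.
move=> mf; apply/(measurable_restrict f (measurable_itv `[a, b]) measurable_halfline).
by apply: measurable_funS mf => //; exact: subIsetl.
Qed.

Lemma hint_patch f F (a b : R) : 0 < a -> a < b ->
  (forall x : R, 0 < x -> is_derive x 1 F (f x)) ->
  (forall x : R, 0 < x -> {for x, continuous f}) ->
  hint (f \_ `[a, b]) = F b - F a.
Proof.
move=> a0 ab dF cf; rewrite /hint -Rintegral_mkcondr setIidr; last exact: itv_halfline.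
by rewrite /Rintegral (ftc_segment a0 ab dF cf).
Qed.

Lemma cvg_natS2 : (n.+2%:R : R) @[n --> \oo] --> +oo.
Proof.
rewrite (_ : (fun _ => _) = (fun n => (n + 2)%N%:R)).
  by have := @cvgr_idn R; rewrite -(cvg_shiftn 2).
by apply/funext => n; rewrite addn2.
Qed.

Lemma cvg_natS2V : (n.+2%:R^-1 : R) @[n --> \oo] --> 0.
Proof. by have := @cvg_harmonic R; rewrite -(cvg_shiftS _). Qed.

Lemma seg_cover (a b : nat -> R) x : 0 < x ->
  (forall n, 0 < a n <= n.+2%:R^-1) -> (forall n, n.+2%:R <= b n) ->
  \forall n \near \oo, x \in `[a n, b n].
Proof.
move=> x0 ha hb; near=> n; rewrite in_itv /=; apply/andP; split.
  have /andP[_ /le_trans] := ha n; apply; near: n.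
  exact: (cvgr_le _ cvg_natS2V).
by apply: le_trans (hb n); near: n; move/cvgryPge : cvg_natS2; apply.
Unshelve. all: by end_near. Qed.

Lemma natS2_lt (a b : nat -> R) n :
  (forall n, 0 < a n <= n.+2%:R^-1) -> (forall n, n.+2%:R <= b n) -> a n < b n.
Proof.
move=> /(_ n)/andP[_ an] /(_ n); apply: lt_le_trans; apply: (le_lt_trans an).
rewrite (@le_lt_trans _ _ 1)// ?ltr1n// invf_le1 ?ltr0n// ler1n//.
Qed.

(** The ends a n and b n of the segments are free within the stated bounds, so
    that they can be chosen where the primitive F is small. *)
Lemma hint_exhaust f F (a b : nat -> R) :
  (forall n, 0 < a n <= n.+2%:R^-1) -> (forall n, n.+2%:R <= b n) ->
  (forall x : R, 0 < x -> is_derive x 1 F (f x)) ->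
  (forall x : R, 0 < x -> {for x, continuous f}) ->
  integ f -> F (b n) - F (a n) @[n --> \oo] --> hint f.
Proof.
move=> ha hb dF cf hf; have mf := integ_meas hf.
have [|//||||_] := @hint_dct (fun n => f \_ `[a n, b n]) (fun x => `|f x|) f.
- by move=> n; exact: meas_patch.
- move=> x x0; have h := seg_cover x0 ha hb.
  apply: (@cvg_trans _ (f x @[_ --> \oo])); last exact: cvg_cst.
  apply: near_eq_cvg; near=> n; rewrite patchE ifT//; near: n.
  by apply: filterS h => n; rewrite inE.
- exact: integ_norm.
- by move=> n x x0; rewrite patchE; case: ifP => // _; rewrite normr0.
apply: cvg_trans; apply: near_eq_cvg; apply: nearW => n /=.
have /andP[an _] := ha n.
by rewrite (hint_patch an (natS2_lt n ha hb) dF cf).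
Unshelve. all: by end_near. Qed.

(** For a nonnegative derivative, integrability over the half-line follows from
    the existence of the limits of the primitive. *)
Lemma ftc_ge0 f F (l0 l1 : R) :
  (forall x : R, 0 < x -> is_derive x 1 F (f x)) ->
  (forall x : R, 0 < x -> {for x, continuous f}) ->
  (forall x, 0 < x -> 0 <= f x) ->
  F x @[x --> 0^'+] --> l0 -> F x @[x --> +oo] --> l1 ->
  integ f /\ hint f = l1 - l0.
Proof.
move=> dF cf f0 F0 F1.
have mf := meas_cont cf.
pose a n : R := n.+2%:R^-1; pose b n : R := n.+2%:R.
have ha n : 0 < a n <= n.+2%:R^-1 by rewrite lexx andbT invr_gt0 ltr0n.
have hb n : n.+2%:R <= b n by [].
have cF : F (b n) - F (a n) @[n --> \oo] --> l1 - l0.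
  apply: cvgB; first by move/cvg_pinftyP : F1; apply; exact: cvg_natS2.
  move/cvg_at_rightP : F0; apply; split; last exact: cvg_natS2V.
  by move=> n; have /andP[] := ha n.
have hf : integ f.
  apply: integ_ge0P => //.
  rewrite (_ : (\int[mu]_(x in D) (f x)%:E)%E = (l1 - l0)%:E) ?ltry//.
  have U : \bigcup_n `[a n, b n]%classic = D.
    apply/seteqP; split => [x [n _]|x].
      by apply: itv_halfline; have /andP[] := ha n.
    rewrite halflineE => x0; have [N _ /(_ N (leqnn _)) h] := seg_cover x0 ha hb.
    by exists N.
  have nd : nondecreasing_seq (fun n => `[a n, b n]%classic).
    apply/nondecreasing_seqP => n; rewrite subsetEset => x.
    rewrite /= !in_itv /= => /andP[xn nx]; apply/andP; split.
      by apply: le_trans xn; rewrite lef_pV2 ?posrE ?ltr0n// ler_nat.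
    by apply: (le_trans nx); rewrite ler_nat.
  have := @ge0_nondecreasing_set_cvg_integral _ (measurableTypeR R) R
    (fun n => `[a n, b n]%classic) (EFin \o f) mu nd (fun=> measurable_itv _).
  rewrite U => /(_ _ _)h.
  apply: (cvg_unique _ (h _ _)) => //.
  - move=> n; apply: measurable_funS (meas_EFin mf) => //.
    by apply: itv_halfline; have /andP[] := ha n.
  - move=> n x xn; rewrite lee_fin f0// -halflineE.
    by apply: itv_halfline xn; have /andP[] := ha n.
  rewrite (_ : (fun _ => _) = EFin \o (fun n => F (b n) - F (a n))).
    by apply: cvg_EFin => //; exact: nearW.
  apply/funext => n /=; rewrite (ftc_segment _ _ dF cf)//.
    by have /andP[] := ha n.
  exact: natS2_lt.
split => //; apply: cvg_unique cF => //; exact: hint_exhaust.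
Qed.

(** Since 1/x is integrable neither at 0 nor at infinity, integrability of F/x
    forces F to be small somewhere near both ends.  The points b and a play the
    role of limits of integration, with no limit of F at the ends assumed. *)
Lemma small_values F : (forall x : R, 0 < x -> {for x, continuous F}) ->
  integ (fun x => F x / x) ->
  forall n, (exists2 a, 0 < a <= n.+2%:R^-1 & `|F a| <= n.+2%:R^-1) /\
            (exists2 b, n.+2%:R <= b & `|F b| <= n.+2%:R^-1).
Proof.
move=> cF hF n; set e : R := n.+2%:R^-1; have e0 : 0 < e by rewrite invr_gt0.
have dln (x : R) : 0 < x -> is_derive x 1 (fun x => e * ln x) (e * x^-1).
  by move=> x0; apply: dZ; exact: is_derive1_ln.
have cV (x : R) : 0 < x -> {for x, continuous (fun x : R => e * x^-1)}.
  move=> x0; apply: cvgM; first exact: cvg_cst.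
  by apply: cvgV => //; rewrite gt_eqF.
have key (a b : R) : 0 < a -> a < b ->
    (forall x, a <= x <= b -> e < `|F x|) ->
    e * (ln b - ln a) <= hint (fun x => `|F x / x|).
  move=> a0 ab h; rewrite mulrBr -(hint_patch a0 ab dln cV).
  have h1 x : `|((fun x : R => e * x^-1) \_ `[a, b]) x| <= `|F x / x|.
    rewrite patchE; case: ifPn; last by rewrite normr0.
    rewrite inE /= in_itv /= => /[dup] /h lt /andP[ax _].
    have x0 := lt_le_trans a0 ax.
    rewrite !normrM (gtr0_norm e0) ler_wpM2r//; exact: ltW.
  apply: hint_le => //.
  - apply: (@integ_le _ (fun x => `|F x / x|)) => //; last exact: integ_norm.
    by apply: meas_patch; exact: meas_cont.
  - exact: integ_norm.
  - by move=> x _; exact: le_trans (ler_norm _) (h1 x).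
set C := hint _ in key.
pose r : R := expR (C / e + 1).
have r1 : 0 < r by exact: expR_gt0.
have C0 : 0 <= C by exact: hint_ge0.
have r2 : 1 < r by rewrite expR_gt1 ltr_wpDl// divr_ge0// ltW.
have big : C < e * ln r.
  by rewrite /r expRK mulrDr mulr1 mulrC divfK ?gt_eqF// ltrDl.
(* Since e ln r exceeds the integral, F is small somewhere in each [a, r a]. *)
have gen (a : R) : 0 < a -> exists2 x, a <= x <= r * a & `|F x| <= e.
  move=> a0; apply: contrapT => no.
  have : e * (ln (r * a) - ln a) <= C.
    apply: key => //; first by rewrite ltr_pMl.
    move=> x hx; rewrite ltNge; apply/negP => hF'; apply: no.
    by exists x.
  by rewrite lnM ?posrE// addrK leNgt big.
split.
  have [|x /andP[x1 x2] hx] := gen (e / r); first by rewrite divr_gt0.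
  exists x => //; rewrite (lt_le_trans _ x1) ?divr_gt0//=.
  by rewrite (le_trans x2)// mulrC divfK// gt_eqF.
have [|x /andP[x1 _] hx] := gen n.+2%:R; first by rewrite ltr0n.
by exists x.
Qed.

(** Boundary terms vanish as soon as F/x is integrable: this is the form of
    integration by parts needed for x d/dx. *)
Lemma ftc_zero f F :
  (forall x : R, 0 < x -> is_derive x 1 F (f x)) ->
  (forall x : R, 0 < x -> {for x, continuous f}) ->
  integ f -> integ (fun x => F x / x) -> hint f = 0.
Proof.
move=> dF cf hf hF.
have cF (x : R) : 0 < x -> {for x, continuous F}.
  by move=> /dF; exact: derive_cont.
have sm := small_values cF hF.
pose a n := s2val (cid2 (sm n).1); pose b n := s2val (cid2 (sm n).2).
have ha n : 0 < a n <= n.+2%:R^-1 := s2valP (cid2 (sm n).1).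
have hb n : n.+2%:R <= b n := s2valP (cid2 (sm n).2).
have := hint_exhaust ha hb dF cf hf.
suff h : F (b n) - F (a n) @[n --> \oo] --> 0 by move=> c; exact: (cvg_unique _ c h).
rewrite -[0]subr0; apply: cvgB; apply: norm_cvg0.
  apply: (@squeeze_cvgr _ _ _ _ (cst 0) (fun n => n.+2%:R^-1)).
  - by apply: nearW => n; rewrite normr_ge0 (s2valP' (cid2 (sm n).2)).
  - exact: cvg_cst.
  - exact: cvg_natS2V.
apply: (@squeeze_cvgr _ _ _ _ (cst 0) (fun n => n.+2%:R^-1)).
- by apply: nearW => n; rewrite normr_ge0 (s2valP' (cid2 (sm n).1)).
- exact: cvg_cst.
- exact: cvg_natS2V.
Qed.

End HalfLineIntegral.
#[global] Hint Resolve measurable_halfline measurable_halfline_lebesgue : core.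

(** * Tonelli's theorem and square-integrable functions *)

Section Tonelli.
Variable R : realType.
Implicit Types (f g : R -> R) (h : R -> R -> R).
Local Notation mu := (@lebesgue_measure R).
Local Notation D := (@halfline R).
Local Notation RR := (measurableTypeR R * measurableTypeR R)%type.

Definition jmeas h := measurable_fun (D `*` D : set RR) (fun z : RR => h z.1 z.2).

Lemma measurable_quadrant : measurable (D `*` D : set RR).
Proof. exact: measurableX. Qed.
Hint Resolve measurable_quadrant : core.

Lemma jmeasD h1 h2 : jmeas h1 -> jmeas h2 -> jmeas (fun x t => h1 x t + h2 x t).
Proof. exact: measurable_funD. Qed.

Lemma jmeasM h1 h2 : jmeas h1 -> jmeas h2 -> jmeas (fun x t => h1 x t * h2 x t).
Proof. exact: measurable_funM. Qed.

Lemma jmeas1 f : meas f -> jmeas (fun x _ => f x).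
Proof.
move=> mf; apply: (@measurable_comp _ _ _ RR _ R D f _ fst) => //.
- exact: measurable_halfline.
- by move=> _ [z [z1 _] <-].
- exact: measurable_funTS measurable_fst.
Qed.

Lemma jmeas2 f : meas f -> jmeas (fun _ t => f t).
Proof.
move=> mf; apply: (@measurable_comp _ _ _ RR _ R D f _ snd) => //.
- exact: measurable_halfline.
- by move=> _ [z [_ z2] <-].
- exact: measurable_funTS measurable_snd.
Qed.

Lemma jmeas_comp f h : meas f -> jmeas h -> (forall x t, 0 < x -> 0 < t -> 0 < h x t) ->
  jmeas (fun x t => f (h x t)).
Proof.
move=> mf mh h0; apply: (@measurable_comp _ _ _ RR R R D f _ (fun z => h z.1 z.2)) => //.
  exact: measurable_halfline.
by move=> _ [z [z1 z2] <-]; rewrite halflineE h0// -halflineE.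
Qed.

Lemma jmeasC h : jmeas h -> jmeas (fun x t => h t x).
Proof.
move=> mh; apply: (@measurable_comp _ _ _ RR RR R (D `*` D) (fun z => h z.1 z.2) _
  (fun z => (z.2, z.1))) => //.
  by move=> _ [z [z1 z2] <-].
by apply: measurable_funTS; apply: measurable_fun_pair; [exact: measurable_snd|exact: measurable_fst].
Qed.

(** Extension by 0, Fubini's theorem being about integrals over the whole plane. *)
Let ext0 h (z : RR) : \bar R :=
  ((EFin \o (fun z : RR => h z.1 z.2)) \_ (D `*` D)) z.

Let ext0E h x t : ext0 h (x, t) = (if (x \in D) && (t \in D) then (h x t)%:E else 0)%E.
Proof. by rewrite /ext0 patchE in_setX. Qed.

Let measurable_ext0 h : jmeas h -> measurable_fun setT (ext0 h).
Proof.
move=> mh.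
have mE : measurable_fun (D `*` D : set RR) (EFin \o (fun z : RR => h z.1 z.2)).
  by apply: measurableT_comp => //; exact: mh.
exact: (iffLR (measurable_restrictT _ measurable_quadrant) mE).
Qed.

Let ext0_ge0 h z : (forall x t, 0 < x -> 0 < t -> 0 <= h x t) -> (0 <= ext0 h z)%E.
Proof.
move=> h0; case: z => x t; rewrite ext0E.
by case: ifP => // /andP[/in_halfline ? /in_halfline ?]; rewrite lee_fin h0.
Qed.

Let integral_ext0_2 h x : x \in D ->
  (\int[mu]_t ext0 h (x, t) = \int[mu]_(t in D) (h x t)%:E)%E.
Proof.
move=> xD; rewrite [RHS]integral_mkcond; apply: eq_integral => t _.
by rewrite ext0E xD patchE.
Qed.

Lemma tonelli h : jmeas h -> (forall x t, 0 < x -> 0 < t -> 0 <= h x t) ->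
  (\int[mu]_(x in D) \int[mu]_(t in D) (h x t)%:E =
   \int[mu]_(t in D) \int[mu]_(x in D) (h x t)%:E)%E.
Proof.
move=> mh h0.
have := fubini_tonelli (m1 := mu) (m2 := mu) (ext0 h) (measurable_ext0 mh)
  (fun z => ext0_ge0 z h0).
rewrite [LHS](_ : _ = (\int[mu]_(x in D) \int[mu]_(t in D) (h x t)%:E)%E); last first.
  rewrite [RHS]integral_mkcond; apply: eq_integral => x _; rewrite patchE.
  case: ifPn => xD; first exact: integral_ext0_2.
  by rewrite integral0_eq// => t _; rewrite ext0E (negbTE xD).
move=> ->; rewrite [RHS]integral_mkcond; apply: eq_integral => x _; rewrite patchE.
case: ifPn => xD.
  rewrite [RHS]integral_mkcond; apply: eq_integral => t _.
  by rewrite ext0E xD patchE andbT.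
by rewrite integral0_eq// => t _; rewrite ext0E (negbTE xD) andbF.
Qed.

Lemma meas_fubini h : jmeas h -> (forall x t, 0 < x -> 0 < t -> 0 <= h x t) ->
  (forall x, 0 < x -> integ (h x)) -> meas (fun x => hint (h x)).
Proof.
move=> mh h0 ih.
have := @measurable_fun_fubini_tonelli_F _ _ (measurableTypeR R) (measurableTypeR R) R
  mu (ext0 h) (measurable_ext0 mh) (fun z => ext0_ge0 z h0).
move/(measurable_funTS (D := D)) => m.
have {}m : measurable_fun (D : set (measurableTypeR R)) (EFin \o (fun x => hint (h x))).
  apply: eq_measurable_fun m => x xD; rewrite /fubini_F integral_ext0_2//=.
  by rewrite EFin_hint//; apply/ih/in_halfline.
exact/measurable_EFinP.
Qed.

(** Tonelli's theorem with real-valued integrals: integrability of one iterated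
    integral is an output, which makes the exchange usable to prove that an
    operator is bounded. *)
Lemma tonelli_hint h : jmeas h -> (forall x t, 0 < x -> 0 < t -> 0 <= h x t) ->
  (forall x, 0 < x -> integ (h x)) -> (forall t, 0 < t -> integ (fun x => h x t)) ->
  integ (fun t => hint (fun x => h x t)) ->
  integ (fun x => hint (h x)) /\
  hint (fun x => hint (h x)) = hint (fun t => hint (fun x => h x t)).
Proof.
move=> mh h0 ih1 ih2 ih.
have T := tonelli mh h0.
have E1 : (\int[mu]_(x in D) \int[mu]_(t in D) (h x t)%:E =
    \int[mu]_(x in D) (hint (h x))%:E)%E.
  by apply: eq_integral => x /in_halfline x0; rewrite EFin_hint//; exact: ih1.
have E2 : (\int[mu]_(t in D) \int[mu]_(x in D) (h x t)%:E =
    \int[mu]_(t in D) (hint (fun x => h x t))%:E)%E.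
  by apply: eq_integral => t /in_halfline t0; rewrite EFin_hint//; exact: ih2.
have i1 : integ (fun x => hint (h x)).
  apply: integ_ge0P; first exact: meas_fubini.
    by move=> x x0; apply: hint_ge0 => t t0; exact: h0.
  by rewrite -E1 T E2 -(EFin_hint ih) ltry.
by split; [exact: i1|]; move: T; rewrite E1 E2 -(EFin_hint i1) -(EFin_hint ih) => -[].
Qed.

End Tonelli.

Section SquareIntegrable.
Variable R : realType.
Implicit Types (f g : R -> R).

Definition sqint f := meas f /\ integ (fun x => f x ^+ 2).
Definition inner f g := hint (fun x => f x * g x).
Definition sqnorm f := hint (fun x => f x ^+ 2).

Lemma inner_sqnorm f : inner f f = sqnorm f.
Proof. by apply: hint_ext => x _; rewrite expr2. Qed.

Lemma innerC f g : inner f g = inner g f.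
Proof. by apply: hint_ext => x _; rewrite mulrC. Qed.

Lemma sqint_ext f g : (forall x, 0 < x -> f x = g x) -> sqint f -> sqint g.
Proof.
move=> fg [mf hf]; split; first exact: meas_ext mf.
by apply: integ_ext hf => x x0; rewrite fg.
Qed.

Lemma sqnorm_ext f g : (forall x, 0 < x -> f x = g x) -> sqnorm f = sqnorm g.
Proof. by move=> fg; apply: hint_ext => x x0; rewrite fg. Qed.

Lemma sqnorm_ge0 f : 0 <= sqnorm f.
Proof. by apply: hint_ge0 => x _; exact: sqr_ge0. Qed.

Lemma sqintM f g : sqint f -> sqint g -> integ (fun x => f x * g x).
Proof.
move=> [mf hf] [mg hg]; apply: integ_le (integD hf hg); first exact: measM.
move=> x _; rewrite normrM -(real_normK (num_real (f x))) -(real_normK (num_real (g x))).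
have := sqr_ge0 (`|f x| - `|g x|); have := sqr_ge0 (`|f x| + `|g x|); nra.
Qed.

Lemma sqint0 : sqint (fun=> 0).
Proof.
by split; [exact: meas_cst|apply: integ_ext (integ0 R) => x _; rewrite expr0n].
Qed.

Lemma sqintZ k f : sqint f -> sqint (fun x => k * f x).
Proof.
move=> [mf hf]; split; first exact: measM (meas_cst k) mf.
by apply: integ_ext (integZ (k ^+ 2) hf) => x _; rewrite exprMn.
Qed.

Lemma sqintD f g : sqint f -> sqint g -> sqint (fun x => f x + g x).
Proof.
move=> sf sg; have [mf hf] := sf; have [mg hg] := sg.
split; first exact: measD.
have := integD (integD hf (integZ 2 (sqintM sf sg))) hg.
by apply: integ_ext => x _; rewrite sqrrD; ring.
Qed.

Lemma sqintB f g : sqint f -> sqint g -> sqint (fun x => f x - g x).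
Proof.
move=> sf sg; have := sqintD sf (sqintZ (-1) sg).
by apply: sqint_ext => x _; rewrite mulN1r.
Qed.

Lemma sqint_sum n (f : nat -> R -> R) : (forall k, (k < n)%N -> sqint (f k)) ->
  sqint (fun x => \sum_(k < n) f k x).
Proof.
elim: n => [|n IH] hf.
  by apply: sqint_ext sqint0 => x _; rewrite big_ord0.
have := sqintD (IH (fun k kn => hf k (ltnW kn))) (hf n (ltnSn n)).
by apply: sqint_ext => x _; rewrite big_ord_recr.
Qed.

Lemma sqint_le f g : meas f -> (forall x, 0 < x -> `|f x| <= g x) -> sqint g -> sqint f.
Proof.
move=> mf fg [mg hg]; split => //; apply: integ_le hg; first exact: measX.
move=> x x0; rewrite normrX; apply: lerXn2r; rewrite ?nnegrE ?fg//.
by rewrite (le_trans _ (fg _ x0)).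
Qed.

Lemma sqint_norm f : sqint f -> sqint (fun x => `|f x|).
Proof.
move=> [mf hf]; split; first exact: meas_norm.
by apply: integ_ext hf => x _; rewrite real_normK ?num_real.
Qed.

Lemma sqnormZ k f : sqint f -> sqnorm (fun x => k * f x) = k ^+ 2 * sqnorm f.
Proof.
move=> [_ hf]; rewrite /sqnorm -hintZ//.
by apply: hint_ext => x _; rewrite exprMn.
Qed.

Lemma innerZl k f h : sqint f -> sqint h -> inner (fun x => k * f x) h = k * inner f h.
Proof.
move=> sf sh; rewrite /inner -hintZ; last exact: sqintM.
by apply: hint_ext => x _; rewrite mulrA.
Qed.

Lemma inner_suml n (f : nat -> R -> R) h : (forall k, (k < n)%N -> sqint (f k)) ->
  sqint h -> inner (fun x => \sum_(k < n) f k x) h = \sum_(k < n) inner (f k) h.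
Proof.
move=> sf sh; rewrite /inner -(hint_sum (f := fun k x => f k x * h x)).
  by apply: hint_ext => x _; rewrite mulr_suml.
by move=> k kn; apply: sqintM sh; exact: sf.
Qed.

Lemma sqnormD f g : sqint f -> sqint g ->
  sqnorm (fun x => f x + g x) = sqnorm f + 2 * inner f g + sqnorm g.
Proof.
move=> sf sg; have fg := sqintM sf sg; have [_ hf] := sf; have [_ hg] := sg.
have i2 := integZ 2 fg; have i12 := integD hf i2.
rewrite /sqnorm /inner -(hintZ 2 fg) -(hintD hf i2) -(hintD i12 hg).
by apply: hint_ext => x _; rewrite sqrrD; ring.
Qed.

Lemma sqnormB f g : sqint f -> sqint g ->
  sqnorm (fun x => f x - g x) = sqnorm f - 2 * inner f g + sqnorm g.
Proof.
move=> sf sg; rewrite (@sqnorm_ext _ (fun x => f x + (-1) * g x)); last first.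
  by move=> x _; rewrite mulN1r.
rewrite sqnormD ?sqnormZ//; last exact: sqintZ.
by rewrite innerC innerZl// innerC; ring.
Qed.

Lemma sqnormD_le f g : sqint f -> sqint g ->
  sqnorm (fun x => f x + g x) <= 2 * sqnorm f + 2 * sqnorm g.
Proof.
by move=> sf sg; have := sqnorm_ge0 (fun x => f x - g x); rewrite sqnormB// sqnormD//; lra.
Qed.

Lemma sqnormB_le f g : sqint f -> sqint g ->
  sqnorm (fun x => f x - g x) <= 2 * sqnorm f + 2 * sqnorm g.
Proof.
by move=> sf sg; have := sqnorm_ge0 (fun x => f x + g x); rewrite sqnormB// sqnormD//; lra.
Qed.

Lemma cauchy_schwarz f g : sqint f -> sqint g -> inner f g ^+ 2 <= sqnorm f * sqnorm g.
Proof.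
move=> sf sg.
have q k : 0 <= sqnorm f + 2 * (k * inner f g) + k ^+ 2 * sqnorm g.
  have := sqnorm_ge0 (fun x => f x + k * g x).
  by rewrite sqnormD ?sqnormZ//; [rewrite innerC innerZl// innerC|exact: sqintZ].
have [g0|g0] := ltP 0 (sqnorm g).
  have := q (- inner f g / sqnorm g); set a := inner f g; set G := sqnorm g in g0 *.
  rewrite -(pmulr_lge0 _ g0).
  have -> : (sqnorm f + 2 * (- a / G * a) + (- a / G) ^+ 2 * G) * G = sqnorm f * G - a ^+ 2.
    by field; rewrite gt_eqF.
  by rewrite subr_ge0.
have {g0} g0 : sqnorm g = 0 by apply/eqP; rewrite eq_le g0 sqnorm_ge0.
rewrite g0 mulr0; move: q; rewrite g0.
set a := inner f g => q; have [->|a0] := eqVneq a 0; first by rewrite expr0n.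
have := q (- (sqnorm f + 1) / (2 * a)); rewrite mulr0 addr0.
have -> : sqnorm f + 2 * (- (sqnorm f + 1) / (2 * a) * a) = -1 by field.
by rewrite oppr_ge0 ler10.
Qed.

Lemma inner_sqnorm_0 f g : sqint f -> sqint g -> sqnorm f = 0 -> inner f g = 0.
Proof.
move=> sf sg f0; apply/eqP; rewrite -sqrf_eq0 eq_le sqr_ge0 andbT.
by have := cauchy_schwarz sf sg; rewrite f0 mul0r.
Qed.

End SquareIntegrable.

(** * Operators with homogeneous kernels *)

Section KernelOperators.
Variable R : realType.
Implicit Types (f g : R -> R) (P : {poly R}) (x t : R).

(** The kernels homogeneous of degree -1 of the form P(x/(x+t)) / (x+t): a family
    stable under theta = x d/dx + 1/2, which acts on it by theta P. *)
Definition ker P x t : R := P.[x / (x + t)] / (x + t).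
Definition sop P f x : R := hint (fun t => ker P x t * f t).
Definition pabs P : R := \sum_(i < size P) `|P`_i|.
(** Derivation of x/(x+t) with respect to log x is Q = X - X^2, and the factor
    1/(x+t) contributes - X. *)
Definition theta P : {poly R} := P^`() * ('X - 'X^2) - 'X * P + 2^-1 *: P.

Lemma pabs_ge0 P : 0 <= pabs P.
Proof. exact: sumr_ge0. Qed.

Lemma ratio_bounds x t : 0 < x -> 0 < t -> 0 <= x / (x + t) <= 1.
Proof.
move=> x0 t0; have xt : 0 < x + t by exact: addr_gt0.
by apply/andP; split; rewrite ?ler_pdivrMr ?divr_ge0//; lra.
Qed.

Lemma horner_pabs P (y : R) : 0 <= y <= 1 -> `|P.[y]| <= pabs P.
Proof.
move=> /andP[y0 y1]; rewrite horner_coef; apply: le_trans (ler_norm_sum _ _ _) _.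
apply: ler_sum => i _; rewrite normrM normrX (ger0_norm y0).
by rewrite ler_piMr// exprn_ile1.
Qed.

Lemma ker_bound P x t : 0 < x -> 0 < t -> `|ker P x t| <= pabs P / (x + t).
Proof.
move=> x0 t0; have xt : 0 < x + t by exact: addr_gt0.
rewrite /ker normrM normfV (gtr0_norm xt); apply: ler_wpM2r.
  by rewrite invr_ge0 ltW.
by apply: horner_pabs; exact: ratio_bounds.
Qed.

Lemma kerD P Q x t : ker (P + Q) x t = ker P x t + ker Q x t.
Proof. by rewrite /ker hornerD mulrDl. Qed.

Lemma kerZ k P x t : ker (k *: P) x t = k * ker P x t.
Proof. by rewrite /ker hornerZ mulrA. Qed.

Lemma ker_theta P x t : ker (theta P) x t =
  ((P^`()).[x / (x + t)] * (x / (x + t) - (x / (x + t)) ^+ 2)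
   - (x / (x + t)) * P.[x / (x + t)] + 2^-1 * P.[x / (x + t)]) / (x + t).
Proof. by rewrite /ker /theta !hornerE. Qed.

Lemma derive_ker_x P x t : 0 < x -> 0 < t ->
  is_derive x 1 (fun y => ker P y t) ((ker (theta P) x t - ker P x t / 2) / x).
Proof.
move=> x0 t0; have xt : x + t != 0 by rewrite gt_eqF// addr_gt0.
have d1 : is_derive x 1 (fun y => y + t) (1 + 0) := dD (did x) (dcst t x).
have d2 := dV (f := fun y => y + t) xt d1.
have d3 := dM (did x) d2.
have d4 := dcomp (f := horner P) (g := fun y => y / (y + t)) (is_derive_poly P (x / (x + t))) d3.
apply: is_derive_eq (dM d4 d2) _; rewrite ker_theta /ker.
move: (P^`()).[_] P.[_] => a b; field.
by rewrite xt gt_eqF.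
Qed.

Lemma derive_ker_t P x t : 0 < x -> 0 < t ->
  is_derive t 1 (fun s => ker P x s) ((- ker (theta P) x t - ker P x t / 2) / t).
Proof.
move=> x0 t0; have xt : x + t != 0 by rewrite gt_eqF// addr_gt0.
have d1 : is_derive t 1 (fun s => x + s) (0 + 1) := dD (dcst x t) (did t).
have d2 := dV (f := fun s => x + s) xt d1.
have d3 := dZ x d2.
have d4 := dcomp (f := horner P) (g := fun s => x / (x + s)) (is_derive_poly P (x / (x + t))) d3.
apply: is_derive_eq (dM d4 d2) _; rewrite ker_theta /ker.
move: (P^`()).[_] P.[_] => a b; field.
by rewrite xt gt_eqF.
Qed.

Lemma meas_ker P x : 0 < x -> meas (ker P x).
Proof.
by move=> x0; apply: meas_derive => t t0; exact: derive_ker_t.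
Qed.

Lemma meas_inv : meas (fun t : R => t^-1).
Proof.
by apply: meas_cont => t t0; apply: cvgV => //; rewrite gt_eqF.
Qed.

Lemma jmeas_add : jmeas (fun x t : R => x + t).
Proof.
by apply: jmeasD; [apply: jmeas1|apply: jmeas2]; exact: measurable_id.
Qed.

Lemma jmeas_ker P : jmeas (ker P).
Proof.
have m1 : jmeas (fun x t : R => (x + t)^-1).
  apply: (jmeas_comp meas_inv jmeas_add) => x t x0 t0; exact: addr_gt0.
apply: (jmeasM _ m1); apply: (@jmeas_comp _ (horner P) (fun x t => x / (x + t))).
- exact: measurable_poly.
- by apply: (jmeasM _ m1); apply: jmeas1; exact: measurable_id.
- by move=> x t x0 t0; rewrite divr_gt0// addr_gt0.
Qed.

Lemma cvg_addV x : (x + t)^-1 @[t --> +oo] --> 0.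
Proof.
apply/cvgrPdist_le => e e0; near=> t.
have xt : e^-1 <= x + t.
  by rewrite -lerBlDl; near: t; apply: nbhs_pinfty_ge; exact: num_real.
have xt0 : 0 < x + t by apply: lt_le_trans xt; rewrite invr_gt0.
by rewrite sub0r normrN normfV gtr0_norm// invf_ple ?posrE.
Unshelve. all: by end_near. Qed.

Lemma cont_addV x t : 0 <= x -> 0 < x + t ->
  {for t, continuous (fun t : R => (x + t)^-1)}.
Proof.
move=> x0 t0; apply: (derive_cont (df := - (0 + 1) / (x + t) ^+ 2)).
by apply: (dV (f := fun s => x + s) _ (dD (dcst x t) (did t))); rewrite gt_eqF.
Qed.

Lemma sqint_addV x : 0 < x -> sqint (fun t => (x + t)^-1).
Proof.
move=> x0; split.
  by apply: meas_cont => t t0; apply: cont_addV; [exact: ltW|exact: addr_gt0].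
have := @ftc_ge0 R (fun t => (x + t)^-1 ^+ 2) (fun t => - (x + t)^-1) (- x^-1) 0.
case=> //.
- move=> t t0; have xt : x + t != 0 by rewrite gt_eqF// addr_gt0.
  rewrite (_ : (fun _ => _) = fun t => (-1) * (x + t)^-1); last first.
    by apply/funext => s; rewrite mulN1r.
  apply: is_derive_eq (dZ _ (dV (f := fun s => x + s) xt (dD (dcst x t) (did t)))) _.
  by rewrite add0r -exprVn; ring.
- move=> t t0; have xt : 0 < x + t by rewrite addr_gt0.
  by apply: cvgM; apply: cont_addV => //; exact: ltW.
- by move=> t t0; exact: sqr_ge0.
- apply: cvgN; have c0 : {for 0, continuous (fun t : R => (x + t)^-1)}.
    by apply: cont_addV; rewrite ?addr0// ltW.
  by have := cvg_at_right_filter c0; rewrite addr0.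
- by rewrite -oppr0; apply: cvgN; exact: cvg_addV.
Qed.

Lemma sqint_ker P x : 0 < x -> sqint (ker P x).
Proof.
move=> x0; apply: sqint_le (meas_ker P x0) _ (sqintZ (pabs P) (sqint_addV x0)).
by move=> t t0; exact: ker_bound.
Qed.

Lemma integ_ker P f x : sqint f -> 0 < x -> integ (fun t => ker P x t * f t).
Proof. by move=> sf x0; apply: sqintM => //; exact: sqint_ker. Qed.

Lemma sopDl P Q f x : sqint f -> 0 < x -> sop (P + Q) f x = sop P f x + sop Q f x.
Proof.
move=> sf x0; rewrite /sop -hintD; [|exact: integ_ker..].
by apply: hint_ext => t _; rewrite kerD mulrDl.
Qed.

Lemma sopZl k P f x : sqint f -> 0 < x -> sop (k *: P) f x = k * sop P f x.
Proof.
move=> sf x0; rewrite /sop -hintZ; last exact: integ_ker.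
by apply: hint_ext => t _; rewrite kerZ mulrA.
Qed.

Lemma sop0l f x : sop 0 f x = 0.
Proof.
by rewrite -[RHS](hint0 R); apply: hint_ext => t _; rewrite /ker horner0 !mul0r.
Qed.

Lemma sopZr k P f x : sqint f -> 0 < x ->
  sop P (fun t => k * f t) x = k * sop P f x.
Proof.
move=> sf x0; rewrite /sop -hintZ; last exact: integ_ker.
by apply: hint_ext => t _; rewrite mulrCA.
Qed.

Lemma sopBr P f g x : sqint f -> sqint g -> 0 < x ->
  sop P (fun t => f t - g t) x = sop P f x - sop P g x.
Proof.
move=> sf sg x0; rewrite /sop -hintB; [|exact: integ_ker..].
by apply: hint_ext => t _; rewrite mulrBr.
Qed.

Lemma sop_extr P f g x : (forall t, 0 < t -> f t = g t) -> sop P f x = sop P g x.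
Proof. by move=> fg; apply: hint_ext => t t0; rewrite fg. Qed.

(** Differentiation under the integral sign; near x the derivative of the kernel
    is dominated by a multiple of 1/(u+t) with u = x/2. *)
Lemma derive_sop P f x : sqint f -> 0 < x ->
  is_derive x 1 (sop P f) ((sop (theta P) f x - sop P f x / 2) / x).
Proof.
move=> sf x0; have [mf _] := sf.
pose K (y t : R) : R := ker P y t * f t.
pose u : R := x / 2; pose v : R := 2 * x.
have u0 : 0 < u by rewrite divr_gt0.
have inI y : `]u, v[%classic y -> u < y by rewrite /= in_itv /= => /andP[].
pose M := (pabs (theta P) + pabs P / 2) / u.
have M0 : 0 <= M.
  by apply: divr_ge0 (ltW u0); apply: addr_ge0; rewrite ?divr_ge0 ?pabs_ge0.
pose G (t : R) : R := `|M * (u + t)^-1 * f t|.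
have d1 (y t : R) : 0 < y -> 0 < t -> is_derive y 1 (K ^~ t)
    ((ker (theta P) y t - ker P y t / 2) / y * f t).
  move=> y0 t0; apply: is_derive_eq (dM (derive_ker_x P y0 t0) (dcst (f t) y)) _.
  by rewrite mulr0 addr0.
have Ix : `]u, v[%classic x by rewrite /= in_itv /= /u /v; lra.
have iK y : 0 < y -> integ (K y) by move=> y0; exact: integ_ker.
have iG : integ G.
  apply: integ_norm; apply: sqintM => //.
  by apply: sqintZ; exact: sqint_addV.
have h1 y : `]u, v[%classic y -> integ (K y).
  by move=> /inI uy; apply: iK; exact: lt_trans uy.
have h2 y t : `]u, v[%classic y -> halfline t -> derivable (K ^~ t) y 1.
  rewrite halflineE => /inI uy t0.
  by have [] := d1 _ _ (lt_trans u0 uy) t0.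
have h3 y t : `]u, v[%classic y -> halfline t -> `|partial1of2 K y t| <= G t.
  rewrite halflineE => /inI uy t0; have y0 := lt_trans u0 uy.
  rewrite partial1of2E; have [_ ->] := d1 _ _ y0 t0.
  have ut : 0 < u + t by exact: addr_gt0.
  have yt : 0 < y + t by exact: addr_gt0.
  have -> : G t = M * (u + t)^-1 * `|f t|.
    by rewrite /G normrM ger0_norm// divr_ge0// ltW.
  rewrite normrM; apply: ler_wpM2r => //.
  have b1 := ker_bound (theta P) y0 t0; have b2 := ker_bound P y0 t0.
  rewrite normrM [`|y^-1|]gtr0_norm ?invr_gt0//.
  rewrite (@le_trans _ _ ((pabs (theta P) + pabs P / 2) / (u + t) / u))//; last first.
    by rewrite /M mulrAC.
  apply: ler_pM => //; first by rewrite invr_ge0 ltW.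
    2: by rewrite lef_pV2 ?posrE// ltW.
  apply: (@le_trans _ _ ((pabs (theta P) + pabs P / 2) / (y + t))).
    apply: (le_trans (ler_normB _ _)); rewrite mulrDl lerD//.
    rewrite normrM mulrAC [`|2^-1|]gtr0_norm ?invr_gt0// ler_wpM2r//.
  rewrite ler_wpM2l ?addr_ge0 ?pabs_ge0 ?divr_ge0 ?pabs_ge0//.
  by rewrite lef_pV2 ?posrE// lerD2r ltW.
have H := derivable_under_integral (mu := @lebesgue_measure R) (@measurable_halfline_lebesgue R) Ix h1 h2
  (fun t => normr_ge0 _) iG h3.
have E := differentiation_under_integral (mu := @lebesgue_measure R) (@measurable_halfline_lebesgue R) Ix h1 h2
  (fun t => normr_ge0 _) iG h3.
split => //; rewrite -derive1E E.
transitivity (hint (fun t => x^-1 * (ker (theta P) x t * f t - 2^-1 * (ker P x t * f t)))).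
  apply: eq_Rintegral => t /in_halfline t0.
  by rewrite partial1of2E; have [_ ->] := d1 _ _ x0 t0; ring.
have i1 := integ_ker (theta P) sf x0; have i2 := integ_ker P sf x0.
have i3 := integZ 2^-1 i2.
rewrite (hintZ _ (integB i1 i3)) (hintB i1 i3) (hintZ _ i2) /sop; ring.
Qed.

Lemma meas_sop P f : sqint f -> meas (sop P f).
Proof. by move=> sf; apply: meas_derive => x x0; exact: derive_sop. Qed.

End KernelOperators.

(** * The Schur test, and chains of the Euler operator *)

Section Schur.
Variable R : realType.
Implicit Types (f g : R -> R) (P : {poly R}) (x t : R).

Definition rsqrt t : R := (Num.sqrt t)^-1.

Lemma rsqrt_gt0 t : 0 < t -> 0 < rsqrt t.
Proof. by move=> t0; rewrite invr_gt0 sqrtr_gt0. Qed.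

Lemma rsqrtM t : 0 < t -> rsqrt t * Num.sqrt t = 1.
Proof. by move=> t0; rewrite mulVf// gt_eqF// sqrtr_gt0. Qed.

Lemma meas_sqrt : meas (@Num.sqrt R).
Proof. by apply: meas_cont => t t0; exact: sqrt_continuous. Qed.

Lemma cont_rsqrt t : 0 < t -> {for t, continuous rsqrt}.
Proof.
by move=> t0; apply: cvgV; [rewrite gt_eqF// sqrtr_gt0|exact: sqrt_continuous].
Qed.

Lemma meas_rsqrt : meas rsqrt.
Proof. by apply: meas_cont => t t0; exact: cont_rsqrt. Qed.

(** The hypotheses of the Schur test with weight t^(-1/2), which is an
    eigenfunction of every operator whose kernel is homogeneous of degree -1. *)
Definition schur_kernel P (M : R) :=
  [/\ forall x t, 0 < x -> 0 < t -> 0 <= ker P x t,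
      forall x t, 0 < x -> 0 < t -> ker P x t = ker P t x &
      forall x, 0 < x -> integ (fun t => ker P x t * rsqrt t) /\
                         hint (fun t => ker P x t * rsqrt t) = M * rsqrt x].

(** The Schur test: Cauchy-Schwarz for K = (K t^(-1/2))^(1/2) (K t^(1/2))^(1/2)
    bounds (S f)^2 pointwise, and Tonelli's theorem evaluates the integral of
    the bound. *)
Lemma schur_bound P M f : schur_kernel P M -> sqint f ->
  sqint (sop P f) /\ sqnorm (sop P f) <= M ^+ 2 * sqnorm f.
Proof.
move=> [k0 kC kM] sf; have [mf hf] := sf.
pose W x t := ker P x t * Num.sqrt t * f t ^+ 2.
have W0 x t : 0 < x -> 0 < t -> 0 <= W x t.
  move=> x0 t0; apply: mulr_ge0 (sqr_ge0 _); apply: mulr_ge0 (sqrtr_ge0 _).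
    exact: k0.
have mW x : 0 < x -> meas (W x).
  by move=> x0; apply: measM (measX _ mf); apply: measM (meas_ker _ x0) meas_sqrt.
have iW x : 0 < x -> integ (W x).
  move=> x0; apply: integ_le (mW _ x0) _ (integZ (pabs P * (1 + x^-1)) hf) => t t0.
  rewrite ger0_norm ?W0// /W; apply: ler_wpM2r; first exact: sqr_ge0.
  have xt : 0 < x + t by exact: addr_gt0.
  apply: (@le_trans _ _ (pabs P / (x + t) * Num.sqrt t)).
    apply: ler_wpM2r; first exact: sqrtr_ge0.
    by apply: le_trans (ler_norm _) _; exact: ker_bound.
  rewrite -mulrA; apply: ler_wpM2l; first exact: pabs_ge0.
  rewrite mulrC ler_pdivrMr//.
  have : Num.sqrt t <= 1 + t.
    have : Num.sqrt t <= Num.sqrt ((1 + t) ^+ 2).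
      by apply: ler_wsqrtr; have := sqr_ge0 t; nra.
    by rewrite sqrtr_sqr ger0_norm// addr_ge0// ltW.
  move/le_trans; apply.
  have -> : (1 + x^-1) * (x + t) = x + t + 1 + t / x by field; rewrite gt_eqF.
  by have := divr_gt0 t0 x0; lra.
have cs x : 0 < x -> (sop P f x) ^+ 2 <= M * rsqrt x * hint (W x).
  move=> x0; have [i1 e1] := kM _ x0.
  pose u t := Num.sqrt (ker P x t * rsqrt t).
  pose w t := Num.sqrt (ker P x t * Num.sqrt t) * f t.
  have m1 : meas u.
    apply: (measurableT_comp (f := @Num.sqrt R)).
      exact: continuous_measurable_fun (@sqrt_continuous R).
    exact: measM (meas_ker _ x0) meas_rsqrt.
  have m2 : meas (fun t => Num.sqrt (ker P x t * Num.sqrt t)).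
    apply: (measurableT_comp (f := @Num.sqrt R)).
      exact: continuous_measurable_fun (@sqrt_continuous R).
    exact: measM (meas_ker _ x0) meas_sqrt.
  have u2 t : 0 < t -> ker P x t * rsqrt t = u t ^+ 2.
    by move=> t0; rewrite sqr_sqrtr// mulr_ge0 ?k0// ltW// rsqrt_gt0.
  have w2 t : 0 < t -> W x t = w t ^+ 2.
    by move=> t0; rewrite exprMn sqr_sqrtr// mulr_ge0 ?k0// sqrtr_ge0.
  have su : sqint u by split => //; exact: integ_ext u2 i1.
  have sw : sqint w.
    by split; [exact: measM m2 mf|exact: integ_ext w2 (iW _ x0)].
  have := cauchy_schwarz su sw.
  rewrite (_ : sqnorm u = M * rsqrt x); last by rewrite -e1; apply: hint_ext => t /u2.
  rewrite (_ : sqnorm w = hint (W x)); last by apply: hint_ext => t /w2.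
  rewrite (_ : inner u w = sop P f x)//; apply: hint_ext => t t0.
  rewrite /u /w mulrA -sqrtrM; last by rewrite mulr_ge0 ?k0// ltW// rsqrt_gt0.
  rewrite mulrACA rsqrtM// mulr1 -expr2 sqrtr_sqr ger0_norm//; exact: k0.
pose H x t := rsqrt x * W x t.
have H0 x t : 0 < x -> 0 < t -> 0 <= H x t.
  by move=> x0 t0; rewrite mulr_ge0 ?W0// ltW// rsqrt_gt0.
have jH : jmeas H.
  apply: jmeasM; first by apply: jmeas1; exact: meas_rsqrt.
  apply: jmeasM; last by apply: jmeas2; exact: measX.
  by apply: jmeasM; [exact: jmeas_ker|by apply: jmeas2; exact: meas_sqrt].
have inner t : 0 < t -> integ (fun x => H x t) /\ hint (fun x => H x t) = M * f t ^+ 2.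
  move=> t0; have [i1 e1] := kM _ t0.
  pose c := Num.sqrt t * f t ^+ 2.
  have E x : 0 < x -> c * (ker P t x * rsqrt x) = H x t.
    by move=> x0; rewrite /H /W /c (kC t x)//; ring.
  split; first exact: integ_ext E (integZ c i1).
  rewrite -(hint_ext E) hintZ// e1 /c.
  by rewrite mulrC -mulrA [rsqrt t * _]mulrA rsqrtM// mul1r.
have [i1 e1] : integ (fun x => hint (H x)) /\
    hint (fun x => hint (H x)) = hint (fun t => hint (fun x => H x t)).
  apply: tonelli_hint => //.
  - by move=> x x0; apply: integZ; exact: iW.
  - by move=> t /inner[].
  - by apply: integ_ext (integZ M hf) => t /inner[_ ->].
have e2 : hint (fun t => hint (fun x => H x t)) = M * sqnorm f.
  by rewrite -(hintZ M hf); apply: hint_ext => t /inner[_ ->].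
have le x : 0 < x -> sop P f x ^+ 2 <= M * hint (H x).
  by move=> x0; rewrite /H (hintZ _ (iW _ x0)) mulrA; exact: cs.
have s1 : integ (fun x => sop P f x ^+ 2).
  apply: integ_le (integZ M i1); first by apply: measX; exact: meas_sop.
  by move=> x x0; rewrite (ger0_norm (sqr_ge0 _)); exact: le.
split; first by split; [exact: meas_sop|exact: s1].
rewrite expr2 -mulrA -e2 -e1 -(hintZ M i1).
exact: hint_le s1 (integZ M i1) le.
Qed.

End Schur.

Section Chains.
Variable R : realType.
Implicit Types (f g : R -> R) (P : {poly R}) (x t : R) (v w : nat -> R -> R).

(** A chain is a sequence v, theta v, theta^2 v, ... for theta = x d/dx + 1/2.  It is
    kept as a sequence because v k.+1 is usually known in closed form, so that
    no iterated derivative has to be computed. *)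
Definition chain v := forall k x, 0 < x ->
  is_derive x 1 (v k) ((v k.+1 x - v k x / 2) / x).

Definition sqchain v := chain v /\ forall k, sqint (v k).

Lemma chain_shift v n : chain v -> chain (fun k => v (n + k)%N).
Proof. by move=> cv k x x0; rewrite addnS; exact: cv. Qed.

Definition sopchain P f k := sop (iter k (@theta R) P) f.

Lemma sop_chain P f : sqint f -> chain (sopchain P f).
Proof. by move=> sf k x x0; exact: derive_sop. Qed.

(** (x u v)' = theta u * v + u * theta v, and the integral of the left-hand side
    vanishes because x u v, divided by x, is integrable. *)
Lemma theta_skew (u u' v v' : R -> R) :
  (forall x, 0 < x -> is_derive x 1 u ((u' x - u x / 2) / x)) ->
  (forall x, 0 < x -> is_derive x 1 v ((v' x - v x / 2) / x)) ->
  (forall x, 0 < x -> {for x, continuous u'}) ->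
  (forall x, 0 < x -> {for x, continuous v'}) ->
  sqint u -> sqint u' -> sqint v -> sqint v' ->
  inner u' v = - inner u v'.
Proof.
move=> du dv cu' cv' su su' sv sv'.
pose F x := x * (u x * v x); pose f x := u' x * v x + u x * v' x.
have dF x : 0 < x -> is_derive x 1 F (f x).
  move=> x0; apply: is_derive_eq (dM (did x) (dM (du _ x0) (dv _ x0))) _.
  by rewrite /f; field; rewrite gt_eqF.
have cf x : 0 < x -> {for x, continuous f}.
  move=> x0; apply: cvgD; apply: cvgM.
  - exact: cu'.
  - exact: derive_cont (dv _ x0).
  - exact: derive_cont (du _ x0).
  - exact: cv'.
have i1 := sqintM su' sv; have i2 := sqintM su sv'.
have := ftc_zero dF cf (integD i1 i2).
rewrite /f hintD// => h; apply/eqP; rewrite -addr_eq0; apply/eqP; apply: h.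
apply: integ_ext (sqintM su sv) => x x0.
by rewrite /F mulrAC divff ?gt_eqF// mul1r.
Qed.

Lemma chain_cont v k x : chain v -> 0 < x -> {for x, continuous (v k)}.
Proof. by move=> cv x0; exact: derive_cont (cv k x x0). Qed.

Lemma chain_skew v w i j : sqchain v -> sqchain w -> inner (v i.+1) (w j) = - inner (v i) (w j.+1).
Proof.
move=> [cv sv] [cw sw].
have c1 x : 0 < x -> {for x, continuous (v i.+1)} := @chain_cont _ _ x cv.
have c2 x : 0 < x -> {for x, continuous (w j.+1)} := @chain_cont _ _ x cw.
exact: (theta_skew (cv i) (cw j) c1 c2 (sv i) (sv i.+1) (sw j) (sw j.+1)).
Qed.

(** Integration by parts in t: a kernel homogeneous of degree -1 is sent by theta
    in x and by theta in t to opposite functions, so that these operators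
    commute with theta. *)
Lemma sop_theta P v x : sqchain v -> 0 < x -> sop P (v 1%N) x = sop (theta P) (v 0%N) x.
Proof.
move=> [cv sv] x0; have sk Q := sqint_ker Q x0.
have dk t : 0 < t -> is_derive t 1 (ker P x) ((- ker (theta P) x t - ker P x t / 2) / t).
  by move=> t0; exact: derive_ker_t.
have c1 t : 0 < t -> {for t, continuous (fun t => - ker (theta P) x t)}.
  by move=> t0; apply: cvgN; exact: derive_cont (derive_ker_t _ x0 t0).
have c2 t : 0 < t -> {for t, continuous (v 1%N)} := @chain_cont _ _ t cv.
have s1 : sqint (fun t => - ker (theta P) x t).
  by apply: sqint_ext (sqintZ (-1) (sk (theta P))) => t _; rewrite mulN1r.
have := theta_skew dk (cv 0%N) c1 c2 (sk P) s1 (sv 0%N) (sv 1%N).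
rewrite -[inner (ker P x) _]/(sop P (v 1%N) x) => h; apply: oppr_inj; rewrite -h.
rewrite -mulN1r -(hintZ (-1) (integ_ker (theta P) (sv 0%N) x0)).
by apply: hint_ext => t _; rewrite mulN1r mulNr.
Qed.

Lemma sqchain_shift v n : sqchain v -> sqchain (fun k => v (n + k)%N).
Proof. by move=> [cv sv]; split => //; exact: chain_shift. Qed.

Lemma sop_iter_theta P v k x : sqchain v -> 0 < x ->
  sop P (v k) x = sopchain P (v 0%N) k x.
Proof.
elim: k v P => [//|k IH] v P sv x0.
have := IH (fun j => v (1 + j)%N) P (sqchain_shift 1 sv) x0.
rewrite add1n => ->; rewrite /sopchain /= sop_theta//.
Qed.

End Chains.

(** * The Euler product of the cosine acting on the Carleman kernel *)

Section ThetaAlgebra.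
Variable R : realType.
Implicit Types (f g : R -> R) (P p q : {poly R}) (x t : R) (v w : nat -> R -> R).

Lemma thetaD P P' : theta (P + P') = theta P + theta P' :> {poly R}.
Proof. by rewrite /theta derivD scalerDr; ring. Qed.

Lemma thetaZ k P : theta (k *: P) = k *: theta P :> {poly R}.
Proof. by rewrite /theta derivZ -!mul_polyC; ring. Qed.

Lemma theta0 : theta 0 = 0 :> {poly R}.
Proof. by rewrite -[0](scale0r 0) thetaZ !scale0r. Qed.

Lemma theta_sum n (P : 'I_n -> {poly R}) :
  theta (\sum_i P i) = \sum_i theta (P i) :> {poly R}.
Proof. by elim/big_ind2: _ => [|A B A' B' <- <-|//]; [exact: theta0|rewrite thetaD]. Qed.

(** p(theta), on the polynomial P that represents a kernel and on a chain v. *)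
Definition opact p P : {poly R} := \sum_(j < size p) p`_j *: iter j (@theta R) P.

Definition act p v x : R := \sum_(j < size p) p`_j * v j x.

Lemma opactE n p P : (size p <= n)%N ->
  opact p P = \sum_(j < n) p`_j *: iter j (@theta R) P.
Proof.
move=> pn; rewrite /opact (big_ord_widen n (fun j => p`_j *: iter j (@theta R) P))//.
rewrite big_mkcond /=; apply: eq_bigr => j _; case: ltnP => // pj.
by rewrite nth_default// scale0r.
Qed.

Lemma actE n p v x : (size p <= n)%N -> act p v x = \sum_(j < n) p`_j * v j x.
Proof.
move=> pn; rewrite /act (big_ord_widen n (fun j => p`_j * v j x))//.
rewrite big_mkcond /=; apply: eq_bigr => j _; case: ltnP => // pj.
by rewrite nth_default// mul0r.
Qed.

Lemma opactD p q P : opact (p + q) P = opact p P + opact q P.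
Proof.
set n := maxn (size p) (size q).
rewrite (@opactE n (p + q)) ?size_polyD// (@opactE n p) ?leq_maxl//.
rewrite (@opactE n q) ?leq_maxr// -big_split /=.
by apply: eq_bigr => j _; rewrite coefD scalerDl.
Qed.

Lemma actD p q v x : act (p + q) v x = act p v x + act q v x.
Proof.
set n := maxn (size p) (size q).
rewrite (@actE n (p + q)) ?size_polyD// (@actE n p) ?leq_maxl//.
rewrite (@actE n q) ?leq_maxr// -big_split /=.
by apply: eq_bigr => j _; rewrite coefD mulrDl.
Qed.

Lemma actZ k p v x : act (k *: p) v x = k * act p v x.
Proof.
rewrite (@actE (size p)) ?size_scale_leq// /act mulr_sumr.
by apply: eq_bigr => j _; rewrite coefZ mulrA.
Qed.

Lemma actB p q v x : act (p - q) v x = act p v x - act q v x.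
Proof. by rewrite -scaleN1r actD actZ mulN1r. Qed.

Lemma act0 v x : act 0 v x = 0.
Proof. by rewrite /act size_poly0 big_ord0. Qed.

Lemma act_sum n (p : 'I_n -> {poly R}) v x :
  act (\sum_i p i) v x = \sum_i act (p i) v x.
Proof.
by elim/big_rec2: _ => [|i a b _ <-]; [exact: act0|rewrite actD].
Qed.

Lemma opactC c P : opact c%:P P = c *: P.
Proof. by rewrite (@opactE 1) ?size_polyC_leq1// big_ord1 coefC. Qed.

Lemma opactZr k p P : opact p (k *: P) = k *: opact p P.
Proof.
rewrite /opact scaler_sumr; apply: eq_bigr => j _.
have -> : iter j (@theta R) (k *: P) = k *: iter j (@theta R) P.
  by elim: (nat_of_ord j) => //= n ->; rewrite thetaZ.
by rewrite !scalerA mulrC.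
Qed.

Lemma opactZ k p P : opact (k *: p) P = k *: opact p P.
Proof.
rewrite (@opactE (size p)) ?size_scale_leq// /opact scaler_sumr.
by apply: eq_bigr => j _; rewrite coefZ scalerA.
Qed.

Lemma opactMX p P : opact (p * 'X) P = theta (opact p P).
Proof.
rewrite (@opactE (size p).+1); last by rewrite (leq_trans (size_polyMleq _ _))// size_polyX addn2.
rewrite big_ord_recl /= coefMX eqxx scale0r add0r /opact theta_sum.
by apply: eq_bigr => j _; rewrite coefMX /= thetaZ.
Qed.

Lemma opactM p q P : opact (p * q) P = opact q (opact p P).
Proof.
elim/poly_ind: q => [|q c IH].
  by rewrite mulr0 /opact size_poly0 !big_ord0.
rewrite mulrDr mulrA opactD opactMX IH [p * _]mulrC mul_polyC opactZ.
by rewrite [RHS]opactD opactMX opactC.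
Qed.

Lemma sop_opact p P f x : sqint f -> 0 < x ->
  sop (opact p P) f x = act p (sopchain P f) x.
Proof.
move=> sf x0; rewrite /opact /act.
elim/big_rec2: _ => [|i a b _ <-]; first exact: sop0l.
by rewrite sopDl// sopZl.
Qed.

Lemma sqint_act p v : (forall k, sqint (v k)) -> sqint (act p v).
Proof.
by move=> sv; apply: (sqint_sum (f := fun k x => p`_k * v k x)) => k _; exact: sqintZ.
Qed.

Lemma sop_act p P v x : sqchain v -> 0 < x ->
  sop P (act p v) x = sop (opact p P) (v 0%N) x.
Proof.
move=> cv x0; have sv := cv.2; rewrite sop_opact// /act.
transitivity (\sum_(j < size p) p`_j * sop P (v j) x); last first.
  by apply: eq_bigr => j _; rewrite sop_iter_theta.
have i k : integ (fun t => ker P x t * (p`_k * v k t)).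
  by apply: integ_ker => //; exact: sqintZ.
transitivity (hint (fun t => \sum_(k < size p) ker P x t * (p`_k * v k t))).
  by apply: hint_ext => t _; rewrite mulr_sumr.
rewrite (hint_sum (f := fun k t => ker P x t * (p`_k * v k t)))//.
by apply: eq_bigr => j _; rewrite -(sopZr _ _ (sv j) x0).
Qed.

(** Q^n represents the kernel x^n t^n / (x+t)^(2n+1). *)
Definition Q : {poly R} := 'X - 'X^2.

Lemma theta_Q n : theta (Q ^+ n) = (n%:R + 2^-1) *: ((1 - 'X *+ 2) * Q ^+ n).
Proof.
have dQ : Q^`() = 1 - 'X *+ 2 by rewrite /Q derivB derivX derivXn.
have e : (Q ^+ n)^`() * Q = n%:R * (1 - 'X *+ 2) * Q ^+ n.
  rewrite deriv_exp dQ -mulr_natl; case: n => [|n]; first by rewrite !mul0r.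
  by rewrite [in RHS]exprS; ring.
rewrite /theta -/Q e -!mul_polyC polyCD.
have -> : (n%:R%:P : {poly R}) = n%:R by rewrite -polyC_natr.
have h : (2^-1 : R)%:P *+ 2 = 1 :> {poly R}.
  have e2 : 2^-1 *+ 2 = 1 :> R by rewrite mulr2n; lra.
  by rewrite -polyCMn e2.
transitivity ((n%:R * (1 - 'X *+ 2) - ((2^-1)%:P *+ 2) * 'X + (2^-1)%:P) * Q ^+ n).
  by rewrite h; ring.
by ring.
Qed.

(** On Q^n the operator theta^2 - (n + 1/2)^2 only raises the exponent.  This
    recursion is what turns the Euler product of the cosine into a sequence of
    kernels concentrating on the diagonal. *)
Lemma theta2_Q n : theta (theta (Q ^+ n)) =
  (n%:R + 2^-1) ^+ 2 *: Q ^+ n - ((n.*2.+1)%:R * (n.*2.+2)%:R) *: Q ^+ n.+1.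
Proof.
rewrite theta_Q thetaZ.
have dQ : (1 - 'X *+ 2 : {poly R})^`() = - 2%:R.
  by rewrite derivB derivMn derivX -polyC1 derivC sub0r.
have -> : theta ((1 - 'X *+ 2) * Q ^+ n) =
    - 2%:R * Q ^+ n.+1 + (1 - 'X *+ 2) * theta (Q ^+ n).
  by rewrite /theta derivM dQ [Q ^+ n.+1]exprS -!mul_polyC -/Q; ring.
rewrite theta_Q -!mul_polyC [Q ^+ n.+1]exprS.
have -> : ((n%:R + 2^-1) ^+ 2)%:P = (n%:R + 2^-1)%:P * (n%:R + 2^-1)%:P :> {poly R}.
  by rewrite -polyCM -expr2.
set a := (n%:R + 2^-1 : R).
have -> : (n.*2.+1)%:R * (n.*2.+2)%:R = a * (4 * a + 2).
  by rewrite /a -[n.*2.+2]addn2 -[n.*2.+1]addn1 !natrD -muln2 natrM; field.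
have -> : (a * (4 * a + 2))%:P = a%:P * (4%:P * a%:P + 2%:P) :> {poly R}.
  by rewrite -polyCM -polyCD -polyCM.
have -> : (4%:R%:P : {poly R}) = 4%:R by rewrite -polyC_natr.
have -> : (2%:R%:P : {poly R}) = 2%:R by rewrite -polyC_natr.
move: (Q ^+ n) => S; rewrite /Q; ring.
Qed.

(** The ratio of the n-th partial Euler product applied to 1/(x+t) to the kernel
    x^n t^n / (x+t)^(2n+1). *)
Fixpoint Cn n : R := if n is k.+1 then Cn k * (8 * k.+1%:R / (k.*2.+1)%:R) else 1.

Lemma Cn_gt0 n : 0 < Cn n.
Proof. by elim: n => //= n IH; rewrite mulr_gt0// divr_gt0// mulr_gt0. Qed.

(** eprod n is the n-th partial Euler product of cos(pi X). *)
Definition efac n : {poly R} := 1 - ((n%:R + 2^-1) ^- 2) *: 'X^2.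
Definition eprod n : {poly R} := \prod_(k < n) efac k.

Lemma opact_efac n P : opact (efac n) P = P - ((n%:R + 2^-1) ^- 2) *: theta (theta P).
Proof.
rewrite /efac -polyC1 -scaleNr -mul_polyC expr2 mulrA opactD !opactMX !opactC scale1r.
by rewrite !thetaZ scaleNr.
Qed.

Lemma half_neq0 n : n%:R + 2^-1 != 0 :> R.
Proof. by rewrite gt_eqF// ltr_wpDl. Qed.

Lemma Cn_step n : Cn n.+1 = Cn n * ((n.*2.+1)%:R * (n.*2.+2)%:R / (n%:R + 2^-1) ^+ 2).
Proof.
rewrite /= -[n.*2.+2]addn2 -[n.*2.+1]addn1 -[n.+1]addn1 !natrD -muln2 natrM; field.
have h := half_neq0 n; have h2 : n%:R * 2 + 1 != 0 :> R by rewrite gt_eqF// ltr_wpDl// mulr_ge0.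
by rewrite h2 /=.
Qed.

Lemma opact_eprod n : opact (eprod n) 1 = Cn n *: Q ^+ n.
Proof.
elim: n => [|n IH].
  by rewrite /eprod big_ord0 -polyC1 opactC expr0.
rewrite Cn_step /eprod big_ord_recr /= -/(eprod n) opactM IH opactZr opact_efac theta2_Q.
rewrite -(scalerA (Cn n)); congr (_ *: _).
rewrite scalerBr scalerA mulVf ?expf_neq0 ?half_neq0// scale1r opprB addrCA subrr addr0.
by rewrite scalerA mulrC.
Qed.

End ThetaAlgebra.

Section Mass.
Variable R : realType.
Implicit Types (f g : R -> R) (P : {poly R}) (x t : R).
Local Notation rsqrt := (@rsqrt R).
Local Notation Q := (Q R).
Local Notation Cn := (@Cn R).

Lemma derive_sqrt t : 0 < t -> is_derive t 1 (@Num.sqrt R) (rsqrt t / 2).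
Proof.
move=> t0; apply: is_derive_eq (is_derive1_sqrt t0) _.
by rewrite /rsqrt invfM mulrC.
Qed.

Lemma sqrtV t : 0 < t -> Num.sqrt t / t = rsqrt t.
Proof.
move=> t0; rewrite -{2}[t]sqr_sqrtr ?ltW// expr2 invfM mulrA mulfV ?mul1r//.
by rewrite gt_eqF// sqrtr_gt0.
Qed.

Lemma horner_Q x t : 0 < x -> 0 < t -> Q.[x / (x + t)] = x * t / (x + t) ^+ 2.
Proof.
move=> x0 t0; have xt : x + t != 0 by rewrite gt_eqF// addr_gt0.
by rewrite /Q !hornerE; field.
Qed.

Lemma ker_Q n x t : 0 < x -> 0 < t ->
  ker (Q ^+ n) x t = (x * t / (x + t) ^+ 2) ^+ n / (x + t).
Proof. by move=> x0 t0; rewrite /ker horner_exp horner_Q. Qed.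

Lemma ker_Q_ge0 n x t : 0 < x -> 0 < t -> 0 <= ker (Q ^+ n) x t.
Proof.
move=> x0 t0; rewrite ker_Q//.
have xt : 0 < x + t by exact: addr_gt0.
by rewrite divr_ge0 ?exprn_ge0 ?divr_ge0 ?mulr_ge0 ?exprn_ge0 ?ltW.
Qed.

Lemma ker1 x t : ker 1 x t = (x + t)^-1.
Proof. by rewrite /ker hornerC mul1r. Qed.

Lemma ker_QC n x t : 0 < x -> 0 < t -> ker (Q ^+ n) x t = ker (Q ^+ n) t x.
Proof. by move=> x0 t0; rewrite !ker_Q// [t + x]addrC [t * x]mulrC. Qed.

(** The primitive is an arctangent of sqrt (t/x). *)
Lemma mass_cauchy x : 0 < x -> integ (fun t => ker 1 x t * rsqrt t) /\
  hint (fun t => ker 1 x t * rsqrt t) = pi * rsqrt x.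
Proof.
move=> x0; have r0 := rsqrt_gt0 x0.
pose F t := 2 * rsqrt x * atan (rsqrt x * Num.sqrt t).
have := @ftc_ge0 R (fun t => ker 1 x t * rsqrt t) F 0 (2 * rsqrt x * (pi / 2)).
have -> : 2 * rsqrt x * (pi / 2) - 0 = pi * rsqrt x by rewrite subr0; field.
apply.
- move=> t t0; have d1 := dZ (rsqrt x) (derive_sqrt t0).
  have d2 := dcomp (f := @atan R) (g := fun t => rsqrt x * Num.sqrt t) (is_derive1_atan _) d1.
  apply: is_derive_eq (dZ (2 * rsqrt x) d2) _; rewrite ker1 exprMn sqr_sqrtr ?ltW//.
  have -> : rsqrt x ^+ 2 = x^-1 by rewrite exprVn sqr_sqrtr// ltW.
  have -> : 2 * rsqrt x * ((1 + x^-1 * t)^-1 * (rsqrt x * (rsqrt t / 2))) =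
    rsqrt x ^+ 2 * ((1 + x^-1 * t)^-1 * rsqrt t).
    by move: (1 + x^-1 * t)^-1 (rsqrt t) => A B; field.
  have -> : rsqrt x ^+ 2 = x^-1 by rewrite exprVn sqr_sqrtr// ltW.
  rewrite mulrA -invfM mulrDr mulr1 mulrA divff ?mul1r// gt_eqF//.
- move=> t t0; apply: cvgM; last exact: cont_rsqrt.
  exact: derive_cont (derive_ker_t _ x0 t0).
- move=> t t0; rewrite ker1; apply: mulr_ge0; last exact/ltW/rsqrt_gt0.
  by rewrite invr_ge0 addr_ge0// ltW.
- have cF : {for 0, continuous F}.
    apply: cvgM; first exact: cvg_cst.
    apply: (@continuous_comp _ _ _ (fun t => rsqrt x * Num.sqrt t) (@atan R)); last exact: continuous_atan.
    by apply: cvgM; [exact: cvg_cst|exact: sqrt_continuous].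
  by have := cvg_at_right_filter cF; rewrite /F sqrtr0 mulr0 atan0 mulr0.
- apply: cvgM; first exact: cvg_cst.
  apply: cvg_comp (@cvgy_atan R).
  apply/cvgryPge => A; near=> t.
  rewrite -ler_pdivrMl//.
  have B0 : 0 <= `|(rsqrt x)^-1 * A| by [].
  apply: le_trans (ler_norm _) _; rewrite -(ger0_norm B0) -sqrtr_sqr.
  apply: ler_wsqrtr; near: t; apply: nbhs_pinfty_ge; exact: num_real.
Unshelve. all: by end_near. Qed.

Lemma integ_ker_rsqrt P x : 0 < x -> integ (fun t => ker P x t * rsqrt t).
Proof.
move=> x0; have [i1 _] := mass_cauchy x0.
apply: integ_le (measM (meas_ker P x0) (@meas_rsqrt R)) _ (integZ (pabs P) i1).
move=> t t0; rewrite normrM (gtr0_norm (rsqrt_gt0 t0)) mulrA.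
by apply: ler_wpM2r; [exact/ltW/rsqrt_gt0|rewrite ker1; exact: ker_bound].
Qed.

(** theta in t is a total derivative against the weight t^(-1/2), which theta
    annihilates. *)
Lemma mass_theta P x : 0 < x -> hint (fun t => ker (theta P) x t * rsqrt t) = 0.
Proof.
move=> x0.
pose F t := - (Num.sqrt t * ker P x t).
apply: (@ftc_zero R _ F).
- move=> t t0; rewrite /F (_ : (fun _ => _) = fun t => -1 * (Num.sqrt t * ker P x t)).
    apply: is_derive_eq (dZ (-1) (dM (derive_sqrt t0) (derive_ker_t P x0 t0))) _.
    by rewrite -(sqrtV t0); field; rewrite gt_eqF.
  by apply/funext => s; rewrite mulN1r.
- move=> t t0; apply: cvgM; last exact: cont_rsqrt.
  exact: derive_cont (derive_ker_t _ x0 t0).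
- exact: integ_ker_rsqrt.
- apply: integ_ext (integZ (-1) (integ_ker_rsqrt P x0)) => t t0.
  by rewrite /F -(sqrtV t0); ring.
Qed.

(** Each factor of the Euler product equals 1 - c theta^2 and so preserves the mass
    of the kernel against t^(-1/2). *)
Lemma mass_Q n x : 0 < x -> Cn n * hint (fun t => ker (Q ^+ n) x t * rsqrt t) = pi * rsqrt x.
Proof.
move=> x0; elim: n => [|n IH].
  by rewrite /= mul1r; have [_ <-] := mass_cauchy x0; apply: hint_ext.
have := mass_theta (theta (Q ^+ n)) x0; rewrite theta2_Q.
set a := (n%:R + 2^-1) ^+ 2; set b := _ * _.
have i k := integ_ker_rsqrt (Q ^+ k) x0.
rewrite (@hint_ext _ _ (fun t => a * (ker (Q ^+ n) x t * rsqrt t) -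
    b * (ker (Q ^+ n.+1) x t * rsqrt t))); last first.
  by move=> t _; rewrite -scaleNr kerD !kerZ; ring.
rewrite (hintB (integZ a (i n)) (integZ b (i n.+1))) (hintZ _ (i n)) (hintZ _ (i n.+1)).
move/eqP; rewrite subr_eq0 => /eqP h.
rewrite Cn_step -/a -/b -IH -mulrA; congr (_ * _).
by rewrite mulrAC -h mulrAC divff ?mul1r// expf_neq0// half_neq0.
Qed.

(** Up to the factor pi, the n-th partial Euler product of cos(pi theta) applied
    to the Carleman operator.  It is a positive operator that fixes t^(-1/2). *)
Definition En n f : R -> R := sop ((Cn n / pi) *: Q ^+ n) f.

Lemma schur_cauchy : schur_kernel 1 (pi : R).
Proof.
split=> [x t x0 t0|x t x0 t0|x x0].
- by rewrite ker1 invr_ge0 addr_ge0 ?ltW.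
- by rewrite !ker1 addrC.
- exact: mass_cauchy.
Qed.

Lemma schur_En n : schur_kernel ((Cn n / pi) *: Q ^+ n) 1.
Proof.
have c0 : 0 <= Cn n / pi by rewrite divr_ge0 ?pi_ge0// ltW// Cn_gt0.
split=> [x t x0 t0|x t x0 t0|x x0].
- by rewrite kerZ mulr_ge0// ker_Q_ge0.
- by rewrite !kerZ ker_QC.
- split; first exact: integ_ker_rsqrt.
  have i := integ_ker_rsqrt (Q ^+ n) x0.
  rewrite (@hint_ext _ _ (fun t => Cn n / pi * (ker (Q ^+ n) x t * rsqrt t))).
    rewrite (hintZ _ i) mulrAC mass_Q// mulrAC divff ?mul1r// gt_eqF//; exact: pi_gt0.
  by move=> t _; rewrite kerZ mulrA.
Qed.

Lemma En_contract n f : sqint f -> sqint (En n f) /\ sqnorm (En n f) <= sqnorm f.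
Proof.
by move=> sf; have [s h] := schur_bound (schur_En n) sf; rewrite expr1n mul1r in h.
Qed.

(** Every kernel of the family is dominated by a multiple of 1/(x+t). *)
Lemma sqint_sop P f : sqint f -> sqint (sop P f).
Proof.
move=> sf; have sn := sqint_norm sf.
have [s1 _] := schur_bound schur_cauchy sn.
apply: sqint_le (meas_sop P sf) _ (sqintZ (pabs P) s1) => x x0.
apply: le_trans (hint_norm (integ_ker P sf x0)) _.
rewrite /sop -(hintZ (pabs P) (integ_ker 1 sn x0)).
apply: hint_le; first exact: integ_norm (integ_ker P sf x0).
  exact: integZ (integ_ker 1 sn x0).
move=> t t0; rewrite normrM mulrA ker1.
by apply: ler_wpM2r => //; exact: ker_bound.
Qed.

Lemma sop_sqchain P f : sqint f -> sqchain (sopchain P f).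
Proof. by move=> sf; split; [exact: sop_chain|move=> k; exact: sqint_sop]. Qed.

Lemma sqnorm_sop1 f : sqint f -> sqnorm (sop 1 f) <= pi ^+ 2 * sqnorm f.
Proof. by move=> sf; have [] := schur_bound schur_cauchy sf. Qed.

End Mass.

(** * The approximate identity *)

Section ApproximateIdentity.
Variable R : realType.
Implicit Types (f g F : R -> R) (P : {poly R}) (x t : R).
Local Notation mu := (@lebesgue_measure R).
Local Notation rsqrt := (@rsqrt R).
Local Notation Q := (Q R).
Local Notation Cn := (@Cn R).
Local Notation En := (@En R).

Lemma Cn_le n : Cn n <= n.+1%:R * 4 ^+ n.
Proof.
elim: n => [|n IH]; first by rewrite /= expr0 mulr1.
rewrite Cn_step.
have h0 : (0 : R) < n%:R + 2^-1 by rewrite ltr_wpDl.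
have n0 : (0 : R) <= n%:R by [].
apply: (@le_trans _ _ (n.+1%:R * 4 ^+ n *
   ((n.*2.+1)%:R * (n.*2.+2)%:R / (n%:R + 2^-1) ^+ 2))).
  by apply: ler_wpM2r IH; rewrite divr_ge0 ?mulr_ge0 ?exprn_ge0 ?ltW.
rewrite [4 ^+ n.+1]exprSr [leRHS]mulrCA [n.+1%:R * 4 ^+ n]mulrC -[leLHS]mulrA.
apply: ler_wpM2l; first by rewrite exprn_ge0.
rewrite mulrA ler_pdivrMr ?exprn_gt0//.
rewrite -[n.*2.+2]addn2 -[n.*2.+1]addn1 -[n.+2]addn2 -[n.+1]addn1 !natrD -muln2 natrM.
set m := n%:R; have m0 : 0 <= m by [].
by have := mulr_ge0 m0 m0; nra.
Qed.

Lemma cvg_natM_exp (q : R) : 0 <= q < 1 -> n.+1%:R * q ^+ n @[n --> \oo] --> 0.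
Proof.
move=> /andP[q0 q1].
pose p := Num.sqrt q; have p0 : 0 <= p by exact: sqrtr_ge0.
have p2 : p * p = q by rewrite -expr2 sqr_sqrtr.
have p1 : p < 1 by have := q1; rewrite -p2; nra.
pose C := 1 + (1 - p)^-1.
have d0 : 0 < 1 - p by rewrite subr_gt0.
(* Bernoulli's inequality for p = sqrt q: (n+1) p^n is bounded, and q^n = p^n p^n. *)
have b n : n.+1%:R * p ^+ n <= C.
  have h k : k%:R * (1 - p) * p ^+ k <= 1 - p ^+ k.
    elim: k => [|k IH]; first by rewrite mul0r mul0r expr0 subrr.
    rewrite exprS -natr1; have e0 : 0 <= p ^+ k by exact: exprn_ge0.
    have e1 : p ^+ k <= 1 by rewrite exprn_ile1// ltW.
    move: IH e0 e1; set y := p ^+ k; set z := k%:R => IH e0 e1.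
    have py : p * y <= 1 by rewrite mulr_ile1// ltW.
    by have := ler_wpM2l p0 IH; have := ler_wpM2l (ltW d0) py; lra.
  have e0 : 0 <= p ^+ n by exact: exprn_ge0.
  have e1 : p ^+ n <= 1 by rewrite exprn_ile1// ltW.
  rewrite -natr1 mulrDl mul1r addrC lerD//.
  rewrite -(ler_pM2r d0) mulVf ?gt_eqF// mulrAC.
  by apply: le_trans (h n) _; rewrite gerBl.
have C0 : 0 <= C by apply: le_trans (b 0%N); rewrite expr0 mulr1.
apply: (@squeeze_cvgr _ _ _ _ (cst 0) (fun n => C * p ^+ n)).
- apply: nearW => n; rewrite mulr_ge0 ?exprn_ge0//=.
  rewrite -p2 exprMn mulrA; apply: ler_wpM2r; first exact: exprn_ge0.
  exact: b.
- exact: cvg_cst.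
- rewrite -[0](mulr0 C); apply: cvgM; first exact: cvg_cst.
  by apply: cvg_expr; rewrite ger0_norm.
Qed.

(** Off the diagonal the kernel decays geometrically, because
    4 x t / (x + t)^2 = 1 - ((t - x) / (x + t))^2 while the constant Cn n is at
    most (n+1) 4^n. *)
Lemma ker_Q_offdiag n x t (d : R) : 0 < x -> 0 < t -> 0 < d -> d <= `|t - x| ->
  Cn n * ker (Q ^+ n) x t <= n.+1%:R * (1 - (d / (2 * x + d)) ^+ 2) ^+ n * ker 1 x t.
Proof.
move=> x0 t0 d0 hd; rewrite ker_Q// ker1 mulrA.
have xt : 0 < x + t by exact: addr_gt0.
apply: ler_wpM2r; first by rewrite invr_ge0 ltW.
have y0 : 0 <= x * t / (x + t) ^+ 2 by rewrite divr_ge0 ?exprn_ge0 ?mulr_ge0 ?ltW.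
apply: (@le_trans _ _ (n.+1%:R * 4 ^+ n * (x * t / (x + t) ^+ 2) ^+ n)).
  by apply: ler_wpM2r; [exact: exprn_ge0|exact: Cn_le].
rewrite -mulrA -exprMn; apply: ler_wpM2l => //.
apply: lerXn2r; rewrite ?nnegrE.
- by rewrite mulr_ge0.
- have xd : 0 < 2 * x + d by lra.
  have : d / (2 * x + d) <= 1 by rewrite ler_pdivrMr//; lra.
  have : 0 <= d / (2 * x + d) by rewrite divr_ge0// ltW.
  by nra.
have -> : 4 * (x * t / (x + t) ^+ 2) = 1 - (`|t - x| / (x + t)) ^+ 2.
  by rewrite expr_div_n real_normK ?num_real//; field; rewrite gt_eqF.
rewrite lerD2l lerN2; apply: lerXn2r; rewrite ?nnegrE.
- by apply: divr_ge0; lra.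
- by apply: divr_ge0 => //; exact: ltW.
rewrite ler_pdivrMr; last by lra.
rewrite mulrAC ler_pdivlMr//.
move: hd; case: (ger0P (t - x)) => h hd.
  have : 0 <= x * (t - x - d) by apply: mulr_ge0; lra.
  by lra.
have : 0 <= x * (x - t - d) by apply: mulr_ge0; lra.
have : 0 <= d * (x - t) by apply: mulr_ge0; lra.
by lra.
Qed.

(** Domination by the common eigenfunction t^(-1/2), preserved by En. *)
Definition dominated (B : R) g := forall t, 0 < t -> `|g t| <= B * rsqrt t.

Lemma ker_En n x t : ker ((Cn n / pi) *: Q ^+ n) x t = Cn n * ker (Q ^+ n) x t / pi.
Proof. by rewrite kerZ mulrAC. Qed.

Lemma En_dominated B g n x : sqint g -> dominated B g -> 0 < x ->
  `|En n g x| <= B * rsqrt x.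
Proof.
move=> sg hg x0; have [k0 _ kM] := schur_En R n; have [i1 e1] := kM x x0.
apply: le_trans (hint_norm (integ_ker _ sg x0)) _.
rewrite -[rsqrt x]mul1r -e1 -(hintZ B i1).
apply: hint_le (integ_norm (integ_ker _ sg x0)) (integZ B i1) _ => t t0.
rewrite normrM (ger0_norm (k0 _ _ x0 t0)) mulrCA.
by apply: ler_wpM2l; [exact: k0|exact: hg].
Qed.

(** The usual argument for approximate identities, relative to the weight
    t^(-1/2): h = g sqrt t is continuous at x and bounded, near the diagonal
    it is close to h x, and elsewhere the kernel is exponentially small. *)
Lemma En_cvg B g x : sqint g -> dominated B g -> 0 < x -> {for x, continuous g} ->
  En n g x @[n --> \oo] --> g x.
Proof.
move=> sg hg x0 cg.
pose h t := g t * Num.sqrt t.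
have ch : {for x, continuous h} by apply: cvgM => //; exact: sqrt_continuous.
have hB t : 0 < t -> `|h t| <= B.
  move=> t0; rewrite normrM (ger0_norm (sqrtr_ge0 _)).
  apply: le_trans (ler_wpM2r (sqrtr_ge0 _) (hg _ t0)) _.
  by rewrite -mulrA rsqrtM// mulr1.
have gE t : 0 < t -> g t = h t * rsqrt t.
  by move=> t0; rewrite /h -mulrA [Num.sqrt t * _]mulrC rsqrtM// mulr1.
have B0 : 0 <= B by apply: le_trans (hB _ x0).
have r0 := rsqrt_gt0 x0.
apply/cvgrPdist_le => e e0.
pose e1 := e / 2 / rsqrt x.
have e10 : 0 < e1 by rewrite divr_gt0// divr_gt0.
move/cvgrPdist_le : ch => /(_ _ e10)[d /= d0 hd].
pose q := 1 - (d / (2 * x + d)) ^+ 2.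
have xd : 0 < 2 * x + d by rewrite addr_gt0// mulr_gt0.
have q01 : 0 <= q < 1.
  have h1 : d / (2 * x + d) < 1 by rewrite ltr_pdivrMr//; lra.
  have h2 : 0 < d / (2 * x + d) by rewrite divr_gt0.
  by rewrite /q; apply/andP; split; nra.
have key n : `|En n g x - g x| <= rsqrt x * (e1 + 2 * B * (n.+1%:R * q ^+ n)).
  have [k0 _ kM] := schur_En R n; have [i1 m1] := kM x x0.
  set P := (Cn n / pi) *: Q ^+ n in k0 kM i1 m1 *.
  have [i2 m2] := mass_cauchy x0.
  have -> : En n g x - g x = hint (fun t => ker P x t * rsqrt t * (h t - h x)).
    rewrite (gE x x0) mulrC -[rsqrt x * h x]mul1r mulrA -m1 mulrC -(hintZ (h x) i1).
    rewrite /En /sop -(hintB (integ_ker P sg x0) (integZ (h x) i1)).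
    by apply: hint_ext => t t0; rewrite (gE t t0); ring.
  have i3 : integ (fun t => ker P x t * rsqrt t * (h t - h x)).
    apply: integ_ext (integB (integ_ker P sg x0) (integZ (h x) i1)) => t t0.
    by rewrite (gE t t0); ring.
  apply: le_trans (hint_norm i3) _.
  have i4 := integD (integZ e1 i1) (integZ (2 * B * (n.+1%:R * q ^+ n) / pi) i2).
  have -> : rsqrt x * (e1 + 2 * B * (n.+1%:R * q ^+ n)) =
     hint (fun t => e1 * (ker P x t * rsqrt t) +
       (2 * B * (n.+1%:R * q ^+ n) / pi) * (ker 1 x t * rsqrt t)).
    rewrite (hintD (integZ e1 i1) (integZ (2 * B * (n.+1%:R * q ^+ n) / pi) i2)).
    rewrite (hintZ _ i1) (hintZ _ i2) m1 m2 mul1r.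
    by move: pi (lt0r_neq0 (pi_gt0 R)) => p p0; field.
  apply: hint_le (integ_norm i3) i4 _ => t t0.
  have kr0 : 0 <= ker P x t * rsqrt t.
    by apply: mulr_ge0; [exact: k0|exact/ltW/rsqrt_gt0].
  have k10 : 0 <= ker 1 x t * rsqrt t.
    by apply: mulr_ge0; [rewrite ker1 invr_ge0 addr_ge0 ?ltW|exact/ltW/rsqrt_gt0].
  rewrite normrM (ger0_norm kr0).
  have qn : 0 <= n.+1%:R * q ^+ n by rewrite mulr_ge0// exprn_ge0//; case/andP: q01.
  have [near_x|far] := ltP `|x - t| d.
    have := hd _ near_x; rewrite distrC => hh.
    apply: (@le_trans _ _ (e1 * (ker P x t * rsqrt t))).
      by rewrite mulrC; apply: ler_wpM2r.
    rewrite lerDl; apply: mulr_ge0 => //; apply: divr_ge0 (pi_ge0 _).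
    by apply: mulr_ge0 => //; apply: mulr_ge0.
  have hh : `|h t - h x| <= 2 * B.
    apply: le_trans (ler_normB _ _) _; have := hB _ t0; have := hB _ x0; lra.
  rewrite distrC in far.
  have off := ker_Q_offdiag n x0 t0 d0 far.
  have {}off : ker P x t <= n.+1%:R * q ^+ n * ker 1 x t / pi.
    by rewrite /P ker_En; apply: ler_wpM2r off; rewrite invr_ge0 pi_ge0.
  apply: (@le_trans _ _ (2 * B * (n.+1%:R * q ^+ n) / pi * (ker 1 x t * rsqrt t))).
    apply: (@le_trans _ _ (ker P x t * rsqrt t * (2 * B))); first exact: ler_wpM2l.
    have -> : 2 * B * (n.+1%:R * q ^+ n) / pi * (ker 1 x t * rsqrt t) =
      (n.+1%:R * q ^+ n * ker 1 x t / pi) * (rsqrt t * (2 * B)) by ring.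
    rewrite -mulrA; apply: ler_wpM2r off.
    by apply: mulr_ge0; [exact/ltW/rsqrt_gt0|exact: mulr_ge0].
  by rewrite lerDr mulr_ge0// ltW.
have lim0 : rsqrt x * (2 * B * (n.+1%:R * q ^+ n)) @[n --> \oo] --> 0.
  rewrite -[0](mulr0 (rsqrt x)); apply: cvgM; first exact: cvg_cst.
  rewrite -[0](mulr0 (2 * B)); apply: cvgM; first exact: cvg_cst.
  exact: cvg_natM_exp.
near=> n; rewrite distrC; apply: le_trans (key n) _.
have -> : e = rsqrt x * e1 + e / 2 by rewrite /e1; field; rewrite gt_eqF.
rewrite mulrDr lerD2l; near: n; apply: (cvgr_le _ lim0).
by rewrite divr_gt0.
Unshelve. all: by end_near. Qed.

(** 1/(b+x)^2 serves as an integrable bound that is at least 1/(2b)^2 on the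
    support. *)
Lemma integ_box (a b M : R) f : 0 < a -> 0 < b -> meas f ->
  (forall x, 0 < x -> `|f x| <= M) -> (forall x, ~~ (a < x < b) -> f x = 0) -> integ f.
Proof.
move=> a0 b0 mf fM f0; have [_ i] := sqint_addV b0.
apply: integ_le mf _ (integZ (M * (4 * b ^+ 2)) i) => x x0.
have M0 : 0 <= M by apply: le_trans (fM _ x0).
have xb : 0 < b + x by exact: addr_gt0.
have [/andP[ax xb']|/f0 ->] := boolP (a < x < b).
  apply: le_trans (fM _ x0) _; rewrite -mulrA ler_peMr// exprVn.
  by rewrite ler_pdivlMr ?exprn_gt0// mul1r; nra.
rewrite normr0; apply: mulr_ge0 (sqr_ge0 _); apply: mulr_ge0 => //.
by apply: mulr_ge0 => //; exact: sqr_ge0.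
Qed.

(** Weak convergence plus contraction gives strong convergence:
    |E g - g|^2 <= 2 (|g|^2 - <E g, g>), and <E g, g> tends to |g|^2 by dominated
    convergence, for which pointwise convergence on the support of g suffices. *)
Lemma En_box_cvg (a b M : R) g : 0 < a -> 0 < b -> meas g ->
  (forall x, 0 < x -> `|g x| <= M) -> (forall x, ~~ (a < x < b) -> g x = 0) ->
  (forall x, a < x < b -> {for x, continuous g}) ->
  sqint g /\ sqnorm (fun x => En n g x - g x) @[n --> \oo] --> 0.
Proof.
move=> a0 b0 mg gM g0 cg.
have M0 : 0 <= M by apply: le_trans (gM _ a0).
have ig := integ_box a0 b0 mg gM g0.
have sg : sqint g.
  split => //; apply: (@integ_box a b (M ^+ 2)) => //; first exact: measX.
    by move=> x x0; rewrite normrX; apply: lerXn2r; rewrite ?nnegrE ?gM.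
  by move=> x /g0 ->; rewrite expr0n.
split => //.
(* On ]a, b[ the weight t^(-1/2) is at least b^(-1/2). *)
pose B := M * Num.sqrt b.
have hg : dominated B g.
  move=> t t0; have [/andP[at' tb]|/g0 ->] := boolP (a < t < b).
    apply: le_trans (gM _ t0) _; rewrite /B -mulrA ler_peMr//.
    rewrite -(rsqrtM t0) mulrC; apply: ler_wpM2r; first exact/ltW/rsqrt_gt0.
    by apply: ler_wsqrtr; exact: ltW.
  by rewrite normr0 !mulr_ge0 ?sqrtr_ge0// ltW// rsqrt_gt0.
have sE n : sqint (En n g) by have [] := En_contract n sg.
have [] := @hint_dct R (fun n x => En n g x * g x)
   (fun x => B * rsqrt a * `|g x|) (fun x => g x ^+ 2).
- by move=> n; apply: measM mg; exact: (sE n).1.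
- exact: measX.
- move=> x x0; rewrite expr2.
  have [ab|/g0 ->] := boolP (a < x < b).
    by apply: cvgM; [exact: En_cvg sg hg x0 (cg _ ab)|exact: cvg_cst].
  rewrite mulr0; under eq_fun do rewrite mulr0; exact: cvg_cst.
- exact: integZ (integ_norm ig).
- move=> n x x0; rewrite normrM.
  have [/andP[ax xb]|/g0 ->] := boolP (a < x < b); last by rewrite normr0 !mulr0.
  apply: ler_wpM2r => //; apply: le_trans (En_dominated n sg hg x0) _.
  apply: ler_wpM2l; first by rewrite mulr_ge0// sqrtr_ge0.
  by rewrite lef_pV2 ?posrE ?sqrtr_gt0//; apply: ler_wsqrtr; exact: ltW.
move=> _ c.
have {}c : 2 * (sqnorm g - inner (En n g) g) @[n --> \oo] --> 0.
  rewrite -[0](mulr0 2); apply: cvgM; first exact: cvg_cst.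
  by rewrite -(subrr (sqnorm g)); apply: cvgB => //; exact: cvg_cst.
apply: squeeze_cvgr (cvg_cst 0) c; apply: nearW => n.
rewrite sqnorm_ge0 /= sqnormB//; have [_] := En_contract n sg; lra.
Qed.

(** Truncate F in domain and in size, approximate the truncation G in mean by a
    continuous function, and clip the latter at the bound of G; clipping turns
    the approximation in mean into one in mean square. *)
Lemma sqint_dense F (e : R) : sqint F -> 0 < e ->
  exists g a b M, [/\ 0 < a, 0 < b, meas g &
    [/\ forall x, 0 < x -> `|g x| <= M, forall x, ~~ (a < x < b) -> g x = 0,
        forall x, a < x < b -> {for x, continuous g} &
        sqnorm (fun x => F x - g x) <= e]].
Proof.
move=> sF e0; have [mF hF] := sF.
pose T n x := if (n.+2%:R^-1 < x < n.+2%:R) && (`|F x| <= n.+2%:R) then F x else 0.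
have mT n : meas (T n).
  have m1 : measurable_fun (halfline (R := R)) (fun x : R => (n.+2%:R^-1 < x < n.+2%:R) && (`|F x| <= n.+2%:R)).
    apply: measurable_and.
      apply: measurable_and.
        by apply: measurable_fun_ltr => //; exact: measurable_cst.
      by apply: measurable_fun_ltr => //; exact: measurable_cst.
    by apply: measurable_fun_ler; [exact: meas_norm|exact: measurable_cst].
  apply: (measurable_fun_if (@measurable_halfline R) m1).
    by apply: measurable_funS mF; [exact: measurable_halfline|exact: subIsetl].
  exact: measurable_cst.
have leT n x : `|F x - T n x| <= `|F x|.
  by rewrite /T; case: ifP => _; rewrite ?subrr ?normr0 ?subr0.
have cT : sqnorm (fun x => F x - T n x) @[n --> \oo] --> 0.
  have [] := @hint_dct R (fun n x => (F x - T n x) ^+ 2) (fun x => F x ^+ 2) (fun=> 0).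
  - by move=> n; apply: measX; exact: measB.
  - exact: meas_cst.
  - move=> x x0; apply: (@cvg_trans _ ((fun=> 0 : R) @ \oo)); last exact: cvg_cst.
    apply: near_eq_cvg; near=> n; rewrite /T ifT ?subrr ?expr0n//.
    apply/andP; split; first (apply/andP; split).
    + by near: n; apply: (cvgr_lt _ (@cvg_natS2V R)).
    + by near: n; move/cvgryPgt : (@cvg_natS2 R); exact.
    + by near: n; move/cvgryPge : (@cvg_natS2 R); exact.
  - exact: hF.
  - move=> n x x0; rewrite normrX -[leRHS]real_normK ?num_real//.
    by apply: lerXn2r; rewrite ?nnegrE.
  by move=> _; rewrite hint0.
have e4 : 0 < e / 4 by rewrite divr_gt0.
have [N _ /(_ N (leqnn _)) /= hN] := cvgr_le _ cT _ e4.
set a : R := N.+2%:R^-1; set b : R := N.+2%:R; set G := T N in hN *.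
have a0 : 0 < a by rewrite invr_gt0.
have b0 : 0 < b by [].
have Gb x : `|G x| <= b.
  by rewrite /G /T; case: ifP => [/andP[]//|_]; rewrite normr0 ltW.
have G0 x : ~~ (a < x < b) -> G x = 0 by move=> h; rewrite /G /T (negbTE h).
have iG : integ G by apply: (@integ_box a b b) => //; exact: mT.
pose J : set (measurableTypeR R) := `]a, b[%classic.
have mJ : measurable J by exact: measurable_itv.
have JD : J `<=` halfline (R := R).
  by move=> x; rewrite halflineE /J /= in_itv /= => /andP[+ _]; exact: lt_trans.
have iGJ : mu.-integrable J (EFin \o G).
  by apply: (integrableS (@measurable_halfline_lebesgue R) mJ JD iG).
have finJ : (mu J < +oo)%E.
  by rewrite /J lebesgue_measure_itv /=; case: ifP => _; rewrite -?EFinB ltry.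
have [g_ [cg ig cvg0]] := @approximation_continuous_integrable R J G mJ finJ iGJ.
have d0 : 0 < e / (8 * b) by rewrite divr_gt0// mulr_gt0.
have [k hk] : exists k, hint ((fun x => `|G x - g_ k x|) \_ J) <= e / (8 * b).
  have d0' : (0 < (e / (8 * b))%:E)%E by rewrite lte_fin.
  have [K _ /(_ K (leqnn _)) /= hK] : \forall k \near \oo,
      (\int[mu]_(z in J) `|(G z - g_ k z)%:E| <= (e / (8 * b))%:E)%E.
    move/fine_cvgP : cvg0 => [fin c]; near=> k.
    rewrite -[leLHS]fineK; last by near: k; exact: fin.
    rewrite lee_fin; near: k; exact: (cvgr_le _ c).
  have iK : mu.-integrable J (EFin \o (fun x => G x - g_ K x)).
    exact: (integrableB mJ iGJ (ig K)).
  exists K; rewrite /hint -Rintegral_mkcondr setIidr// /Rintegral.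
  rewrite -[leRHS]/(fine (e / (8 * b))%:E) fine_le//.
  exact: (integrable_fin_num mJ (integrable_norm iK)).
(* G and its clipped approximation are bounded by b, so |G - g|^2 <= 2b |G - g|. *)
pose clip y : R := Num.max (- b) (Num.min b y).
have clipb y : `|clip y| <= b.
  rewrite ler_norml /clip; apply/andP; split; first by rewrite le_max lexx.
  by rewrite ge_max ge_min lexx /= andbT; lra.
have clip1 y z : `|z| <= b -> `|z - clip y| <= `|z - y|.
  rewrite ler_norml => /andP[z1 z2]; rewrite /clip.
  case: (leP b y) => yb.
    rewrite (max_idPr _); last by lra.
    by rewrite ler0_norm ?ler0_norm; lra.
  case: (leP (- b) y) => yb2 //.
  by rewrite !ger0_norm; lra.
pose g := (fun x => clip (g_ k x)) \_ J.
have cclip x : {for x, continuous (fun x => clip (g_ k x))}.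
  have := @continuous_max R R (fun _ => - b) (fun x => Num.min b (g_ k x)) x.
  apply; first exact: cvg_cst.
  apply: continuous_min; first exact: cvg_cst.
  exact: cg.
have mclip : meas (fun x => clip (g_ k x)) by apply: meas_cont => x _; exact: cclip.
have gJ x : ~~ (a < x < b) -> g x = 0.
  by move=> h; rewrite /g patchE memNset// /J /= in_itv /=; exact/negP.
have gJ1 x : a < x < b -> g x = clip (g_ k x).
  by move=> h; rewrite /g patchE mem_set// /J /= in_itv.
have gb x : `|g x| <= b.
  by rewrite /g patchE; case: ifP => _ //; rewrite normr0 ltW.
have mg : meas g.
  apply/(measurable_restrict _ (measurable_itv `]a, b[) (@measurable_halfline R)).
  by apply: measurable_funS mclip; [exact: measurable_halfline|exact: subIsetl].
exists g, a, b, b; split => //; split => //.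
- move=> x xab; have /andP[ax xb] := xab.
  have h : \forall y \near x, clip (g_ k y) = g y.
    near=> y; rewrite gJ1//; apply/andP; split; near: y.
      exact: lt_nbhsr.
    exact: lt_nbhsl.
  have c : clip (g_ k y) @[y --> x] --> clip (g_ k x) := cclip x.
  rewrite -(gJ1 _ xab) in c.
  by apply: cvg_trans c; exact: near_eq_cvg.
have sqb y : `|y| <= b -> `|y ^+ 2| <= b ^+ 2.
  by move=> yb; rewrite normrX; apply: lerXn2r => //; rewrite nnegrE ltW.
have sG : sqint G.
  split; first exact: mT.
  apply: (@integ_box a b (b ^+ 2)) => //; first by apply: measX; exact: mT.
    by move=> x _; exact: sqb.
  by move=> x /G0 ->; rewrite expr0n.
have sg : sqint g.
  split => //.
  apply: (@integ_box a b (b ^+ 2)) => //; first by apply: measX.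
    by move=> x _; exact: sqb.
  by move=> x /gJ ->; rewrite expr0n.
  rewrite (@sqnorm_ext _ _ (fun x => (F x - G x) + (G x - g x))); last by move=> x _; ring.
apply: le_trans (sqnormD_le _ _) _; [exact: sqintB|exact: sqintB|].
have : sqnorm (fun x => G x - g x) <= e / 4.
  have iP : integ ((fun x => `|G x - g_ k x|) \_ J).
    rewrite /integ -restrict_EFin.
    apply/integrable_restrict; [exact: mJ|exact: measurable_halfline_lebesgue|].
    rewrite setIidr//.
    have iB : mu.-integrable J (EFin \o (fun x => G x - g_ k x)).
      exact: (integrableB mJ iGJ (ig k)).
    exact: integrable_norm iB.
  have <- : 2 * b * (e / (8 * b)) = e / 4 by field; rewrite gt_eqF.
  apply: (@le_trans _ _ (2 * b * hint ((fun x => `|G x - g_ k x|) \_ J))); last first.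
    by apply: ler_wpM2l hk; rewrite mulr_ge0// ltW.
  rewrite -(hintZ (2 * b) iP).
  apply: hint_le; [exact: (sqintB sG sg).2|exact: integZ|] => x x0.
  have [xab|xab] := boolP (a < x < b); last first.
    rewrite gJ// G0// subrr expr0n /=; apply: mulr_ge0; first by rewrite mulr_ge0 ?ltW.
    by rewrite patchE; case: ifP.
  rewrite patchE mem_set /= ?in_itv//= gJ1//.
  rewrite -(real_normK (num_real (G x - _))) expr2; apply: ler_pM => //; last exact: clip1.
  by apply: le_trans (ler_normB _ _) _; have := Gb x; have := clipb (g_ k x); lra.
lra.
Unshelve. all: by end_near. Qed.

(** Density and uniform boundedness of the contractions En. *)
Lemma En_cvg_sqint F : sqint F ->
  sqnorm (fun x => En n F x - F x) @[n --> \oo] --> 0.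
Proof.
move=> sF; apply/cvgrPdist_le => e e0.
have e12 : 0 < e / 12 by rewrite divr_gt0.
have [g [a [b [M [a0 b0 mg [gM g0 cg Fg]]]]]] := sqint_dense sF e12.
have [sg c] := En_box_cvg a0 b0 mg gM g0 cg.
have [K _ hK] := cvgr_le _ c _ e12.
near=> n.
have {hK} hn : sqnorm (fun x => En n g x - g x) <= e / 12.
  by apply: hK => /=; near: n; exact: nbhs_infty_ge.
rewrite sub0r normrN ger0_norm ?sqnorm_ge0//.
have sd := sqintB sF sg.
have [sE hE] := En_contract n sd; have [sEg _] := En_contract n sg.
have s1 : sqint (fun x => En n g x - g x) by exact: sqintB.
have s2 : sqint (fun x => (En n g x - g x) - (F x - g x)) by exact: sqintB.
rewrite (@sqnorm_ext _ _ (fun x => En n (fun y => F y - g y) x +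
    ((En n g x - g x) - (F x - g x)))); last first.
  by move=> x x0; rewrite /En (sopBr _ sF sg x0); ring.
apply: le_trans (sqnormD_le sE s2) _.
have := sqnormB_le s1 sd; lra.
Unshelve. all: by end_near. Qed.

End ApproximateIdentity.

(** * Integrals of Wallis type *)

Section CosineIntegrals.
Variable R : realType.
Implicit Types (f g : R -> R) (x y s : R).
Local Notation mu := (@lebesgue_measure R).

Definition ch y : R := (expR y + expR (- y)) / 2.
Definition sh y : R := (expR y - expR (- y)) / 2.

Lemma derive_expN y : is_derive y 1 (fun y => expR (- y)) (- expR (- y)).
Proof.
have d1 : is_derive y 1 (fun y => -1 * y) (-1 * 1) := dZ (-1) (did y).
have := dcomp (f := @expR R) (g := fun y => -1 * y) (is_derive_expR _) d1.
rewrite (_ : (fun y => expR (-1 * y)) = fun y => expR (- y)).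
  by move=> h; apply: is_derive_eq h _; rewrite mulN1r mulr1 mulrN1.
by apply/funext => z; rewrite mulN1r.
Qed.

Lemma derive_ch y : is_derive y 1 ch (sh y).
Proof.
apply: is_derive_eq (dM (dD (is_derive_expR y) (derive_expN y)) (dcst 2^-1 y)) _.
by rewrite mulr0 addr0.
Qed.

Lemma derive_sh y : is_derive y 1 sh (ch y).
Proof.
apply: is_derive_eq (dM (dB (is_derive_expR y) (derive_expN y)) (dcst 2^-1 y)) _.
by rewrite mulr0 addr0 opprK.
Qed.

Lemma ch0 : ch 0 = 1.
Proof. by rewrite /ch oppr0 expR0; field. Qed.

Lemma sh0 : sh 0 = 0.
Proof. by rewrite /sh oppr0 subrr mul0r. Qed.

Lemma cosh_sub1 y : ch y - 1 = (expR (y / 2) - expR (- (y / 2))) ^+ 2 / 2.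
Proof.
rewrite sqrrB -!expRM_natl -expRD subrr expR0 mulrN.
by rewrite [2 * (y / 2)]mulrC divfK// /ch; field.
Qed.

Lemma ch_ge1 y : 1 <= ch y.
Proof. by rewrite -subr_ge0 cosh_sub1 divr_ge0 ?sqr_ge0. Qed.

Lemma cosh_sub1_le y : 0 <= y -> ch y - 1 <= y ^+ 2 * expR (2 * y).
Proof.
move=> y0; rewrite cosh_sub1.
set z := y / 2; have z0 : 0 <= z by rewrite divr_ge0.
have ez : 1 <= expR z by rewrite -expR0 ler_expR.
have e1 : expR z - 1 <= z * expR z.
  have := expR_ge1Dx (- z); rewrite expRN.
  have ep := expR_gt0 z; rewrite -(ler_pM2r ep) mulVf ?gt_eqF//; lra.
have e2 : 1 - expR (- z) <= z * expR z.
  have h1 := expR_ge1Dx (- z); have : z <= z * expR z by rewrite ler_peMr.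
  lra.
have e3 : expR (- z) <= 1 by rewrite -expR0 ler_expR oppr_le0.
have e4 : expR z - expR (- z) <= y * expR z.
  by have -> : y = z + z; [rewrite /z; field|lra].
have e5 : (expR z - expR (- z)) ^+ 2 <= (y * expR z) ^+ 2.
  by apply: lerXn2r => //; rewrite nnegrE ?mulr_ge0 ?expR_ge0//; lra.
apply: le_trans (_ : (y * expR z) ^+ 2 <= _).
  have := sqr_ge0 (expR z - expR (- z)); lra.
rewrite exprMn -expRM_natl; apply: ler_wpM2l; first exact: sqr_ge0.
by rewrite ler_expR /z; lra.
Qed.

Definition cint f : R := \int[mu]_(x in `[0, pi / 2]) f x.

Let pihalf0 : (0 : R) < pi / 2.
Proof. by rewrite divr_gt0// pi_gt0. Qed.

Lemma cint_integrable f : continuous f -> mu.-integrable `[0, pi / 2] (EFin \o f).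
Proof.
move=> cf; apply: continuous_compact_integrable; first exact: segment_compact.
exact: continuous_subspaceT.
Qed.

Lemma cintD f g : continuous f -> continuous g ->
  cint (fun x => f x + g x) = cint f + cint g.
Proof.
by move=> cf cg; apply: RintegralD (cint_integrable cf) (cint_integrable cg).
Qed.

Lemma cintB f g : continuous f -> continuous g ->
  cint (fun x => f x - g x) = cint f - cint g.
Proof.
by move=> cf cg; apply: RintegralB (cint_integrable cf) (cint_integrable cg).
Qed.

Lemma cintZ k f : continuous f -> cint (fun x => k * f x) = k * cint f.
Proof.
by move=> cf; apply: RintegralZl (cint_integrable cf).
Qed.

Lemma cint_le f g : continuous f -> continuous g ->
  (forall x, 0 <= x <= pi / 2 -> f x <= g x) -> cint f <= cint g.
Proof.
move=> cf cg fg.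
apply: le_Rintegral (cint_integrable cf) (cint_integrable cg) _ => //.
Qed.

Lemma cint_ftc f F : (forall x, is_derive x 1 F (f x)) -> continuous f ->
  cint f = F (pi / 2) - F 0.
Proof.
move=> dF cf; have cF x : {for x, continuous F} by exact: derive_cont (dF x).
rewrite /cint /Rintegral (@continuous_FTC2 _ f F)//.
- exact: continuous_subspaceT.
- split => /=.
  + by move=> x _; have [] := dF x.
  + exact: cvg_at_right_filter (cF 0).
  + exact: cvg_at_left_filter (cF (pi / 2)).
- by move=> x _; rewrite derive1E; have [_] := dF x.
Qed.

(** A crude constant suffices: either cos x is at most 1/2, and then sin x is bounded
    below, or cos is at least 1/2 on [0, x] and the mean value theorem applies. *)
Lemma sin_ge_lin x : 0 <= x <= pi / 2 -> x <= 4 * sin x.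
Proof.
move=> /andP[x0 xp].
have x2 : x <= 2 by rewrite (le_trans xp)// ltW// pihalf_lt2.
have s0 : 0 <= sin x by apply: sin_ge0_pi; rewrite x0 (le_trans xp)// ler_pdivrMr//; have := pi_ge0 R; lra.
have [c|c] := leP (cos x) (1 / 2).
  have c0 : 0 <= cos x by apply: cos_ge0_pihalf; rewrite xp andbT; lra.
  have := cos2Dsin2 x; nra.
have [->|xn] := eqVneq x 0; first by rewrite sin0 mulr0.
have xp0 : 0 < x by rewrite lt_neqAle eq_sym xn.
have [|z zx] := @MVT R sin cos 0 x xp0 (fun z _ => is_derive_sin z).
  by apply: continuous_subspaceT; exact: continuous_sin.
rewrite sin0 !subr0 => ->; move: zx; rewrite in_itv /= => /andP[z0 zx].
have cz : cos x <= cos z.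
  have p0 := pi_ge0 R.
  by apply: ltW; rewrite ltr_cos// in_itv /=; apply/andP; split; lra.
nra.
Qed.

Lemma cont_ch s : continuous (fun x => ch (s * x)).
Proof.
move=> x.
exact: (derive_cont (dcomp (f := ch) (g := fun x => s * x) (derive_ch _) (dZ s (did x)))).
Qed.

Lemma cont_cosX m : continuous (fun x : R => cos x ^+ m).
Proof.
by move=> x; exact: (derive_cont (dX m (is_derive_cos x))).
Qed.

Lemma cont_chcos s m : continuous (fun x => ch (s * x) * cos x ^+ m).
Proof. by move=> x; apply: cvgM; [exact: cont_ch|exact: cont_cosX]. Qed.

(** Integrals of Wallis type.  Their ratio at s and at 0 is, by the recursion
    below, the quotient of ch (pi s / 2) by a partial Euler product, so that
    Euler's formula reduces to the concentration of cos^m at 0. *)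
Definition cosmom s m : R := cint (fun x => ch (s * x) * cos x ^+ m).

Lemma cosmom_prim s k x : is_derive x 1
  (fun x => ch (s * x) * (k.+1%:R * cos x ^+ k * sin x) + s * (sh (s * x) * cos x ^+ k.+1))
  ((k.+1%:R ^+ 2 + s ^+ 2) * (ch (s * x) * cos x ^+ k.+1)
    - k.+1%:R * k%:R * (ch (s * x) * cos x ^+ k.-1)).
Proof.
have d1 : is_derive x 1 (fun x => ch (s * x)) (sh (s * x) * (s * 1)).
  exact: (dcomp (f := ch) (g := fun x => s * x) (derive_ch _) (dZ s (did x))).
have d2 : is_derive x 1 (fun x => sh (s * x)) (ch (s * x) * (s * 1)).
  exact: (dcomp (f := sh) (g := fun x => s * x) (derive_sh _) (dZ s (did x))).
have c n : is_derive x 1 (fun x : R => cos x ^+ n) (n%:R * cos x ^+ n.-1 * - sin x).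
  exact: dX (is_derive_cos x).
have d3 := dM d1 (dM (dZ k.+1%:R (c k)) (is_derive_sin x)).
apply: is_derive_eq (dD d3 (dZ s (dM d2 (c k.+1)))) _.
rewrite [k.+1.-1]/=; have h := sin2cos2 x; set S := sin x in h *; set C := cos x in h *.
case: k {d3 c} => [|k].
  by rewrite /= !expr1 !expr0; ring.
rewrite [k.+1.-1]/= !exprS; set D := C ^+ k.
set chx := ch _; set shx := sh _; set a := k.+2%:R; set b := k.+1%:R.
have ab : a = b + 1 by rewrite /a -natr1.
transitivity (chx * a * (C * C * D - b * D * S ^+ 2) + s ^+ 2 * chx * (C * C * D)).
  ring.
by rewrite h ab; ring.
Qed.

(** Two integrations by parts. *)
Lemma cosmom_rec s k :
  (k.+1%:R ^+ 2 + s ^+ 2) * cosmom s k.+1 - k.+1%:R * k%:R * cosmom s k.-1 =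
  if k is 0 then ch (s * (pi / 2)) else 0.
Proof.
have c1 := @cont_chcos s k.+1; have c2 := @cont_chcos s k.-1.
have cZ a f : continuous f -> continuous (fun x => a * f x).
  by move=> cf x; apply: cvgM; [exact: cvg_cst|exact: cf].
rewrite -(cintZ _ c1) -(cintZ _ c2) -(cintB (cZ _ _ c1) (cZ _ _ c2)).
rewrite (cint_ftc (cosmom_prim s k)); last first.
  move=> x; apply: cvgB.
    exact: (cZ (k.+1%:R ^+ 2 + s ^+ 2) _ c1 x).
  exact: (cZ (k.+1%:R * k%:R) _ c2 x).
rewrite mulr0 ch0 sh0 sin0 cos_pihalf sin_pihalf mulr0 mulr0 mul0r mulr0 addr0 subr0.
rewrite [0 ^+ k.+1]expr0n /= !mulr0 addr0 mulr1.
by case: k {c1 c2} => [|k]; rewrite ?expr0 ?expr0n /= ?mulr0 ?mulr1.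
Qed.

Lemma cosmom_gt0 m : 0 < cosmom 0 m.*2.+1.
Proof.
elim: m => [|m IH].
  have := cosmom_rec 0 0; rewrite mulr0 mul0r subr0 expr0n addr0 expr1n mul1r mul0r ch0.
  by move=> ->.
have := cosmom_rec 0 m.*2.+2; rewrite /= expr0n /= addr0.
move/eqP; rewrite subr_eq0 => /eqP h.
rewrite -(pmulr_rgt0 _ (_ : 0 < m.*2.+3%:R ^+ 2)) ?exprn_gt0// doubleS h.
by rewrite !mulr_gt0.
Qed.

(** As m grows the mass of cos^m concentrates at 0, where ch (s x) = 1.  The rate
    comes from ch (s x) - 1 = O(sin^2 x) and from the recursion for s = 0, which
    says that sin^2 has mean O(1/m). *)
Lemma cosmom_ratio s : 0 <= s -> exists C, forall m,
  1 <= cosmom s m.*2.+1 / cosmom 0 m.*2.+1 <= 1 + C / m.+1%:R.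
Proof.
move=> s0; pose C := s ^+ 2 * 16 * expR (4 * s); exists C => m.
set k := m.*2.+1; have J0 : 0 < cosmom 0 k := cosmom_gt0 m.
have C0 : 0 <= C by rewrite /C !mulr_ge0 ?sqr_ge0 ?expR_ge0.
have cp x : 0 <= x <= pi / 2 -> 0 <= cos x ^+ k.
  move=> /andP[x0 xp]; apply: exprn_ge0; apply: cos_ge0_pihalf; rewrite xp andbT.
  by have := pihalf0; lra.
rewrite ler_pdivlMr// mul1r ler_pdivrMr//; apply/andP; split.
  apply: cint_le; [exact: cont_chcos..|] => x hx; rewrite mul0r ch0 mul1r.
  by apply: ler_peMl; [exact: cp|exact: ch_ge1].
have cZ a f : continuous f -> continuous (fun x => a * f x).
  by move=> cf x; apply: cvgM; [exact: cvg_cst|exact: cf].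
have r := cosmom_rec 0 k.+1; rewrite expr0n /= addr0 in r.
have {r} r : cosmom 0 k.+2 = cosmom 0 k * (k.+1%:R / k.+2%:R).
  move/eqP: r; rewrite subr_eq0 => /eqP r.
  have k2 : (k.+2%:R : R) != 0 by [].
  apply: (mulfI (expf_neq0 2 k2)); rewrite r.
  by move: (k.+2%:R) (k.+1%:R) (cosmom 0 k) k2 => A B J A0; field.
apply: (@le_trans _ _ (cosmom 0 k + C * (cosmom 0 k - cosmom 0 k.+2))).
  rewrite -(cintB (@cont_chcos 0 k) (@cont_chcos 0 k.+2)).
  have c1 : continuous (fun x => ch (0 * x) * cos x ^+ k - ch (0 * x) * cos x ^+ k.+2).
    by move=> x; apply: cvgB; exact: cont_chcos.
  rewrite -(cintZ C c1) -(cintD (@cont_chcos 0 k) (cZ C _ c1)).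
  apply: cint_le; first exact: cont_chcos.
    by move=> x; apply: cvgD; [exact: cont_chcos|exact: (cZ C _ c1 x)].
  move=> x hx; rewrite mul0r ch0 !mul1r.
  have -> : cos x ^+ k + C * (cos x ^+ k - cos x ^+ k.+2) =
     (1 + C * sin x ^+ 2) * cos x ^+ k by rewrite sin2cos2 !exprS; ring.
  apply: ler_wpM2r; first exact: cp.
  have /andP[x0 xp] := hx; have x2 : x <= 2 by rewrite (le_trans xp)// ltW// pihalf_lt2.
  have sx0 : 0 <= s * x by exact: mulr_ge0.
  rewrite -lerBlDl; apply: le_trans (cosh_sub1_le sx0) _.
  have sl := sin_ge_lin hx.
  have x16 : x ^+ 2 <= 16 * sin x ^+ 2.
    have -> : 16 * sin x ^+ 2 = (4 * sin x) ^+ 2 by ring.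
    by apply: lerXn2r; rewrite ?nnegrE// (le_trans x0).
  rewrite exprMn /C.
  apply: (@le_trans _ _ (s ^+ 2 * x ^+ 2 * expR (4 * s))).
    apply: ler_wpM2l; first by rewrite mulr_ge0 ?sqr_ge0.
    by rewrite ler_expR; nra.
  have -> : s ^+ 2 * 16 * expR (4 * s) * sin x ^+ 2 =
     s ^+ 2 * (16 * sin x ^+ 2) * expR (4 * s) by ring.
  apply: ler_wpM2r; first exact: expR_ge0.
  by apply: ler_wpM2l; first exact: sqr_ge0.
rewrite r [(1 + C / _) * _]mulrDl mul1r lerD2l.
have -> : cosmom 0 k - cosmom 0 k * (k.+1%:R / k.+2%:R) = cosmom 0 k / k.+2%:R.
  have k2 : (k.+2%:R : R) != 0 by [].
  have -> : k.+1%:R = k.+2%:R - 1 :> R by rewrite -[k.+2%:R]natr1 addrK.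
  by move: (k.+2%:R) (cosmom 0 k) k2 => A J A0; field.
rewrite [leRHS]mulrAC -[leRHS]mulrA; apply: ler_wpM2l => //.
apply: ler_wpM2l; first exact: ltW.
by rewrite lef_pV2 ?posrE// ler_nat /k; lia.
Qed.

End CosineIntegrals.

(** * Power series and the Euler product of the hyperbolic cosine *)

Section PowerSeries.
Variable R : realType.
Implicit Types (a b e : nat -> R) (x y s : R).

Lemma cvg_eq (f g : nat -> R) (l : R) : f =1 g ->
  g n @[n --> \oo] --> l -> f n @[n --> \oo] --> l.
Proof. by move=> fg; rewrite (funext fg). Qed.

(** Strong induction on the index: the lowest nonzero coefficient would dominate
    near 0.  Nonnegative arguments suffice, where the partial Euler products
    have nonnegative terms. *)
Lemma pseries_unique0 e :
  (forall x, 0 <= x -> \sum_(k < n) e k * x ^+ k @[n --> \oo] --> 0) -> e =1 (fun=> 0).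
Proof.
move=> h.
have e0 : e n @[n --> \oo] --> 0.
  have h1 := h 1 ler01.
  have h2 : \sum_(k < n.+1) e k * 1 ^+ k @[n --> \oo] --> 0.
    by rewrite (cvg_shiftS (fun n => \sum_(k < n) e k * 1 ^+ k)).
  have := cvgB h2 h1; rewrite subrr; move=> c; apply: (cvg_eq _ (c _)) => n /=.
  by rewrite big_ord_recr /= addrC addKr expr1n mulr1.
have [M M0 eM] : exists2 M, 0 < M & forall n, `|e n| <= M.
  have [M [_ hM]] := cvg_seq_bounded (cvgP _ e0).
  exists (`|M| + 1); first by rewrite ltr_wpDl.
  by move=> n; apply: hM => //; rewrite (le_lt_trans (ler_norm _))// ltrDl.
move=> k; elim/ltn_ind: k => k IH.
apply/eqP; rewrite -normr_le0.
(* The terms after the k-th are a geometric tail; divide by x^k and let x tend to 0. *)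
have key x : 0 < x -> x <= 1 / 2 -> `|e k| <= 2 * M * x.
  move=> x0 x2; have xk : 0 < x ^+ k by rewrite exprn_gt0.
  have cB : `|\sum_(j < n) e j * x ^+ j| @[n --> \oo] --> `|0 : R|.
    by apply: cvg_norm; apply: h; exact: ltW.
  have bound n : `|e k| * x ^+ k - 2 * M * x * x ^+ k <=
      `|\sum_(j < (k.+1 + n)%N) e j * x ^+ j|.
    rewrite big_split_ord /= big_ord_recr /= big1; last first.
      by move=> i _; rewrite IH// mul0r.
    rewrite add0r; apply: le_trans (lerB_normD _ _).
    rewrite normrM (gtr0_norm xk) lerD2l lerN2.
    apply: le_trans (ler_norm_sum _ _ _) _.
    have g m : \sum_(i < m) x ^+ i <= 2.
      have x1 : 1 - x != 0 by rewrite subr_eq0 eq_sym lt_eqF//; lra.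
      have := subrX1 x m; rewrite -[\sum_(i < m) _]/(\sum_(i < m) x ^+ i) => E.
      have xm : 0 <= x ^+ m by rewrite exprn_ge0// ltW.
      have S0 : 0 <= \sum_(i < m) x ^+ i by apply: sumr_ge0 => i _; rewrite exprn_ge0// ltW.
      have d0 : (1 - x) * \sum_(i < m) x ^+ i = 1 - x ^+ m by rewrite -opprB mulNr -E opprB.
      by nra.
    apply: (@le_trans _ _ (\sum_(i < n) M * x * x ^+ k * x ^+ i)).
      apply: ler_sum => i _; rewrite normrM normrX (gtr0_norm x0).
      have -> : M * x * x ^+ k * x ^+ i = M * x ^+ (k.+1 + i) by rewrite exprD exprS; ring.
      by apply: ler_wpM2r => //; rewrite exprn_ge0// ltW.
    rewrite -mulr_sumr.
    have c0 : 0 <= M * x * x ^+ k by rewrite !mulr_ge0// ltW.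
    apply: le_trans (ler_wpM2l c0 (g n)) _; lra.
  have : `|e k| * x ^+ k - 2 * M * x * x ^+ k <= 0.
    move: cB; rewrite normr0 -(cvg_shiftn k.+1) => cB.
    apply: ler_cvg_to (cvg_cst _) cB _.
    by apply: nearW => n; have := bound n; rewrite addnC.
  by rewrite -mulrBl pmulr_lle0// subr_le0.
apply: contraT; rewrite -ltNge => ek.
pose x := Num.min (1 / 2) (`|e k| / (4 * M)).
have x0 : 0 < x by rewrite lt_min divr_gt0//= divr_gt0// mulr_gt0.
have := key x x0; rewrite ge_min lexx => /(_ isT).
have : 4 * M * x <= `|e k|.
  have -> : `|e k| = 4 * M * (`|e k| / (4 * M)).
    by field; rewrite gt_eqF.
  by apply: ler_wpM2l; [rewrite mulr_ge0// ltW|rewrite ge_min lexx orbT].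
have : 0 < M * x by rewrite mulr_gt0.
lra.
Qed.

Lemma pseries_unique a b (f : R -> R) :
  (forall x, 0 <= x -> \sum_(k < n) a k * x ^+ k @[n --> \oo] --> f x) ->
  (forall x, 0 <= x -> \sum_(k < n) b k * x ^+ k @[n --> \oo] --> f x) -> a =1 b.
Proof.
move=> ha hb k; apply/eqP; rewrite -subr_eq0; apply/eqP.
apply: (@pseries_unique0 (fun k => a k - b k)) => x x0.
have := cvgB (ha _ x0) (hb _ x0); rewrite subrr; move=> c; apply: (cvg_eq _ (c _)) => n /=.
by rewrite -sumrB; apply: eq_bigr => i _; rewrite mulrBl.
Qed.

Lemma exp_series y : \sum_(k < n) y ^+ k / k`!%:R @[n --> \oo] --> expR y.
Proof.
have := is_cvg_series_exp_coeff y => /cvgP.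
have -> : (fun n => \sum_(k < n) y ^+ k / k`!%:R) = series (exp_coeff y).
  by apply/funext => n; rewrite /series /= big_mkord.
by [].
Qed.

(** Taylor coefficients of exp (c x), and of ch (pi x). *)
Definition ecoef (c : R) k : R := c ^+ k / k`!%:R.
Definition gam k : R := (ecoef pi k + ecoef (- pi) k) / 2.

Lemma gam_series s : \sum_(k < n) gam k * s ^+ k @[n --> \oo] --> ch (pi * s).
Proof.
have c : (\sum_(k < n) (pi * s) ^+ k / k`!%:R + \sum_(k < n) (- (pi * s)) ^+ k / k`!%:R) *
    2^-1 @[n --> \oo] --> ch (pi * s).
  by apply: cvgM; [apply: cvgD; exact: exp_series|exact: cvg_cst].
apply: (cvg_eq _ c) => n /=.
rewrite -big_split /= mulr_suml; apply: eq_bigr => i _.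
by rewrite /gam /ecoef -mulNr !exprMn; ring.
Qed.

Definition conv a b k : R := \sum_(i < k.+1) a i * b (k - i)%N.

Lemma coef_conv (p q : {poly R}) k : (p * q)`_k = conv (nth 0 p) (nth 0 q) k.
Proof. by rewrite coefM. Qed.

Lemma convDl a a' b k : conv (fun i => a i + a' i) b k = conv a b k + conv a' b k.
Proof. by rewrite -big_split; apply: eq_bigr => i _; rewrite mulrDl. Qed.

Lemma convDr a b b' k : conv a (fun i => b i + b' i) k = conv a b k + conv a b' k.
Proof. by rewrite -big_split; apply: eq_bigr => i _; rewrite mulrDr. Qed.

Lemma convZl c a b k : conv (fun i => a i * c) b k = conv a b k * c.
Proof. by rewrite mulr_suml; apply: eq_bigr => i _; rewrite mulrAC. Qed.

Lemma convZr c a b k : conv a (fun i => b i * c) k = conv a b k * c.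
Proof. by rewrite mulr_suml; apply: eq_bigr => i _; rewrite mulrA. Qed.

Lemma eq_conv a a' b b' : a =1 a' -> b =1 b' -> conv a b =1 conv a' b'.
Proof. by move=> ea eb k; apply: eq_bigr => i _; rewrite ea eb. Qed.

Lemma conv_ecoef c d k : conv (ecoef c) (ecoef d) k = ecoef (c + d) k.
Proof.
rewrite /ecoef addrC exprDn mulr_suml; apply: eq_bigr => i _.
have ik : (i <= k)%N by rewrite -ltnS.
have := bin_fact ik => /(congr1 (fun n => n%:R : R)); rewrite !natrM => E.
have f n : (n`!%:R : R) != 0 by rewrite pnatr_eq0 -lt0n fact_gt0.
rewrite -mulr_natr -E.
have B0 : ('C(k, i)%:R : R) != 0 by rewrite pnatr_eq0 -lt0n bin_gt0.
by field; rewrite B0 !f.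
Qed.

Lemma conv_le a a' b b' k : (forall i, 0 <= a i <= a' i) -> (forall i, 0 <= b i <= b' i) ->
  conv a b k <= conv a' b' k.
Proof.
move=> ha hb; apply: ler_sum => i _.
by have /andP[? ?] := ha i; have /andP[? ?] := hb (k - i)%N; apply: ler_pM.
Qed.

Lemma conv_ge0 a b k : (forall i, 0 <= a i) -> (forall i, 0 <= b i) -> 0 <= conv a b k.
Proof. by move=> ha hb; apply: sumr_ge0 => i _; rewrite mulr_ge0. Qed.

Lemma cvg_sum m (u : nat -> nat -> R) (l : nat -> R) :
  (forall k, (k < m)%N -> u n k @[n --> \oo] --> l k) ->
  \sum_(k < m) u n k @[n --> \oo] --> \sum_(k < m) l k.
Proof.
elim: m => [|m IH] h.
  by rewrite big_ord0; under eq_fun do rewrite big_ord0; exact: cvg_cst.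
rewrite big_ord_recr /=; under eq_fun do rewrite big_ord_recr /=.
by apply: cvgD; [apply: IH => k km; exact/h/ltnW|exact: h].
Qed.

Lemma conv_cvg (u u' : nat -> nat -> R) (l l' : nat -> R) k :
  (forall i, u n i @[n --> \oo] --> l i) -> (forall i, u' n i @[n --> \oo] --> l' i) ->
  conv (u n) (u' n) k @[n --> \oo] --> conv l l' k.
Proof.
move=> h h'.
apply: (@cvg_sum k.+1 (fun n i => u n i * u' n (k - i)%N) (fun i => l i * l' (k - i)%N)).
by move=> i _; apply: cvgM; [exact: h|exact: h'].
Qed.

(** Taylor coefficients of ch^2 (pi x) and of ch^4 (pi x). *)
Definition gam2 := conv gam gam.
Definition gam4 := conv gam2 gam2.

Lemma gam2E k : gam2 k = (ecoef (2 * pi) k + ecoef 0 k + ecoef 0 k + ecoef (- (2 * pi)) k) / 4.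
Proof.
rewrite /gam2 /gam convZl convZr convDl !convDr !conv_ecoef.
have -> : pi + pi = 2 * pi :> R by ring.
have -> : - pi - pi = - (2 * pi) :> R by ring.
rewrite addNr subrr; move: (ecoef _ k) (ecoef 0 k) (ecoef _ k) => x y z.
by field.
Qed.

Lemma ecoef_even c k : ~~ odd k -> ecoef (- c) k = ecoef c k.
Proof. by move=> ok; rewrite /ecoef exprNn -signr_odd (negbTE ok) mul1r. Qed.

Lemma ecoef_odd c k : odd k -> ecoef (- c) k = - ecoef c k.
Proof. by move=> ok; rewrite /ecoef exprNn -signr_odd ok mulN1r mulNr. Qed.

Lemma ecoef0 k : ecoef 0 k = (k == 0%N)%:R.
Proof. by rewrite /ecoef expr0n; case: k => [|k] /=; rewrite ?mul0r// divr1. Qed.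

Lemma ecoef_ge0 c k : 0 <= c -> 0 <= ecoef c k.
Proof. by move=> c0; rewrite divr_ge0 ?exprn_ge0. Qed.

Lemma gam_ge0 k : 0 <= gam k.
Proof.
have h := ecoef_ge0 k (pi_ge0 R); rewrite /gam; have [ok|ok] := boolP (odd k).
  by rewrite ecoef_odd// subrr mul0r.
by rewrite ecoef_even// divr_ge0// addr_ge0.
Qed.

Lemma gam2_ge0 k : 0 <= gam2 k.
Proof. by apply: conv_ge0; exact: gam_ge0. Qed.

Lemma gam2_odd k : odd k -> gam2 k = 0.
Proof.
move=> ok; rewrite gam2E ecoef_odd// ecoef0.
have -> : (k == 0%N) = false by case: k ok.
by rewrite !addr0 subrr mul0r.
Qed.

Lemma gam2_le k : gam2 k <= ecoef (2 * pi) k.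
Proof.
have p2 : 0 <= 2 * pi :> R by rewrite mulr_ge0// pi_ge0.
have h := ecoef_ge0 k p2.
have [ok|ok] := boolP (odd k); first by rewrite gam2_odd.
rewrite gam2E ecoef_even//.
have : ecoef 0 k <= ecoef (2 * pi) k.
  by rewrite ecoef0; case: k h {ok} => [|k] h //=; rewrite /ecoef expr0 fact0 divr1.
lra.
Qed.

(** ch^4 (pi x) has 4 pi as its highest frequency; all other frequencies
    contribute nonnegative amounts in even degree. *)
Lemma gam4_ge k : ~~ odd k -> ecoef (4 * pi) k / 8 <= gam4 k.
Proof.
move=> ok; have p2 : 0 <= 2 * pi :> R by rewrite mulr_ge0// pi_ge0.
have h := ecoef_ge0 k p2; have h0 := ecoef_ge0 k (lexx (0 : R)).
rewrite /gam4 (eq_conv gam2E gam2E) convZl convZr !convDl !convDr !conv_ecoef.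
rewrite !add0r !addr0 addNr subrr -opprD !ecoef_even//.
have -> : 2 * pi + 2 * pi = 4 * pi :> R by ring.
lra.
Qed.

End PowerSeries.

Section EulerProduct.
Variable R : realType.
Implicit Types (p q : {poly R}) (s : R).
Local Notation gam := (@gam R).

(** eprodp n is the n-th partial Euler product of ch (pi X), which is eprod n
    with all signs made positive. *)
Definition efacp n : {poly R} := 1 + ((n%:R + 2^-1) ^- 2) *: 'X^2.
Definition eprodp n : {poly R} := \prod_(k < n) efacp k.

Lemma eprodpS n : eprodp n.+1 = eprodp n + ((n%:R + 2^-1) ^- 2) *: (eprodp n * 'X^2).
Proof. by rewrite /eprodp big_ord_recr /= /efacp mulrDr mulr1 -scalerAr. Qed.

Lemma eprodp_eval n s : (eprodp n.+1).[s] *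
  (cosmom (2 * s) n.*2.+1 / cosmom 0 n.*2.+1) = ch (pi * s).
Proof.
have hz := half_neq0 R; elim: n => [|n IH].
  have r (t : R) : (1 + t ^+ 2) * cosmom t 1 = ch (t * (pi / 2)).
    by have := cosmom_rec t 0; rewrite expr1n mulr0 mul0r subr0.
  have r0 : cosmom 0 1 = 1 :> R.
    by have := r 0; rewrite expr0n addr0 mul1r mul0r ch0.
  rewrite r0 divr1 eprodpS /eprodp big_ord0 mul1r hornerD hornerZ hornerXn hornerC.
  have -> : pi * s = 2 * s * (pi / 2) by move: pi => p; field.
  by rewrite -r; field.
rewrite -IH [eprodp n.+2]eprodpS.
have := cosmom_rec (2 * s) n.*2.+2; have := cosmom_rec (0 : R) n.*2.+2.
have J0 := cosmom_gt0 R n; have J1 := cosmom_gt0 R n.+1.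
rewrite -doubleS /= in J1 *; rewrite doubleS in J1 *.
set I0 := cosmom 0 _ in J0 *; set I1 := cosmom 0 _ in J1 *.
set A0 := cosmom (2 * s) n.*2.+1; set A1 := cosmom (2 * s) _.
rewrite expr0n /= addr0 => /eqP; rewrite subr_eq0 => /eqP E0 /eqP; rewrite subr_eq0 => /eqP E1.
rewrite !hornerE /=; set P := (eprodp n.+1).[s].
set k := n.*2.+3%:R in E0 E1 *; set l := n.*2.+2%:R in E0 E1 *.
have hk : k = 2 * (n.+1%:R + 2^-1).
  by rewrite /k -[n.*2.+3]addn3 -[n.+1]addn1 !natrD -muln2 natrM; field.
have k0 : k != 0 by rewrite pnatr_eq0.
have l0 : l != 0 by rewrite pnatr_eq0.
have -> : (n.+1%:R + 2^-1) = k / 2 by rewrite hk; field.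
clearbody k l; clear hk.
have I1E : I1 = l * I0 / k.
  by apply: (mulfI (expf_neq0 2 k0)); rewrite E0; field.
have A0E : A0 = (k ^+ 2 + (2 * s) ^+ 2) * A1 / (k * l).
  by rewrite E1; field; rewrite ?k0 ?l0.
have I00 : I0 != 0 by rewrite gt_eqF.
rewrite I1E A0E; clear - k0 l0 I00; clearbody I0 A1 P; field.
by rewrite ?k0 ?l0 ?I00.
Qed.

Lemma eprodp_bounds s : 0 <= s -> exists C, forall n,
  (eprodp n.+1).[s] <= ch (pi * s) <= (eprodp n.+1).[s] * (1 + C / n.+1%:R).
Proof.
move=> s0; have [|C hC] := @cosmom_ratio R (2 * s); first by rewrite mulr_ge0.
exists C => n; have /andP[h1 h2] := hC n; have E := eprodp_eval n s.
have r0 : 0 < cosmom (2 * s) n.*2.+1 / cosmom 0 n.*2.+1 by apply: lt_le_trans h1.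
have P0 : 0 <= (eprodp n.+1).[s].
  by rewrite -(pmulr_lge0 _ r0) E (le_trans ler01)// ch_ge1.
by rewrite -E; apply/andP; split; [exact: ler_peMr|exact: ler_wpM2l].
Qed.

Lemma eprodp_ge0 n k : 0 <= (eprodp n)`_k.
Proof.
elim: n k => [|n IH] k; first by rewrite /eprodp big_ord0 coef1.
rewrite eprodpS coefD coefZ coefMXn addr_ge0// mulr_ge0//.
by case: ifP.
Qed.

Lemma eprodp_nd k : nondecreasing_seq (fun n => (eprodp n)`_k).
Proof.
apply/nondecreasing_seqP => n; rewrite eprodpS coefD lerDl coefZ coefMXn mulr_ge0//.
by case: ifP => // _; exact: eprodp_ge0.
Qed.

Lemma eprodp_trunc n m s : 0 <= s -> \sum_(k < m) (eprodp n)`_k * s ^+ k <= (eprodp n).[s].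
Proof.
move=> s0; set p := eprodp n.
rewrite (@horner_coef_wide _ (maxn m (size p))) ?leq_maxr//.
rewrite (big_ord_widen (maxn m (size p)) (fun k => p`_k * s ^+ k)) ?leq_maxl//.
rewrite big_mkcond /=; apply: ler_sum => k _; case: ifP => // _.
by rewrite mulr_ge0 ?exprn_ge0 ?eprodp_ge0.
Qed.

Lemma eprodp_coef_ub n k : (eprodp n)`_k <= ch pi.
Proof.
have [C hC] := eprodp_bounds ler01; have /andP[h _] := hC n; rewrite mulr1 in h.
apply: le_trans (le_trans _ h); first exact: (eprodp_nd k (leqnSn n)).
apply: le_trans (eprodp_trunc n.+1 k.+1 ler01).
rewrite big_ord_recr /= expr1n mulr1 lerDr.
by apply: sumr_ge0 => i _; rewrite expr1n mulr1 eprodp_ge0.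
Qed.

(** Euler's product formula for ch, coefficient by coefficient.  The coefficients
    of the partial products increase to limits al; monotone convergence and
    the two-sided bound on the values give sum al_k s^k = ch (pi s), and power
    series have unique coefficients. *)
Lemma eprodp_cvg k : (eprodp n)`_k @[n --> \oo] --> gam k.
Proof.
have cv j : cvgn (fun n => (eprodp n)`_j).
  apply: nondecreasing_is_cvgn; first exact: eprodp_nd.
  by exists (ch pi) => _ [n _ <-]; exact: eprodp_coef_ub.
pose al j := limn (fun n => (eprodp n)`_j).
have alc j : (eprodp n)`_j @[n --> \oo] --> al j by exact: cv.
have le n j : (eprodp n)`_j <= al j.
  exact: (nondecreasing_cvgn_le (@eprodp_nd j) (cv j)).
suff -> : gam k = al k by [].
apply: (@pseries_unique _ gam al (fun s => ch (pi * s))) => s s0; first exact: gam_series.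
have [C hC] := eprodp_bounds s0.
have c0 : (0 <= C).
  have /andP[h1 h2] := hC 0%N; move: (le_trans h1 h2).
  have P0 : 0 < (eprodp 1).[s].
    rewrite eprodpS /eprodp big_ord0 mul1r hornerD hornerC hornerZ hornerXn.
    by rewrite ltr_pwDl// mulr_ge0// exprn_ge0.
  by rewrite divr1 ler_pMr// lerDl.
have up m : \sum_(j < m) al j * s ^+ j <= ch (pi * s).
  have c1 : \sum_(j < m) (eprodp n)`_j * s ^+ j @[n --> \oo] --> \sum_(j < m) al j * s ^+ j.
    apply: (@cvg_sum R m (fun n j => (eprodp n)`_j * s ^+ j) (fun j => al j * s ^+ j)).
    by move=> j _; apply: cvgM => //; exact: cvg_cst.
  apply: ler_cvg_to c1 (cvg_cst (ch (pi * s))) _; near=> n.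
  have n0 : (0 < n)%N by near: n; exact: nbhs_infty_gt.
  apply: le_trans (eprodp_trunc n m s0) _.
  by rewrite -(prednK n0); have /andP[] := hC n.-1.
apply/cvgrPdist_le => e e0.
have cl : ch (pi * s) * C / n.+1%:R @[n --> \oo] --> 0.
  by rewrite -[0](mulr0 (ch (pi * s) * C)); apply: cvgM; [exact: cvg_cst|exact: cvg_harmonic].
have [N _ /(_ N (leqnn _)) /= hN] := cvgr_le _ cl _ e0.
near=> m.
rewrite ger0_norm ?subr_ge0 ?up//.
have /andP[h1 h2] := hC N.
have le2 : (eprodp N.+1).[s] <= \sum_(j < m) al j * s ^+ j.
  rewrite (@horner_coef_wide _ m); last by near: m; exact: nbhs_infty_ge.
  by apply: ler_sum => j _; apply: ler_wpM2r; rewrite ?exprn_ge0.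
have cn : 0 <= C / N.+1%:R by rewrite divr_ge0.
have h3 := ler_wpM2r cn h1.
rewrite -mulrA in hN; rewrite mulrDr mulr1 in h2.
rewrite lerBlDr (le_trans h2)// addrC lerD// (le_trans h3)//.
Unshelve. all: by end_near. Qed.

Lemma eprodp_le n k : (eprodp n)`_k <= gam k.
Proof.
have c := @eprodp_cvg k.
by have := nondecreasing_cvgn_le (@eprodp_nd k) (cvgP _ c) n; rewrite (cvg_lim _ c).
Qed.

End EulerProduct.

(** * Inversion in mean square by polynomials in the Euler operator *)

Section AlternatingPolynomials.
Variable R : realType.
Implicit Types (p q pb qb : {poly R}).

(** p(X) = pb(i X) with pb even: the coefficients of p alternate in sign when
    those of pb are nonnegative. *)
Definition altpoly p pb := forall k, (odd k -> pb`_k = 0) /\ p`_k = (-1) ^+ k./2 * pb`_k.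

Lemma altpolyM p pb q qb : altpoly p pb -> altpoly q qb -> altpoly (p * q) (pb * qb).
Proof.
move=> hp hq k; split.
  move=> ok; rewrite coefM big1// => i _.
  have [oi|oi] := boolP (odd i); first by rewrite (hp i).1// mul0r.
  by rewrite (hq _).1 ?mulr0// oddB ?ok ?(negbTE oi)// -ltnS.
rewrite !coefM mulr_sumr; apply: eq_bigr => i _.
rewrite (hp i).2 (hq _).2.
have [oi|oi] := boolP (odd i); first by rewrite (hp i).1// mulr0 !mul0r mulr0.
have [oj|oj] := boolP (odd (k - i)); first by rewrite (hq _).1// !mulr0.
have ik : (i <= k)%N by rewrite -ltnS.
have -> : k./2 = (i./2 + (k - i)./2)%N.
  by rewrite -[in LHS](subnKC ik) halfD (negbTE oi).
by rewrite exprD; ring.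
Qed.

Lemma altpoly_efac n : altpoly (efac R n) (efacp R n).
Proof.
move=> k; rewrite /efac /efacp coefB coefD coefZ coefXn coef1; split.
  by case: k => [|[|[|k]]] //= _; rewrite mulr0 addr0.
by case: k => [|[|[|k]]] //=; rewrite ?expr0 ?expr1; ring.
Qed.

Lemma altpoly_eprod n : altpoly (eprod R n) (eprodp R n).
Proof.
elim: n => [|n IH].
  rewrite /eprod /eprodp !big_ord0 => k; rewrite coef1.
  by case: k => [|k] /=; rewrite ?mulr0 ?mulr1 ?expr0.
by rewrite /eprod /eprodp !big_ord_recr /=; apply: altpolyM => //; exact: altpoly_efac.
Qed.

End AlternatingPolynomials.

Section ActMul.
Variable R : realType.
Implicit Types (p q : {poly R}) (v : nat -> R -> R) (x : R).

Lemma actMX p v x : act (p * 'X) v x = act p (fun k => v k.+1) x.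
Proof.
rewrite (@actE _ (size p).+1); last by rewrite (leq_trans (size_polyMleq _ _))// size_polyX addn2.
rewrite big_ord_recl /= coefMX eqxx mul0r add0r /act.
by apply: eq_bigr => j _; rewrite coefMX.
Qed.

Lemma actC c v x : act c%:P v x = c * v 0%N x.
Proof. by rewrite (@actE _ 1) ?size_polyC_leq1// big_ord1 coefC. Qed.

Lemma actM p q v x :
  act (p * q) v x = act p (fun i => act q (fun j => v (i + j)%N)) x.
Proof.
elim/poly_ind: p v => [|p c IH] v; first by rewrite mul0r !act0.
rewrite mulrDl actD -mulrA ['X * q]mulrC mulrA actMX IH mul_polyC actZ.
by rewrite actD actMX actC.
Qed.

End ActMul.

Section ChainNorms.
Variable R : realType.
Implicit Types (p q pb : {poly R}) (x : R).
Variable v : nat -> R -> R.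
Hypothesis cv : sqchain v.

Definition hankel_wt n : R := if odd n then 0 else sqnorm (v n./2).

Lemma hankel_wt_ge0 n : 0 <= hankel_wt n.
Proof. by rewrite /hankel_wt; case: ifP => // _; exact: sqnorm_ge0. Qed.

(** By skew-symmetry <v_i, v_j> depends, up to sign, only on i + j; it vanishes
    for i + j odd and equals the squared norm of v_((i+j)/2) up to sign for
    i + j even.  So the Gram matrix of a chain is a signed Hankel matrix. *)
Lemma gram_hankel i j : inner (v i) (v j) = (-1) ^+ (i + (i + j)./2) * hankel_wt (i + j).
Proof.
have step n k : (k <= n)%N -> inner (v k) (v (n - k)%N) = (-1) ^+ k * inner (v 0%N) (v n).
  elim: k => [|k IH] kn; first by rewrite subn0 mul1r.
  rewrite chain_skew// -subSn// subSS IH ?(ltnW kn)// exprS mulN1r mulNr//.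
have e : inner (v i) (v j) = (-1) ^+ i * inner (v 0%N) (v (i + j)%N).
  by rewrite -(step (i + j)%N i (leq_addr _ _)) addKn.
rewrite e exprD -mulrA; congr (_ * _); rewrite /hankel_wt.
set n := (i + j)%N; have [on|on] := boolP (odd n).
  have := step n n (leqnn n); rewrite subnn innerC -signr_odd on expr1 mulr0 => h.
  by apply/eqP; have := h; lra.
have k2 : (n - n./2)%N = n./2.
  by rewrite -[in X in (X - _)%N](odd_double_half n) (negbTE on) add0n -addnn addnK.
have hn : (n./2 <= n)%N by rewrite -{2}(odd_double_half n) -addnn addnA leq_addl.
have := step n n./2 hn; rewrite k2 inner_sqnorm => ->.
by rewrite mulrA -exprD addnn -signr_odd odd_double mul1r.
Qed.

(** The linear functional X^k |-> hankel_wt k. *)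
Definition wsum q : R := act q (fun k _ => hankel_wt k) 0.

Lemma sqnorm_act p : sqnorm (act p v) =
  \sum_(i < size p) \sum_(j < size p) p`_i * p`_j * inner (v i) (v j).
Proof.
have sv := cv.2; have sa := sqint_act p sv.
rewrite -inner_sqnorm {1}/act (inner_suml (f := fun k x => p`_k * v k x)) => [|k _|//]; last exact: sqintZ.
apply: eq_bigr => i _; rewrite innerZl// innerC /act.
rewrite (inner_suml (f := fun k x => p`_k * v k x)) => [|k _|//]; last exact: sqintZ.
by rewrite mulr_sumr; apply: eq_bigr => j _; rewrite innerZl// innerC mulrA.
Qed.

Lemma wsumM m p q : (size p <= m)%N -> (size q <= m)%N ->
  wsum (p * q) = \sum_(i < m) \sum_(j < m) p`_i * q`_j * hankel_wt (i + j).
Proof.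
move=> pm qm; rewrite /wsum actM (actE _ _ pm); apply: eq_bigr => i _.
rewrite (actE _ _ qm) mulr_sumr.
by apply: eq_bigr => j _; rewrite mulrA.
Qed.

Definition absp p : {poly R} := \poly_(i < size p) `|p`_i|.

Lemma coef_absp p k : (absp p)`_k = `|p`_k|.
Proof. by rewrite coef_poly; case: ltnP => // h; rewrite nth_default// normr0. Qed.

Lemma size_absp p : (size (absp p) <= size p)%N.
Proof. exact: size_poly. Qed.

Lemma sqnorm_act_le p : sqnorm (act p v) <= wsum (absp p * absp p).
Proof.
rewrite sqnorm_act (wsumM (size_absp p) (size_absp p)).
apply: ler_sum => i _; apply: ler_sum => j _; rewrite !coef_absp gram_hankel.
apply: le_trans (ler_norm _) _.
by rewrite !normrM normrX normrN1 expr1n mul1r (ger0_norm (hankel_wt_ge0 _)).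
Qed.

(** For an even polynomial with alternating signs the signs of the Hankel matrix
    cancel: the norm of p(theta) v becomes a sum with nonnegative terms. *)
Lemma sqnorm_act_alt p pb : altpoly p pb -> sqnorm (act p v) = wsum (pb * pb).
Proof.
move=> hp.
have nz k : (pb`_k == 0) = (p`_k == 0).
  by rewrite (hp k).2 mulf_eq0 expf_eq0 oppr_eq0 oner_eq0 andbF.
have -> : pb = \poly_(i < size p) ((-1) ^+ i./2 * p`_i).
  apply/polyP => k; rewrite coef_poly; case: ltnP => h.
    by rewrite (hp k).2 mulrA -exprD addnn -signr_odd odd_double mul1r.
  by apply/eqP; rewrite nz nth_default.
set qb := \poly_(_ < _) _.
have cq k : qb`_k = (-1) ^+ k./2 * p`_k.
  by rewrite coef_poly; case: ltnP => // h; rewrite nth_default// mulr0.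
have odd0 k : odd k -> p`_k = 0 by move=> ok; apply/eqP; rewrite -nz (hp k).1.
have sq : (size qb <= size p)%N by exact: size_poly.
rewrite sqnorm_act (wsumM sq sq).
apply: eq_bigr => i _; apply: eq_bigr => j _; rewrite !cq gram_hankel.
have [oi|oi] := boolP (odd i); first by rewrite odd0// !(mulr0, mul0r).
have [oj|oj] := boolP (odd j); first by rewrite (odd0 j)// !(mulr0, mul0r).
have si : (-1) ^+ i = 1 :> R by rewrite -signr_odd (negbTE oi).
by rewrite exprD si mul1r halfD (negbTE oi) add0n exprD; ring.
Qed.

Lemma wsumE m q : (size q <= m)%N -> wsum q = \sum_(k < m) q`_k * hankel_wt k.
Proof. by move=> qm; rewrite /wsum (actE _ _ qm). Qed.

Lemma wsum_ge m q : (forall k, 0 <= q`_k) -> \sum_(k < m) q`_k * hankel_wt k <= wsum q.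
Proof.
move=> q0; rewrite (@wsumE (maxn m (size q))) ?leq_maxr//.
rewrite (big_ord_widen (maxn m (size q)) (fun k => q`_k * hankel_wt k)) ?leq_maxl//.
rewrite big_mkcond /=; apply: ler_sum => k _; case: ifP => // _.
by rewrite mulr_ge0 ?hankel_wt_ge0.
Qed.

End ChainNorms.

Section Inversion.
Variable R : realType.
Implicit Types (f g F : R -> R) (p q : {poly R}) (x : R).
Local Notation pi := (@pi R).
Local Notation eprod := (eprod R).
Local Notation eprodp := (eprodp R).

(** The operator f |-> G of the theorem, seen as the square of the Carleman
    operator sop 1, and the chain of theta^k G. *)
Definition carleman2 F : R -> R := sop 1 (sop 1 F).
Definition tchain F : nat -> R -> R := sopchain 1 (sop 1 F).

Lemma tchain_sqchain F : sqint F -> sqchain (tchain F).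
Proof. by move=> sF; apply: sop_sqchain; exact: sqint_sop. Qed.

Lemma sop_QE n g x : sqint g -> 0 < x -> @Cn R n * sop (Q R ^+ n) g x = pi * En n g x.
Proof.
move=> sg x0; rewrite /En sopZl// mulrA mulrCA divff ?mulr1//.
by rewrite gt_eqF// pi_gt0.
Qed.

(** T = S^2 and each factor S absorbs one Euler product. *)
Lemma act_eprod2 N F x : sqint F -> 0 < x ->
  act (eprod N * eprod N) (tchain F) x = pi ^+ 2 * En N (En N F) x.
Proof.
move=> sF x0; have s1 := sqint_sop 1 sF; have [sE _] := En_contract N sF.
have hs := sop_sqchain 1 sF.
rewrite /tchain -(sop_opact (eprod N * eprod N) 1 s1 x0) opactM opact_eprod opactZr.
rewrite (sopZl _ _ s1 x0).
have -> : sop (opact (eprod N) (Q R ^+ N)) (sop 1 F) x =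
    sop (Q R ^+ N) (act (eprod N) (sopchain 1 F)) x.
  by rewrite (sop_act (eprod N) (Q R ^+ N) hs x0).
rewrite (@sop_extr _ _ _ (fun t => pi * En N F t)); last first.
  move=> t t0; rewrite -(sop_opact (eprod N) 1 sF t0) opact_eprod (sopZl _ _ sF t0).
  exact: sop_QE.
by rewrite (sopZr _ _ sE x0) mulrCA (sop_QE N sE x0) mulrA.
Qed.

(** The analytic core.  The square of a partial Euler product, applied to T F, has
    norm at most pi^2 |F|; the norm being a positive sum, each of its finite
    sections passes to the limit, where the product has become ch^4 (pi X).
    Thus G = T F is an analytic vector of theta, with the exact radius. *)
Lemma hankel_wt_summable F m : sqint F ->
  \sum_(k < m) ecoef (4 * pi) k * hankel_wt (tchain F) k <= 8 * (pi ^+ 4 * sqnorm F).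
Proof.
move=> sF; have cT := tchain_sqchain sF.
have up N : \sum_(k < m) ((eprodp N * eprodp N) * (eprodp N * eprodp N))`_k * hankel_wt (tchain F) k
    <= pi ^+ 4 * sqnorm F.
  have ge0 k : 0 <= ((eprodp N * eprodp N) * (eprodp N * eprodp N))`_k.
    by rewrite !coef_conv; apply: conv_ge0 => i; rewrite coef_conv; apply: conv_ge0 => ?; exact: eprodp_ge0.
  apply: le_trans (wsum_ge (tchain F) m ge0) _.
  have alt := altpolyM (altpoly_eprod R N) (altpoly_eprod R N).
  rewrite -(sqnorm_act_alt cT alt).
  have [sE hE] := En_contract N sF; have [sEE hEE] := En_contract N sE.
  rewrite (sqnorm_ext (fun (x : R) (x0 : 0 < x) => act_eprod2 N sF x0)) (sqnormZ _ sEE) -exprM.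
  apply: ler_wpM2l; first by rewrite exprn_ge0// pi_ge0.
  exact: (le_trans hEE hE).
have lim : \sum_(k < m) ((eprodp N * eprodp N) * (eprodp N * eprodp N))`_k * hankel_wt (tchain F) k
    @[N --> \oo] --> \sum_(k < m) gam4 R k * hankel_wt (tchain F) k.
  apply: (@cvg_sum R m (fun N k => ((eprodp N * eprodp N) * (eprodp N * eprodp N))`_k *
    hankel_wt (tchain F) k) (fun k => gam4 R k * hankel_wt (tchain F) k)) => k _.
  apply: cvgM; last exact: cvg_cst.
  have c2 i : (eprodp N * eprodp N)`_i @[N --> \oo] --> gam2 R i.
    apply: (cvg_eq (fun N => coef_conv _ _ _)).
    by apply: (conv_cvg (u := fun N i => (eprodp N)`_i) (u' := fun N i => (eprodp N)`_i)) => j; exact: eprodp_cvg.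
  apply: (cvg_eq (fun N => coef_conv _ _ _)).
  exact: (conv_cvg (u := fun N i => (eprodp N * eprodp N)`_i) (u' := fun N i => (eprodp N * eprodp N)`_i)).
have {}lim : \sum_(k < m) gam4 R k * hankel_wt (tchain F) k <= pi ^+ 4 * sqnorm F.
  by apply: (ler_cvg_to lim (cvg_cst (pi ^+ 4 * sqnorm F))); exact: nearW.
have -> : \sum_(k < m) ecoef (4 * pi) k * hankel_wt (tchain F) k =
    8 * \sum_(k < m) ecoef (4 * pi) k / 8 * hankel_wt (tchain F) k.
  by rewrite mulr_sumr; apply: eq_bigr => k _; field.
apply: ler_wpM2l => //; apply: (le_trans _ lim); apply: ler_sum => k _.
have [ok|ok] := boolP (odd k); first by rewrite /hankel_wt ok !mulr0.
by apply: ler_wpM2r; [exact: hankel_wt_ge0|exact: gam4_ge].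
Qed.

(** Dominated convergence for series: with a_n the polynomial of the absolute
    values of the coefficients of d_n, the squared norm of d_n(theta) G is at most
    the sum of hankel_wt k times the k-th coefficient of a_n^2, which is dominated
    by the summable C^2 (4 pi)^k / k! hankel_wt k. *)
Lemma act_to0 F (d : nat -> {poly R}) C : sqint F ->
  (forall n k, `|(d n)`_k| <= C * ecoef (2 * pi) k) ->
  (forall k, (d n)`_k @[n --> \oo] --> 0) ->
  sqnorm (act (d n) (tchain F)) @[n --> \oo] --> 0.
Proof.
move=> sF dC d0; have cT := tchain_sqchain sF.
set w := hankel_wt (tchain F); have w0 k : 0 <= w k by exact: hankel_wt_ge0.
pose S m := \sum_(k < m) ecoef (4 * pi) k * w k.
have e40 k : 0 <= ecoef (4 * pi) k by rewrite ecoef_ge0// mulr_ge0// pi_ge0.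
have ndS : nondecreasing_seq S.
  by apply/nondecreasing_seqP => m; rewrite /S big_ord_recr /= lerDl mulr_ge0.
have cS : cvgn S.
  apply: nondecreasing_is_cvgn => //.
  by exists (8 * (pi ^+ 4 * sqnorm F)) => _ [m _ <-]; exact: hankel_wt_summable.
have leS m : S m <= limn S by exact: nondecreasing_cvgn_le.
pose c n k := conv (fun i => `|(d n)`_i|) (fun i => `|(d n)`_i|) k.
have c_ge0 n k : 0 <= c n k by apply: conv_ge0.
have c_le n k : c n k <= C ^+ 2 * ecoef (4 * pi) k.
  apply: (@le_trans _ _ (conv (fun i => ecoef (2 * pi) i * C) (fun i => ecoef (2 * pi) i * C) k)).
    by apply: conv_le => i; rewrite normr_ge0 mulrC dC.
  rewrite convZl convZr conv_ecoef.
  have -> : 2 * pi + 2 * pi = 4 * pi by ring.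
  by have -> : C ^+ 2 * ecoef (4 * pi) k = ecoef (4 * pi) k * C * C by ring.
have dn i : `|(d n)`_i| @[n --> \oo] --> (0 : R).
  have : `|(d n)`_i| @[n --> \oo] --> `|0 : R| by apply: cvg_norm; exact: d0.
  by rewrite normr0.
have c_0 k : c n k @[n --> \oo] --> 0.
  have z : conv (fun=> 0) (fun=> 0) k = 0 :> R.
    by rewrite /conv big1// => i _; rewrite mul0r.
  rewrite -[0]z.
  apply: (conv_cvg (u := fun n i => `|(d n)`_i|) (u' := fun n i => `|(d n)`_i|) (l := fun=> 0) (l' := fun=> 0)) => i.
    exact: dn.
  exact: dn.
have bound n K : sqnorm (act (d n) (tchain F)) <=
    \sum_(k < K) c n k * w k + C ^+ 2 * (limn S - S K).
  apply: le_trans (sqnorm_act_le cT _) _.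
  set q := absp (d n) * absp (d n).
  have qE k : q`_k = c n k.
    by rewrite coef_conv; apply: eq_conv => i; rewrite coef_absp.
  rewrite (@wsumE _ _ (K + size q)) ?leq_addl// big_split_ord /=.
  apply: lerD; first by apply: ler_sum => k _; rewrite qE.
  apply: (@le_trans _ _ (C ^+ 2 * (S (K + size q)%N - S K))).
    have -> : S (K + size q)%N - S K =
        \sum_(k < size q) ecoef (4 * pi) (K + k) * w (K + k)%N.
      by rewrite /S big_split_ord /= addrAC subrr add0r.
    rewrite mulr_sumr; apply: ler_sum => k _.
    by rewrite qE mulrA; apply: ler_wpM2r.
  by apply: ler_wpM2l; [exact: sqr_ge0|rewrite lerD2r].
apply/cvgrPdist_le => e e0.
have t0 : C ^+ 2 * (limn S - S K) @[K --> \oo] --> 0.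
  rewrite -[0](mulr0 (C ^+ 2)); apply: cvgM; first exact: cvg_cst.
  by rewrite -(subrr (limn S)); apply: cvgB => //; exact: cvg_cst.
have e2 : 0 < e / 2 by rewrite divr_gt0.
have [K _ /(_ K (leqnn _)) /= hK] := cvgr_le _ t0 _ e2.
have f0 : \sum_(k < K) c n k * w k @[n --> \oo] --> 0.
  have h : \sum_(k < K) c n k * w k @[n --> \oo] --> \sum_(k < K) (0 * w k).
    apply: (@cvg_sum R K (fun n k => c n k * w k) (fun k => 0 * w k)) => k _.
    by apply: cvgM => //; exact: cvg_cst.
  have z : \sum_(k < K) (0 * w k) = 0 by apply: big1 => k _; rewrite mul0r.
  by rewrite z in h.
near=> n.
rewrite sub0r normrN ger0_norm ?sqnorm_ge0//.
apply: le_trans (bound n K) _.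
have : \sum_(k < K) c n k * w k <= e / 2 by near: n; exact: (cvgr_le _ f0).
lra.
Unshelve. all: by end_near. Qed.

(** Any polynomials approximating cos^2(pi X) coefficientwise, with the natural
    domination, invert T: they may be compared with the squares of the Euler
    products, for which the inverse is the strong limit of En. *)
Lemma inversion_cvg F (z : nat -> {poly R}) C : sqint F ->
  (forall n k, `|(z n)`_k| <= C * ecoef (2 * pi) k) ->
  (forall k, (z n)`_k @[n --> \oo] --> (-1) ^+ k./2 * gam2 R k) ->
  sqnorm (fun x => act (z n) (tchain F) x - pi ^+ 2 * F x) @[n --> \oo] --> 0.
Proof.
move=> sF zC zc; have cT := tchain_sqchain sF; have sT := cT.2.
pose q n := eprod n * eprod n.
have qE n k : (q n)`_k = (-1) ^+ k./2 * (eprodp n * eprodp n)`_k.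
  by have [_] := altpolyM (altpoly_eprod R n) (altpoly_eprod R n) k.
have d1 : sqnorm (act (z n - q n) (tchain F)) @[n --> \oo] --> 0.
  apply: (@act_to0 _ (fun n => z n - q n) (C + 1)) => //.
    move=> n k; rewrite coefB mulrDl mul1r; apply: le_trans (ler_normB _ _) _.
    apply: lerD; first exact: zC.
    rewrite qE normrM normrX normrN1 expr1n mul1r coef_conv ger0_norm; last first.
      by apply: conv_ge0 => i; exact: eprodp_ge0.
    apply: le_trans (gam2_le R k); apply: conv_le => i; by rewrite eprodp_ge0 eprodp_le.
  move=> k.
  have c2 : (q n)`_k @[n --> \oo] --> (-1) ^+ k./2 * gam2 R k.
    apply: (cvg_eq (fun n => qE n k)); apply: cvgM; first exact: cvg_cst.
    apply: (cvg_eq (fun N => coef_conv _ _ _)).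
    by apply: (conv_cvg (u := fun N i => (eprodp N)`_i) (u' := fun N i => (eprodp N)`_i)) => j; exact: eprodp_cvg.
  have c3 : (z n)`_k - (q n)`_k @[n --> \oo] --> (-1) ^+ k./2 * gam2 R k - (-1) ^+ k./2 * gam2 R k.
    exact: cvgB.
  rewrite subrr in c3.
  by apply: (cvg_eq _ c3) => n; rewrite coefB.
have cE := En_cvg_sqint sF.
have lim : 2 * sqnorm (act (z n - q n) (tchain F)) +
    8 * pi ^+ 4 * sqnorm (fun x => En n F x - F x) @[n --> \oo] --> 0.
  rewrite -[0]addr0; apply: cvgD.
    by rewrite -[0](mulr0 2); apply: cvgM => //; exact: cvg_cst.
  by rewrite -[0](mulr0 (8 * pi ^+ 4)); apply: cvgM => //; exact: cvg_cst.
apply: squeeze_cvgr (cvg_cst 0) lim; apply: nearW => n; rewrite sqnorm_ge0 /=.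
have [sE hE] := En_contract n sF; have [sEE _] := En_contract n sE.
have sd : sqint (fun x => En n F x - F x) by exact: sqintB.
have [sEd hEd] := En_contract n sd.
have s1 : sqint (act (z n - q n) (tchain F)) by exact: sqint_act.
have s2 : sqint (fun x => En n (fun y => En n F y - F y) x + (En n F x - F x)) by exact: sqintD.
rewrite (@sqnorm_ext _ _ (fun x => act (z n - q n) (tchain F) x +
   pi ^+ 2 * (En n (fun y => En n F y - F y) x + (En n F x - F x)))); last first.
  by move=> x x0; rewrite actB act_eprod2// /En (sopBr _ sE sF x0) -/(En n F x); ring.
apply: le_trans (sqnormD_le s1 (sqintZ _ s2)) _; rewrite lerD2l sqnormZ//.
have h := sqnormD_le sEd sd; rewrite -exprM.
have p4 : 0 <= pi ^+ 4 by rewrite exprn_ge0// pi_ge0.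
have -> : 8 * pi ^+ 4 * sqnorm (fun x => En n F x - F x) =
   2 * (pi ^+ 4 * (4 * sqnorm (fun x => En n F x - F x))) by ring.
by apply: ler_wpM2l => //; apply: ler_wpM2l => //; lra.
Qed.

End Inversion.

(** * The logarithmic kernel and iterated Euler operators *)

Section LogKernel.
Variable R : realType.
Implicit Types (f g : R -> R) (x t s : R).
Local Notation mu := (@lebesgue_measure R).

(** The partial fraction decomposition of 1/((x+s)(s+t)); on the diagonal the
    primitive degenerates to - 1/(x+s). *)
Lemma log_kernelE x t : 0 < x -> 0 < t ->
  integ (fun s => ker 1 x s * ker 1 s t) /\
  hint (fun s => ker 1 x s * ker 1 s t) = log_kernel x t.
Proof.
move=> x0 t0; rewrite /log_kernel.
have cV (y s : R) : 0 < y -> 0 < s -> {for s, continuous (fun s : R => (y + s)^-1)}.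
  by move=> y0 s0; apply: cont_addV; [exact: ltW|exact: addr_gt0].
have E s : ker 1 x s * ker 1 s t = (x + s)^-1 * (t + s)^-1.
  by rewrite !ker1 [s + t]addrC.
rewrite (funext E).
have cf s : 0 < s -> {for s, continuous (fun s : R => (x + s)^-1 * (t + s)^-1)}.
  by move=> s0; apply: cvgM; exact: cV.
have f0 s : 0 < s -> 0 <= (x + s)^-1 * (t + s)^-1.
  by move=> s0; rewrite mulr_ge0// invr_ge0 addr_ge0 ?ltW.
have dadd (y s : R) : is_derive s 1 (fun s : R => y + s) (0 + 1) := dD (dcst y s) (did s).
case: eqP => [tx|/eqP tx].
  rewrite tx in E cf f0 *.
  have := @ftc_ge0 R (fun s => (x + s)^-1 * (x + s)^-1) (fun s => - (x + s)^-1) (- x^-1) 0.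
  rewrite opprK add0r; apply => //.
  - move=> s s0; have xs : x + s != 0 by rewrite gt_eqF// addr_gt0.
    rewrite (_ : (fun _ => _) = fun s => (-1) * (x + s)^-1); last first.
      by apply/funext => r; rewrite mulN1r.
    apply: is_derive_eq (dZ _ (dV (f := fun s => x + s) xs (dadd x s))) _.
    by rewrite add0r; field.
  - apply: cvgN; have c0 : {for 0, continuous (fun t : R => (x + t)^-1)}.
      by apply: cont_addV; rewrite ?addr0// ltW.
    by have := cvg_at_right_filter c0; rewrite addr0.
  - by rewrite -oppr0; apply: cvgN; exact: cvg_addV.
have xt : x - t != 0 by rewrite subr_eq0 eq_sym.
pose F s := (ln (t + s) - ln (x + s)) / (x - t).
have := @ftc_ge0 R _ F ((ln t - ln x) / (x - t)) 0 _ cf f0.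
have -> : 0 - (ln t - ln x) / (x - t) = (ln x - ln t) / (x - t).
  by rewrite sub0r -mulNr opprB.
apply.
- move=> s s0; have xs : 0 < x + s by exact: addr_gt0.
  have ts : 0 < t + s by exact: addr_gt0.
  have d1 := dcomp (f := @ln R) (g := fun s => t + s) (is_derive1_ln ts) (dadd t s).
  have d2 := dcomp (f := @ln R) (g := fun s => x + s) (is_derive1_ln xs) (dadd x s).
  apply: is_derive_eq (dM (dB d1 d2) (dcst (x - t)^-1 s)) _.
  by field; rewrite ?xt ?(gt_eqF xs) ?(gt_eqF ts) //=; rewrite addrC (gt_eqF ts).
- have c0 : {for 0, continuous F}.
    have cln (y : R) : 0 < y -> {for 0, continuous (fun s => ln (y + s))}.
      move=> y0; have y0' : 0 < y + 0 by rewrite addr0.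
      exact: derive_cont (dcomp (f := @ln R) (g := fun s => y + s) (is_derive1_ln y0') (dadd y 0)).
    by apply: cvgM; [apply: cvgB; exact: cln|exact: cvg_cst].
  by have := cvg_at_right_filter c0; rewrite /F !addr0.
- have c1 : ln (1 + (t - x) * (x + s)^-1) * (x - t)^-1 @[s --> +oo] --> 0.
    rewrite -[0](mul0r (x - t)^-1); apply: cvgM; last exact: cvg_cst.
    have h : 1 + (t - x) * (x + s)^-1 @[s --> +oo] --> (1 : R).
      rewrite -[X in _ --> X]addr0; apply: cvgD; first exact: cvg_cst.
      rewrite -[X in _ --> X](mulr0 (t - x)); apply: cvgM; first exact: cvg_cst.
      exact: cvg_addV.
    have cl : ln y @[y --> (1 : R)] --> (0 : R).
      by rewrite -[X in _ --> X](ln1 R); exact: continuous_ln.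
    exact: (cvg_comp _ _ h cl).
  apply: cvg_trans c1; apply: near_eq_cvg; near=> s.
  have s0 : 0 < s by near: s; apply: nbhs_pinfty_gt; exact: num_real.
  have xs : 0 < x + s by exact: addr_gt0.
  have ts : 0 < t + s by exact: addr_gt0.
  rewrite /F -ln_div ?posrE//; congr (ln _ / _).
  by field; rewrite gt_eqF.
Unshelve. all: by end_near. Qed.

(** Nonnegative functions are handled by Tonelli's theorem; a general f is the
    difference of |f| + f and |f|. *)
Lemma log_kernel_op f x : sqint f -> 0 < x ->
  integ (fun t => log_kernel x t * f t) /\ hint (fun t => log_kernel x t * f t) = carleman2 f x.
Proof.
move=> sf x0.
have pos g : sqint g -> (forall t, 0 < t -> 0 <= g t) ->
    integ (fun t => log_kernel x t * g t) /\ hint (fun t => log_kernel x t * g t) = carleman2 g x.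
  move=> sg g0; have s1 := sqint_sop 1 sg; have [mg _] := sg.
  pose H t s := ker 1 x s * ker 1 s t * g t.
  have inner t : 0 < t -> integ (H t) /\ hint (H t) = log_kernel x t * g t.
    move=> t0; have [i e] := log_kernelE x0 t0.
    have E s : 0 < s -> g t * (ker 1 x s * ker 1 s t) = H t s by move=> _; rewrite mulrC.
    split; first exact: integ_ext E (integZ (g t) i).
    by rewrite -(hint_ext E) (hintZ _ i) e mulrC.
  have k0 (y s : R) : 0 < y -> 0 < s -> 0 <= ker 1 y s.
    by move=> y0 s0; rewrite ker1 invr_ge0 addr_ge0 ?ltW.
  have outer s : 0 < s -> integ (fun t => H t s) /\
      hint (fun t => H t s) = ker 1 x s * sop 1 g s.
    move=> s0; have i := integ_ker 1 sg s0.
    have E t : 0 < t -> ker 1 x s * (ker 1 s t * g t) = H t s by move=> _; rewrite mulrA.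
    split; first exact: integ_ext E (integZ _ i).
    by rewrite -(hint_ext E) (hintZ _ i).
  have [|||||i e] := @tonelli_hint R H.
  - have m1 : jmeas (fun _ s => ker 1 x s) by apply: jmeas2; exact: meas_ker.
    exact: jmeasM (jmeasM m1 (jmeasC (jmeas_ker 1))) (jmeas1 mg).
  - move=> t s t0 s0; exact: mulr_ge0 (mulr_ge0 (k0 _ _ x0 s0) (k0 _ _ s0 t0)) (g0 _ t0).
  - by move=> t /inner[].
  - by move=> s /outer[].
  - by apply: integ_ext (integ_ker 1 s1 x0) => s /outer[_ ->].
  split; first by apply: integ_ext i => t /inner[_ ->].
  have -> : carleman2 g x = hint (fun s => hint (fun t => H t s)).
    by apply: hint_ext => s /outer[_ ->].
  by rewrite -e; apply: hint_ext => t /inner[_ ->].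
have sn := sqint_norm sf.
have sp : sqint (fun t => `|f t| + f t) by exact: sqintD.
have [|i1 e1] := pos _ sn; first by move=> t _.
have [|i2 e2] := pos _ sp.
  by move=> t _; rewrite -lerBlDr sub0r -normrN; exact: ler_norm.
have E t : 0 < t -> log_kernel x t * (`|f t| + f t) - log_kernel x t * `|f t| = log_kernel x t * f t.
  by move=> _; ring.
split; first exact: integ_ext E (integB i2 i1).
rewrite -(hint_ext E) (hintB i2 i1) e1 e2 /carleman2.
have s1 := sqint_sop 1 sn; have s2 := sqint_sop 1 sp.
rewrite -(sopBr 1 s2 s1 x0); apply: sop_extr => t t0.
by rewrite -(sopBr 1 sp sn t0); apply: sop_extr => s _; ring.
Qed.

End LogKernel.

Section EulerOperator.
Variable R : realType.
Implicit Types (f g u : R -> R) (p q : {poly R}) (x t : R) (v : nat -> R -> R).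

Definition real_euler (a : R) f x : R := a * x * derive1 f x.

Lemma derive1_ext f u x df : 0 < x -> (forall y : R, 0 < y -> f y = u y) ->
  is_derive x 1 u df -> derive1 f x = df.
Proof.
move=> x0 e du; rewrite derive1E.
by have [_] : is_derive x 1 f df by apply: derive_ext du => // y /e.
Qed.

Lemma derive_act p v x : chain v -> 0 < x ->
  is_derive x 1 (act p v) ((act (p * 'X) v x - act p v x / 2) / x).
Proof.
move=> cv x0; have d k : (k < size p)%N ->
    is_derive x 1 (fun y => p`_k * v k y) (p`_k * ((v k.+1 x - v k x / 2) / x)).
  by move=> _; apply: dZ; exact: cv.
apply: is_derive_eq (dsum (f := fun k y => p`_k * v k y) d) _.
rewrite actMX /act !mulr_suml -sumrB mulr_suml; apply: eq_bigr => i _; ring.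
Qed.

(** x d/dx = theta - 1/2. *)
Lemma iter_euler a v f k x : chain v -> (forall y : R, 0 < y -> f y = v 0%N y) -> 0 < x ->
  iter k (real_euler a) f x = act ((a *: ('X - (2^-1)%:P)) ^+ k) v x.
Proof.
move=> cv fv; elim: k x => [|k IH] x x0.
  by rewrite /= expr0 -polyC1 actC mul1r fv.
rewrite /= {1}/real_euler (derive1_ext x0 IH (derive_act _ cv x0)) exprSr.
set p : {poly R} := _ ^+ k; rewrite -[p * (a *: _)]scalerAr actZ mulrBr actB [p * (2^-1)%:P]mulrC mul_polyC actZ.
by field; rewrite gt_eqF.
Qed.

(** x d/dx (sqrt x v) = sqrt x theta v: conjugation by sqrt x, the form in which
    theta enters the inversion formula. *)
Lemma iter_euler_sqrt a v f k x : chain v -> (forall y : R, 0 < y -> f y = Num.sqrt y * v 0%N y) ->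
  0 < x -> iter k (real_euler a) f x = Num.sqrt x * (a ^+ k * v k x).
Proof.
move=> cv fv; elim: k x => [|k IH] x x0; first by rewrite /= expr0 mul1r fv.
have d := dM (derive_sqrt x0) (dZ (a ^+ k) (cv k x x0)).
rewrite /= {1}/real_euler (derive1_ext x0 IH d) exprS -(sqrtV x0).
by field; rewrite gt_eqF.
Qed.

(** The n-th derivative is x^(-n) times a polynomial in theta. *)
Lemma chain_derive1n v f n x : chain v -> (forall y : R, 0 < y -> f y = v 0%N y) -> 0 < x ->
  derivable (derive1n n f) x 1.
Proof.
move=> cv fv x0.
have [p hp] : exists p, forall x, 0 < x -> derive1n n f x = x^-1 ^+ n * act p v x.
  elim: n => [|n [p hp]].
    by exists 1 => y y0; rewrite expr0 mul1r -polyC1 actC mul1r /derive1n /= fv.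
  exists (p * ('X - (2^-1 + n%:R)%:P)) => y y0.
  have dy := dX n (dV (f := id) (lt0r_neq0 y0) (did y)).
  have d := dM dy (derive_act p cv y0).
  rewrite derive1nS (derive1_ext y0 hp d) mulrBr actB [_ * (_ + _)%:P]mulrC mul_polyC actZ.
  case: n {hp dy d} => [|n] /=; first by rewrite !expr0 expr1; field; rewrite gt_eqF.
  by rewrite !exprS; field; rewrite gt_eqF.
have d := dM (dX n (dV (f := id) (lt0r_neq0 x0) (did x))) (derive_act p cv x0).
by have [] := derive_ext x0 (fun y y0 => esym (hp y y0)) d.
Qed.

Lemma smooth_euler a f : (forall n x, 0 < x -> derivable (derive1n n f) x 1) ->
  forall n x, 0 < x -> derivable (derive1n n (real_euler a f)) x 1.
Proof.
move=> sf.
have D n x : 0 < x -> is_derive x 1 (derive1n n f) (derive1n n.+1 f x).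
  by move=> x0; rewrite derive1nS derive1E; apply/derivableP/sf.
have E n x : 0 < x ->
    derive1n n (real_euler a f) x = a * x * derive1n n.+1 f x + a * n%:R * derive1n n f x.
  elim: n x => [|n IH] x x0; first by rewrite mulr0 mul0r addr0.
  have d1 := dM (dZ a (did x)) (D n.+1 x x0).
  have d2 := dZ (a * n%:R) (D n x x0).
  have -> : derive1n n.+1 (real_euler a f) x = derive1 (derive1n n (real_euler a f)) x by rewrite derive1nS.
  by rewrite (derive1_ext x0 IH (dD d1 d2)) -[n.+1%:R]natr1; ring.
move=> n x x0.
have d1 := dM (dZ a (did x)) (D n.+1 x x0).
have d2 := dZ (a * n%:R) (D n x x0).
by have [] := derive_ext x0 (fun y y0 => esym (E n y y0)) (dD d1 d2).
Qed.

Lemma smooth_iter_euler a f k : (forall n x, 0 < x -> derivable (derive1n n f) x 1) ->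
  forall n x, 0 < x -> derivable (derive1n n (iter k (real_euler a) f)) x 1.
Proof. by move=> sf; elim: k => //= k IH; exact: smooth_euler. Qed.

Definition half_sub : {poly R} := (2^-1)%:P - 'X.

(** The chain theta^k f of a smooth f, expressed by the iterates of - x d/dx =
    1/2 - theta. *)
Definition gchain f k : R -> R := act (half_sub ^+ k) (fun j => iter j (real_euler (-1)) f).

Lemma gchain0 f x : gchain f 0 x = f x.
Proof. by rewrite /gchain expr0 -polyC1 actC mul1r. Qed.

Lemma gchainP f : (forall n x, 0 < x -> derivable (derive1n n f) x 1) ->
  (forall k, sqint (iter k (real_euler (-1)) f)) -> sqchain (gchain f).
Proof.
move=> sf si; split; last by move=> k; apply: sqint_act.
move=> k x x0.
set e := fun j => iter j (real_euler (-1)) f.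
have D j : is_derive x 1 (e j) (- e j.+1 x / x).
  have dj : derivable (e j) x 1 := smooth_iter_euler (a := -1) (k := j) sf (n := 0%N) x0.
  have -> : - e j.+1 x / x = 'D_1 (e j) x.
    by rewrite /e /= {1}/real_euler -derive1E; field; rewrite gt_eqF.
  exact/derivableP.
set p := half_sub ^+ k.
have d j : (j < size p)%N -> is_derive x 1 (fun y => p`_j * e j y) (p`_j * (- e j.+1 x / x)).
  by move=> _; exact: dZ.
apply: is_derive_eq (dsum (f := fun j y => p`_j * e j y) d) _.
have -> : \sum_(j < size p) p`_j * (- e j.+1 x / x) = - act (p * 'X) e x / x.
  by rewrite actMX /act -sumrN mulr_suml; apply: eq_bigr => j _; ring.
rewrite /gchain -/e exprSr -/p /half_sub mulrBr actB [_ * (2^-1)%:P]mulrC mul_polyC actZ.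
by field; rewrite gt_eqF.
Qed.

End EulerOperator.

(** * The two series as polynomials in the Euler operator *)

Section SymbolPolynomials.
Variable R : realType.
Implicit Types (j k n : nat) (y : R).

(** Real and imaginary parts of the powers of i. *)
Definition cos_sign k : R := (~~ odd k)%:R * (-1) ^+ k./2.
Definition sin_sign k : R := (odd k)%:R * (-1) ^+ k./2.

Lemma cos_signD i j : cos_sign (i + j) = cos_sign i * cos_sign j - sin_sign i * sin_sign j.
Proof.
rewrite /cos_sign /sin_sign oddD halfD.
case: (odd i); case: (odd j) => /=; rewrite ?add0n ?add1n ?exprS ?exprD; ring.
Qed.

Lemma sin_signD i j : sin_sign (i + j) = sin_sign i * cos_sign j + cos_sign i * sin_sign j.
Proof.
rewrite /cos_sign /sin_sign oddD halfD.
case: (odd i); case: (odd j) => /=; rewrite ?add0n ?add1n ?exprS ?exprD; ring.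
Qed.

Lemma cos_sign_le1 k : `|cos_sign k| <= 1.
Proof.
by rewrite normrM normrX normrN1 expr1n mulr1; case: odd; rewrite ?normr0 ?normr1.
Qed.

Lemma sin_sign_le1 k : `|sin_sign k| <= 1.
Proof.
by rewrite normrM normrX normrN1 expr1n mulr1; case: odd; rewrite ?normr0 ?normr1.
Qed.

Lemma cos_sign_gam2 j : cos_sign j * ecoef (2 * pi) j + (j == 0%N)%:R = 2 * ((-1) ^+ j./2 * gam2 R j).
Proof.
rewrite /cos_sign; have [oj|oj] := boolP (odd j).
  rewrite gam2_odd// !mul0r !mulr0 add0r.
  by case: j oj.
rewrite gam2E ecoef_even// ecoef0 mul1r; case: j oj => [|j] _ /=.
  by rewrite /ecoef !expr0 fact0; field.
by rewrite !addr0; field.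
Qed.

Lemma cos_series y : \sum_(k < n) cos_sign k * ecoef y k @[n --> \oo] --> cos y.
Proof.
have c : series (cos_coeff y) n @[n --> \oo] --> cos y.
  by rewrite cos.unlock; exact: is_cvg_series_cos_coeff.
apply: (cvg_eq _ c) => n; rewrite /series /= big_mkord; apply: eq_bigr => i _.
by rewrite /cos_coeff /cos_sign /ecoef /= mulrA.
Qed.

Lemma sin_series y : \sum_(k < n) sin_sign k * ecoef y k @[n --> \oo] --> sin y.
Proof.
have c : series (sin_coeff y) n @[n --> \oo] --> sin y.
  by rewrite sin.unlock; exact: is_cvg_series_sin_coeff.
apply: (cvg_eq _ c) => n; rewrite /series /= big_mkord; apply: eq_bigr => i _.
rewrite /sin_coeff /sin_sign /ecoef /= mulrA; case: (nat_of_ord i) => [|k] /=.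
  by rewrite !mul0r.
by case: (boolP (odd k)) => ok /=; rewrite ?mul0r// uphalf_half (negPf ok).
Qed.

Lemma ecoef_series_le y n : 0 <= y -> \sum_(k < n) ecoef y k <= expR y.
Proof.
move=> y0; have nd : nondecreasing_seq (fun n => \sum_(k < n) ecoef y k).
  by apply/nondecreasing_seqP => m; rewrite big_ord_recr /= lerDl ecoef_ge0.
have c := @exp_series R y; rewrite -(cvg_lim (@Rhausdorff R) c).
by apply: nondecreasing_cvgn_le nd _ n; apply/cvg_ex; exists (expR y).
Qed.

(** Taylor coefficients at 0 of the symbol sin^2(pi s) / pi^2. *)
Definition symcoef k : R := ((k == 0%N)%:R - cos_sign k * ecoef (2 * pi) k) / (2 * pi ^+ 2).

(** Partial sums of the symbol in the variable s = 1/2 - X. *)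
Definition sympoly n : {poly R} := \sum_(k < n) symcoef k *: half_sub R ^+ k.

Lemma coef_half_sub k j : (half_sub R ^+ k)`_j = ((-1) ^+ j * (2^-1) ^+ (k - j)) *+ 'C(k, j).
Proof.
have -> : half_sub R ^+ k = \poly_(i < k.+1) (((-1) ^+ i * (2^-1) ^+ (k - i)) *+ 'C(k, i)).
  rewrite poly_def /half_sub exprBn; apply: eq_bigr => i _.
  by rewrite -scalerMnl -mul_polyC polyCM !polyC_exp polyCN.
by rewrite coef_poly ltnS; case: leqP => // kj; rewrite bin_small.
Qed.

(** Binomial coefficients factor through factorials, so that re-expanding in
    X = 1/2 - s leaves in each coefficient a partial sum of the series of
    cos (pi) and sin (pi), up to sign and a factor (2 pi)^j / j!. *)
Lemma coef_sympoly n j : (sympoly n)`_j = (2 * pi ^+ 2)^-1 *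
  (((0 < n)%N && (j == 0%N))%:R -
   (-1) ^+ j * ecoef (2 * pi) j * \sum_(i < (n - j)%N) cos_sign (j + i) * ecoef pi i).
Proof.
have D k : symcoef k * (half_sub R ^+ k)`_j = (2 * pi ^+ 2)^-1 *
    (((k == 0%N) && (j == 0%N))%:R - cos_sign k * ecoef (2 * pi) k * (half_sub R ^+ k)`_j).
  by rewrite /symcoef; case: k => [|k] /=; rewrite ?expr0 ?coef1; ring.
rewrite /sympoly coef_sum; under eq_bigr => k _ do rewrite coefZ D.
rewrite -mulr_sumr sumrB; congr (_ * (_ - _)).
  case: n => [|n]; first by rewrite big_ord0.
  by rewrite big_ord_recl /= big1 ?addr0.
have [nj|jn] := leqP n j.
  move: (nj); rewrite -subn_eq0 => /eqP ->; rewrite big_ord0 mulr0 big1// => k _.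
  by rewrite coef_half_sub bin_small ?mulr0n ?mulr0// (leq_trans (ltn_ord k)).
have [m ->] : exists m, n = (j + m)%N by exists (n - j)%N; rewrite subnKC// ltnW.
rewrite addKn big_split_ord /= big1 ?add0r; last first.
  by move=> k _; rewrite coef_half_sub bin_small ?mulr0n ?mulr0.
rewrite mulr_sumr; apply: eq_bigr => i _; rewrite coef_half_sub.
have := bin_fact (leq_addr i j) => /(congr1 (fun n => n%:R : R)); rewrite addKn !natrM => E.
have f l : (l`!%:R : R) != 0 by rewrite pnatr_eq0 -lt0n fact_gt0.
have B0 : ('C(j + i, j)%:R : R) != 0 by rewrite pnatr_eq0 -lt0n bin_gt0 leq_addr.
rewrite /ecoef -[_ *+ 'C(_, _)]mulr_natr -E exprD !exprMn exprVn.
have two : (2 : R) ^+ i != 0 by rewrite expf_neq0.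
by field; rewrite two B0 !f.
Qed.

Lemma coef_sympoly_le n j : `|(pi ^+ 2 *: sympoly n)`_j| <= (1 + expR pi) / 2 * ecoef (2 * pi) j.
Proof.
have p2 : 0 <= 2 * pi :> R by rewrite mulr_ge0// pi_ge0.
have e0 := ecoef_ge0 j p2.
rewrite coefZ coef_sympoly.
set S := \sum_(i < _) _; set b : R := (_ && _)%:R.
have -> : pi ^+ 2 * ((2 * pi ^+ 2)^-1 * (b - (-1) ^+ j * ecoef (2 * pi) j * S)) =
    (b - (-1) ^+ j * ecoef (2 * pi) j * S) / 2.
  by move: pi (lt0r_neq0 (pi_gt0 R)) (ecoef _ j) => p p0 e; field.
have bj : `|b| <= ecoef (2 * pi) j.
  rewrite /b; case: j {S b} e0 => [|j] e0; rewrite ?andbF ?normr0//.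
  by rewrite andbT /ecoef expr0 fact0 divr1; case: ltnP; rewrite ?normr0 ?normr1.
have Sj : `|S| <= expR pi.
  apply: le_trans (ler_norm_sum _ _ _) (le_trans _ (ecoef_series_le (n - j) (pi_ge0 R))).
  apply: ler_sum => i _; rewrite normrM (ger0_norm (ecoef_ge0 i (pi_ge0 R))).
  by apply: ler_piMl (cos_sign_le1 _); rewrite ecoef_ge0 ?pi_ge0.
rewrite normrM [`|2^-1|]ger0_norm// [leRHS]mulrAC ler_wpM2r//.
apply: le_trans (ler_normB _ _) _; rewrite [leRHS]mulrDl mul1r lerD//.
rewrite normrM [`|(-1) ^+ j * _|]normrM normrX normrN1 expr1n mul1r.
by rewrite (ger0_norm e0) mulrC ler_wpM2r.
Qed.

(** sin^2(pi (1/2 - X)) = cos^2(pi X), by cos pi = -1 and sin pi = 0. *)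
Lemma coef_sympoly_cvg j :
  (pi ^+ 2 *: sympoly n)`_j @[n --> \oo] --> (-1) ^+ j./2 * gam2 R j.
Proof.
have cS : \sum_(i < n) cos_sign (j + i) * ecoef pi i @[n --> \oo] --> - cos_sign j.
  have c : cos_sign j * \sum_(i < n) cos_sign i * ecoef pi i - sin_sign j * \sum_(i < n) sin_sign i * ecoef pi i
      @[n --> \oo] --> cos_sign j * cos pi - sin_sign j * sin pi.
    by apply: cvgB; apply: cvgM; [exact: cvg_cst|exact: cos_series|exact: cvg_cst|exact: sin_series].
  move: c; rewrite cospi sinpi mulr0 subr0 mulrN1 => c; apply: (cvg_eq _ c) => n.
  by rewrite !mulr_sumr -sumrB; apply: eq_bigr => i _; rewrite cos_signD; ring.
rewrite -(cvg_shiftn j.+1).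
have c : ((j == 0%N)%:R - (-1) ^+ j * ecoef (2 * pi) j * \sum_(i < n.+1) cos_sign (j + i) * ecoef pi i) / 2
    @[n --> \oo] --> (((j == 0%N)%:R : R) - (-1) ^+ j * ecoef (2 * pi) j * - cos_sign j) / 2.
  apply: cvgM; last exact: cvg_cst.
  apply: cvgB; first exact: cvg_cst.
  apply: cvgM; first exact: cvg_cst.
  by rewrite (cvg_shiftS (fun n => \sum_(i < n) cos_sign (j + i) * ecoef pi i)).
have <- : ((j == 0%N)%:R - (-1) ^+ j * ecoef (2 * pi) j * - cos_sign j) / 2 = (-1) ^+ j./2 * gam2 R j.
  have := cos_sign_gam2 j; rewrite /cos_sign; case: (boolP (odd j)) => oj /=.
    by rewrite !mul0r oppr0 mulr0 subr0 add0r => ->; field.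
  have -> : (-1) ^+ j = 1 :> R by rewrite -signr_odd (negPf oj).
  by move=> h; lra.
apply: (cvg_eq _ c) => n; rewrite coefZ coef_sympoly addnS addnC /= -addnS addKn.
set S := \sum_(i < _) _; set b : R := (_ == _)%:R.
by move: pi (lt0r_neq0 (pi_gt0 R)) (ecoef _ j) => p p0 e; field.
Qed.

(** The Taylor polynomials of cos^2(pi X), to which the partial sums of the
    inversion formula correspond. *)
Definition cospoly n : {poly R} := \sum_(k < n.+1) ((-1) ^+ k * gam2 R k.*2) *: 'X^(k.*2).

Lemma coef_cospoly n j : (cospoly n)`_j = (j./2 <= n)%N%:R * ((-1) ^+ j./2 * gam2 R j).
Proof.
rewrite coef_sum; have [oj|oj] := boolP (odd j).
  rewrite gam2_odd// !mulr0 big1// => k _; rewrite coefZ coefXn.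
  by case: eqP oj => [->|_ _]; rewrite ?odd_double// mulr0.
have jE : j = j./2.*2 by rewrite even_halfK.
have E k : ((-1) ^+ k * gam2 R k.*2 *: 'X^(k.*2))`_j =
    (k == j./2)%:R * ((-1) ^+ j./2 * gam2 R j).
  rewrite coefZ coefXn {1}jE (inj_eq double_inj) eq_sym mulrC.
  by case: eqP => [->|_]; rewrite ?mul0r// -jE.
under eq_bigr => k _ do rewrite E.
rewrite -mulr_suml; congr (_ * _); case: leqP => [jn|nj].
  have jn' : (j./2 < n.+1)%N by [].
  rewrite (bigD1 (Ordinal jn'))//= eqxx big1 ?addr0// => i /eqP ij.
  by case: eqP => // e; case: ij; apply: val_inj.
by rewrite big1// => i _; rewrite ltn_eqF// (leq_trans (ltn_ord i)).
Qed.

End SymbolPolynomials.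

Section RealInversion.
Variable R : realType.
Implicit Types (f F G : R -> R) (p : {poly R}) (v : nat -> R -> R) (x : R) (n k : nat).

Lemma sympoly_cvg F : sqint F ->
  sqnorm (fun x => act (sympoly R n) (tchain F) x - F x) @[n --> \oo] --> 0.
Proof.
move=> sF; have cT := tchain_sqchain sF.
have c := inversion_cvg sF (@coef_sympoly_le R) (@coef_sympoly_cvg R).
have c2 : (pi ^+ 2) ^- 2 * sqnorm (fun x => act (pi ^+ 2 *: sympoly R n) (tchain F) x - pi ^+ 2 * F x)
    @[n --> \oo] --> (pi ^+ 2) ^- 2 * 0 by apply: cvgM => //; exact: cvg_cst.
rewrite mulr0 in c2; apply: (cvg_eq _ c2) => n.
have sA : sqint (fun x => act (sympoly R n) (tchain F) x - F x).
  by apply: sqintB => //; apply: sqint_act; exact: cT.2.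
have p0 : (pi ^+ 2) ^+ 2 != 0 :> R by rewrite !expf_neq0// lt0r_neq0// pi_gt0.
have <- : sqnorm (fun x => pi ^+ 2 * (act (sympoly R n) (tchain F) x - F x)) =
    sqnorm (fun x => act (pi ^+ 2 *: sympoly R n) (tchain F) x - pi ^+ 2 * F x).
  by apply: sqnorm_ext => x _; rewrite actZ mulrBr.
by rewrite (sqnormZ _ sA) mulKf.
Qed.

Lemma cospoly_cvg F : sqint F ->
  sqnorm (fun x => act (cospoly R n) (tchain F) x - pi ^+ 2 * F x) @[n --> \oo] --> 0.
Proof.
move=> sF; apply: (inversion_cvg (C := 1) sF) => [n k|k].
  rewrite coef_cospoly mul1r normrM normrM normrX normrN1 expr1n mul1r.
  rewrite [`|gam2 R k|]ger0_norm ?gam2_ge0//.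
  apply: le_trans (gam2_le R k); rewrite ler_piMl ?gam2_ge0//.
  by case: leqP; rewrite ?normr0 ?normr1.
rewrite -(cvg_shiftn k./2); apply: cvg_near_cst; apply: nearW => n.
by rewrite /= coef_cospoly leq_addl mul1r.
Qed.

Lemma actXn v m x : act 'X^m v x = v m x.
Proof.
elim: m v => [|m IH] v; first by rewrite expr0 -polyC1 actC mul1r.
by rewrite exprSr actMX IH.
Qed.

Lemma symbol_series v G n x : chain v -> (forall y : R, 0 < y -> G y = v 0%N y) -> 0 < x ->
  \sum_(k < n) symcoef R k * iter k (real_euler (-1)) G x = act (sympoly R n) v x.
Proof.
move=> cv Gv x0; rewrite act_sum; apply: eq_bigr => k _; rewrite actZ (iter_euler _ _ cv Gv x0).
by rewrite scaleN1r opprB.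
Qed.

(** The terms of the inversion formula, for real functions. *)
Definition rterm G k x : R := (2 * Num.sqrt x)^-1 *
  ((-1) ^+ k / (k.*2)`!%:R * iter k.*2 (real_euler (2 * pi)) (fun y => Num.sqrt y * G y) x).

Lemma rtermE v G k x : chain v -> (forall y : R, 0 < y -> G y = v 0%N y) -> 0 < x ->
  rterm G k x = (-1) ^+ k * (ecoef (2 * pi) k.*2 / 2) * v k.*2 x.
Proof.
move=> cv Gv x0; have s0 : Num.sqrt x != 0 by rewrite gt_eqF// sqrtr_gt0.
rewrite /rterm (@iter_euler_sqrt _ _ v) //; last by move=> y y0; rewrite Gv.
have f0 : ((k.*2)`!%:R : R) != 0 by rewrite pnatr_eq0 -lt0n fact_gt0.
by rewrite /ecoef; field; rewrite s0 f0.
Qed.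

Lemma cosine_series v G n x : chain v -> (forall y : R, 0 < y -> G y = v 0%N y) -> 0 < x ->
  G x + \sum_(k < n) rterm G k.+1 x = act (cospoly R n) v x.
Proof.
move=> cv Gv x0; rewrite act_sum big_ord_recl actZ actXn /= expr0 mul1r.
have -> : gam2 R 0 = 1 by have := cos_sign_gam2 R 0; rewrite /cos_sign /ecoef !expr0 fact0 /= => h; lra.
rewrite mul1r -Gv//; congr (_ + _); apply: eq_bigr => k _; rewrite actZ actXn.
rewrite (rtermE _ cv Gv x0) /bump leq0n add1n; congr (_ * _ * _).
have := cos_sign_gam2 R k.+1.*2; rewrite /cos_sign odd_double doubleK /= mul1r addr0.
have s0 : (-1) ^+ k.+1 != 0 :> R by rewrite expf_neq0// oppr_eq0 oner_eq0.
move=> h; apply: (mulfI s0); lra.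
Qed.

(** T = carleman2 commutes with polynomials in theta. *)
Lemma carleman2_act p v x : sqchain v -> 0 < x -> carleman2 (act p v) x = act p (tchain (v 0%N)) x.
Proof.
move=> cv x0.
have s1 := sqint_sop 1 (cv.2 0%N).
have e1 y : 0 < y -> sop 1 (act p v) y = act p (sopchain 1 (v 0%N)) y.
  by move=> y0; rewrite sop_act// sop_opact//; exact: cv.2.
rewrite /carleman2 (sop_extr 1 x e1) sop_act//; last exact: sop_sqchain (cv.2 0%N).
by rewrite sop_opact.
Qed.

Lemma carleman2B f g x : sqint f -> sqint g -> 0 < x ->
  carleman2 (fun y => f y - g y) x = carleman2 f x - carleman2 g x.
Proof.
move=> sf sg x0; rewrite /carleman2 -(sopBr 1 (sqint_sop 1 sf) (sqint_sop 1 sg) x0).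
by apply: sop_extr => y y0; rewrite (sopBr 1 sf sg y0).
Qed.

Lemma sqint_carleman2 f : sqint f -> sqint (carleman2 f).
Proof. by move=> sf; do 2! apply: sqint_sop. Qed.

Lemma sqnorm_carleman2 f : sqint f -> sqnorm (carleman2 f) <= pi ^+ 4 * sqnorm f.
Proof.
move=> sf; apply: le_trans (sqnorm_sop1 (sqint_sop 1 sf)) _.
rewrite (exprD _ 2 2) -mulrA ler_wpM2l ?exprn_ge0 ?pi_ge0//; exact: sqnorm_sop1.
Qed.

Lemma continuous_sqnorm_eq0 f : sqint f -> (forall x : R, 0 < x -> {for x, continuous f}) ->
  sqnorm f = 0 -> forall x, 0 < x -> f x = 0.
Proof.
move=> [mf f2] cf z x x0; apply/eqP; apply: contraT => fx0.
have fp : 0 < `|f x| / 2 by rewrite divr_gt0// normr_gt0.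
have lt2 : `|f x| / 2 < `|f x| by rewrite ltr_pdivrMr// ltr_pMr ?normr_gt0// ltr1n.
have /nbhs_ballP[r /= r0 hr] : \forall y \near x, `|f x| / 2 < `|f y|.
  exact: (cvgr_norm_gt (f x) (cf x x0) _ lt2).
pose s := Num.min (r / 2) (x / 2).
have s0 : 0 < s by rewrite lt_min !divr_gt0.
have sr : s < r by rewrite gt_min ltr_pdivrMr// ltr_pMr// ltr1n.
have sx : s < x by rewrite gt_min orbC ltr_pdivrMr// ltr_pMr// ltr1n.
pose k := (`|f x| / 2) ^+ 2; have k0 : 0 < k by rewrite exprn_gt0.
have a0 : 0 < x - s by rewrite subr_gt0.
have ab : x - s < x + s by rewrite ltrD2l gtrN.
have le y : 0 < y -> ((fun=> k) \_ `[x - s, x + s]) y <= f y ^+ 2.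
  move=> _; rewrite patchE; case: ifPn => [|_]; last exact: sqr_ge0.
  rewrite inE /= in_itv /= => /andP[ya yb].
  rewrite -[f y ^+ 2]real_normK ?num_real// ler_pXn2r// ?nnegrE// ?ltW//.
  by apply: hr; rewrite /ball /= ltr_norml; apply/andP; split; lra.
have ik : integ ((fun=> k) \_ `[x - s, x + s]).
  apply: integ_le (meas_patch _ _ (meas_cst k)) _ f2 => y y0.
  by rewrite ger0_norm ?le// patchE; case: ifP => // _; exact: ltW.
have := hint_le ik f2 le; rewrite -/(sqnorm f) z.
have dk (y : R) : 0 < y -> is_derive y 1 (fun y => k * y) k.
  by move=> _; apply: is_derive_eq (dZ k (did y)) (mulr1 k).
rewrite (hint_patch a0 ab dk); last by move=> y _; exact: cvg_cst.
have : 0 < k * s by rewrite mulr_gt0.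
by rewrite -mulrBr; move=> h1 h2; exfalso; nra.
Qed.

Lemma sqnorm_cvg_unique f g (u : nat -> R -> R) : (forall n, sqint (u n)) -> sqint f -> sqint g ->
  sqnorm (fun x => u n x - f x) @[n --> \oo] --> 0 ->
  sqnorm (fun x => u n x - g x) @[n --> \oo] --> 0 -> sqnorm (fun x => f x - g x) = 0.
Proof.
move=> su sf sg cf cg; apply/eqP; rewrite eq_le sqnorm_ge0 andbT.
have c : 2 * sqnorm (fun x => u n x - g x) + 2 * sqnorm (fun x => u n x - f x) @[n --> \oo] --> 2 * 0 + 2 * (0 : R).
  by apply: cvgD; apply: cvgM => //; exact: cvg_cst.
have := ler_cvg_to (cvg_cst (sqnorm (fun x => f x - g x))) c.
rewrite mulr0 addr0; apply; apply: nearW => n.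
apply: le_trans _ (sqnormB_le (sqintB (su n) sg) (sqintB (su n) sf)).
by rewrite le_eqVlt; apply/orP; left; apply/eqP; apply: sqnorm_ext => x _; ring.
Qed.

(** If p_n(theta) G tends to f, where p_n are the partial sums of the symbol, then
    p_n(theta) T G = T (p_n(theta) G) tends to T f; but it also tends to G, by the
    direct theorem applied to G in place of f.  Continuity upgrades the
    resulting equality to every x. *)
Lemma carleman2_of_symbol_series G f : (forall n x, 0 < x -> derivable (derive1n n G) x 1) ->
  (forall k, sqint (iter k (real_euler (-1)) G)) -> sqint f ->
  sqnorm (fun x => \sum_(k < n) symcoef R k * iter k (real_euler (-1)) G x - f x) @[n --> \oo] --> 0 ->
  forall x, 0 < x -> G x = carleman2 f x.
Proof.
move=> sm si sf c.
have cg := gchainP sm si; set g := gchain G in cg.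
have g0 y : G y = g 0%N y by rewrite /g gchain0.
have gE : g 0%N = G by apply/funext => y; rewrite g0.
have sG : sqint G := si 0%N.
have c1 : sqnorm (fun x => act (sympoly R n) g x - f x) @[n --> \oo] --> 0.
  apply: (cvg_eq _ c) => n; apply: sqnorm_ext => x x0.
  by rewrite (symbol_series n cg.1 (fun y _ => g0 y) x0).
have s1 n : sqint (act (sympoly R n) g) by apply: sqint_act; exact: cg.2.
have c2 : sqnorm (fun x => act (sympoly R n) (tchain G) x - carleman2 f x) @[n --> \oo] --> 0.
  have cM : pi ^+ 4 * sqnorm (fun x => act (sympoly R n) g x - f x) @[n --> \oo] --> pi ^+ 4 * (0 : R).
    by apply: cvgM => //; exact: cvg_cst.
  rewrite mulr0 in cM; apply: (squeeze_cvgr _ (cvg_cst 0) cM); apply: nearW => n.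
  rewrite sqnorm_ge0 /=; apply: le_trans (sqnorm_carleman2 (sqintB (s1 n) sf)).
  rewrite le_eqVlt; apply/orP; left; apply/eqP; apply: sqnorm_ext => x x0.
  have e := carleman2_act (sympoly R n) cg x0; rewrite gE in e.
  by rewrite (carleman2B (s1 n) sf x0) e.
have st n : sqint (act (sympoly R n) (tchain G)).
  by apply: sqint_act; exact: (tchain_sqchain sG).2.
have z := sqnorm_cvg_unique st sG (sqint_carleman2 sf) (sympoly_cvg sG) c2.
move=> x x0; apply/eqP; rewrite -subr_eq0; apply/eqP.
apply: (continuous_sqnorm_eq0 (sqintB sG (sqint_carleman2 sf)) _ z x0) => y y0.
apply: cvgB.
  exact: derive_cont (derive_ext y0 (fun z _ => esym (g0 z)) (cg.1 0%N y y0)).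
exact: derive_cont ((tchain_sqchain sf).1 0%N y y0).
Qed.

End RealInversion.

(** * Complex square-integrable functions *)

Section ComplexL2.
Variable R : realType.
Implicit Types (f g G : R -> R[i]) (x : R) (z w : R[i]).
Local Notation mu := (@lebesgue_measure R).
Local Notation D := (@halfline R).

Lemma normc_sq z : Normc.normc z ^+ 2 = complex.Re z ^+ 2 + complex.Im z ^+ 2.
Proof. by case: z => a b /=; rewrite sqr_sqrtr// addr_ge0// sqr_ge0. Qed.

Lemma normc_ge0 z : 0 <= Normc.normc z.
Proof. by case: z => a b; exact: sqrtr_ge0. Qed.

Lemma L2norm_integral f :
  L2norm f = ((\int[mu]_(x in D) (ReF f x ^+ 2 + ImF f x ^+ 2)%:E) `^ 2^-1)%E.
Proof.
rewrite /L2norm Lnorm.unlock [in RHS]integral_mkcond; congr (_ `^ _)%E.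
apply: eq_integral => x _; rewrite !patchE; case: ifP => _.
  by rewrite abse_EFin poweR_EFin powR_mulrn ?normr_ge0// ger0_norm ?normc_ge0// normc_sq.
by rewrite abse0 poweR0r.
Qed.

Lemma L2P f : L2 f <-> sqint (ReF f) /\ sqint (ImF f).
Proof.
have E : sqint (ReF f) -> sqint (ImF f) ->
    L2norm f = ((sqnorm (ReF f) + sqnorm (ImF f))%:E `^ 2^-1)%E.
  move=> [_ ir] [_ ii]; rewrite L2norm_integral -(hintD ir ii) EFin_hint//.
  exact: integD.
split=> [[[mr mi] lt]|[sr si]]; last first.
  by split; [split; [case: sr|case: si]|rewrite E// poweR_EFin ltry].
have fin : (\int[mu]_(x in D) (ReF f x ^+ 2 + ImF f x ^+ 2)%:E < +oo)%E.
  rewrite ltey; apply/eqP => e; move: lt.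
  by rewrite L2norm_integral e poweRyr// ltxx.
have i : integ (fun x => ReF f x ^+ 2 + ImF f x ^+ 2).
  apply: integ_ge0P fin; last by move=> x _; rewrite addr_ge0// sqr_ge0.
  by apply: measD; exact: measX.
split; split => //; apply: (integ_le _ _ i); try exact: measX.
- by move=> x _; rewrite ger0_norm ?sqr_ge0// lerDl sqr_ge0.
- by move=> x _; rewrite ger0_norm ?sqr_ge0// lerDr sqr_ge0.
Qed.

Lemma L2normE f : L2 f -> L2norm f = (Num.sqrt (sqnorm (ReF f) + sqnorm (ImF f)))%:E.
Proof.
move=> /L2P[[_ ir] [_ ii]]; rewrite L2norm_integral -(powR12_sqrt (addr_ge0 (sqnorm_ge0 _) (sqnorm_ge0 _))).
by rewrite -(hintD ir ii) -poweR_EFin EFin_hint//; exact: integD.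
Qed.

Lemma L2norm_cvg0 (u : nat -> R -> R[i]) : (forall n, L2 (u n)) ->
  L2norm (u n) @[n --> \oo] --> 0%E <->
  (sqnorm (ReF (u n)) @[n --> \oo] --> 0 /\ sqnorm (ImF (u n)) @[n --> \oo] --> 0).
Proof.
move=> Lu; pose s n := sqnorm (ReF (u n)) + sqnorm (ImF (u n)).
have E : (fun n => L2norm (u n)) = (fun n => (Num.sqrt (s n))%:E).
  by apply/funext => n; exact: L2normE.
have s0 n : 0 <= s n by rewrite addr_ge0 ?sqnorm_ge0.
split=> [c|[c1 c2]].
  have {}c : Num.sqrt (s n) @[n --> \oo] --> 0.
    by move: c; rewrite E => /fine_cvg.
  have c2 : Num.sqrt (s n) * Num.sqrt (s n) @[n --> \oo] --> (0 * 0 : R) by exact: cvgM.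
  have c3 : s n @[n --> \oo] --> 0.
    by rewrite mulr0 in c2; apply: (cvg_eq _ c2) => n; rewrite -expr2 sqr_sqrtr.
  split; apply: (squeeze_cvgr _ (cvg_cst 0) c3); apply: nearW => n.
    by rewrite sqnorm_ge0 lerDl sqnorm_ge0.
  by rewrite sqnorm_ge0 lerDr sqnorm_ge0.
have c3 : s n @[n --> \oo] --> (0 + 0 : R) by exact: cvgD.
rewrite addr0 in c3; rewrite E; apply: cvg_EFin; first exact: nearW.
have cs := @sqrt_continuous R 0; rewrite /continuous_at sqrtr0 in cs.
exact: (cvg_comp _ _ c3 cs).
Qed.

Lemma ReF_sum n (u : nat -> R -> R[i]) x :
  ReF (fun x => \sum_(k < n) u k x) x = \sum_(k < n) ReF (u k) x.
Proof.
rewrite /ReF; elim/big_rec2: _ => //= i a b _ <-; by case: (u i x) b => [p q] [r s].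
Qed.

Lemma ImF_sum n (u : nat -> R -> R[i]) x :
  ImF (fun x => \sum_(k < n) u k x) x = \sum_(k < n) ImF (u k) x.
Proof.
rewrite /ImF; elim/big_rec2: _ => //= i a b _ <-; by case: (u i x) b => [p q] [r s].
Qed.

Lemma ReFB f g x : ReF (fun x => f x - g x) x = ReF f x - ReF g x.
Proof. by rewrite /ReF; case: (f x) (g x) => [a b] [c d]. Qed.

Lemma ImFB f g x : ImF (fun x => f x - g x) x = ImF f x - ImF g x.
Proof. by rewrite /ImF; case: (f x) (g x) => [a b] [c d]. Qed.

Lemma ReFZ (k : R -> R) f x : ReF (fun x => (k x)%:C%C * f x) x = k x * ReF f x.
Proof. by rewrite /ReF; case: (f x) => [a b] /=; rewrite mul0r subr0. Qed.

Lemma ImFZ (k : R -> R) f x : ImF (fun x => (k x)%:C%C * f x) x = k x * ImF f x.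
Proof. by rewrite /ImF; case: (f x) => [a b] /=; rewrite mul0r addr0. Qed.

Definition rms_sum (u : nat -> R -> R) (S : R -> R) : Prop :=
  [/\ forall k, sqint (u k), sqint S &
      sqnorm (fun x => \sum_(k < n) u k x - S x) @[n --> \oo] --> 0].

Lemma ms_sumP (u : nat -> R -> R[i]) (S : R -> R[i]) :
  ms_sum u S <-> rms_sum (fun k => ReF (u k)) (ReF S) /\ rms_sum (fun k => ImF (u k)) (ImF S).
Proof.
have key : (forall k, L2 (u k)) -> L2 S ->
    (L2norm (fun x => \sum_(k < n) u k x - S x) @[n --> \oo] --> 0%E <->
    sqnorm (fun x => \sum_(k < n) ReF (u k) x - ReF S x) @[n --> \oo] --> 0 /\
    sqnorm (fun x => \sum_(k < n) ImF (u k) x - ImF S x) @[n --> \oo] --> 0).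
  move=> Lu LS.
  have eR n : ReF (fun x => \sum_(k < n) u k x - S x) =
      fun x => \sum_(k < n) ReF (u k) x - ReF S x.
    by apply/funext => x; rewrite ReFB ReF_sum.
  have eI n : ImF (fun x => \sum_(k < n) u k x - S x) =
      fun x => \sum_(k < n) ImF (u k) x - ImF S x.
    by apply/funext => x; rewrite ImFB ImF_sum.
  have /L2P[sR sI] := LS.
  have Ln n : L2 (fun x => \sum_(k < n) u k x - S x).
    apply/L2P; rewrite eR eI; split; apply: sqintB => //.
      by apply: (sqint_sum (f := fun k => ReF (u k))) => k _; have /L2P[] := Lu k.
    by apply: (sqint_sum (f := fun k => ImF (u k))) => k _; have /L2P[] := Lu k.
  rewrite (L2norm_cvg0 Ln).
  by under eq_fun do rewrite eR; under [in X in _ /\ X]eq_fun do rewrite eI.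
split=> [[Lu LS c]|[[sr sR cR] [si sI cI]]].
  have [c1 c2] := (key Lu LS).1 c; have /L2P[sR sI] := LS.
  by split; split => // k; have /L2P[] := Lu k.
have Lu k : L2 (u k) by apply/L2P.
have LS : L2 S by apply/L2P.
by split => //; apply/(key Lu LS).
Qed.

End ComplexL2.

(** * The complex exponential and the expansions of the symbol *)

Local Open Scope complex_scope.
Local Open Scope ring_scope.

Section ComplexExponential.
Variable R : realType.
Implicit Types (x y : R) (z w : R[i]) (u v : nat -> R[i]) (a b : nat -> R).
Local Notation Re := (@complex.Re R).
Local Notation Im := (@complex.Im R).

(** Convergence on real and imaginary parts, for which limits of real sequences
    can be quoted. *)
Definition ccvg u z : Prop :=
  Re (u n) @[n --> \oo] --> Re z /\ Im (u n) @[n --> \oo] --> Im z.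

Lemma cReD z w : Re (z + w) = Re z + Re w. Proof. by case: z w => [? ?] [? ?]. Qed.
Lemma cImD z w : Im (z + w) = Im z + Im w. Proof. by case: z w => [? ?] [? ?]. Qed.
Lemma cReB z w : Re (z - w) = Re z - Re w. Proof. by case: z w => [? ?] [? ?]. Qed.
Lemma cImB z w : Im (z - w) = Im z - Im w. Proof. by case: z w => [? ?] [? ?]. Qed.
Lemma cReM z w : Re (z * w) = Re z * Re w - Im z * Im w.
Proof. by case: z w => [? ?] [? ?]. Qed.
Lemma cImM z w : Im (z * w) = Re z * Im w + Im z * Re w.
Proof. by case: z w => [? ?] [? ?]. Qed.

Lemma eq_ReIm z w : Re z = Re w -> Im z = Im w -> z = w.
Proof. by case: z w => [a b] [c d] /= -> ->. Qed.

Lemma ccvgP u z : ccvg u z <-> Normc.normc (u n - z) @[n --> \oo] --> (0 : R).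
Proof.
have nE n : Normc.normc (u n - z) = Num.sqrt ((Re (u n) - Re z) ^+ 2 + (Im (u n) - Im z) ^+ 2).
  by rewrite -cReB -cImB -normc_sq sqrtr_sqr ger0_norm// normc_ge0.
split=> [[c1 c2]|c].
  have cs := @sqrt_continuous R 0; rewrite /continuous_at sqrtr0 in cs.
  have c3 : (Re (u n) - Re z) ^+ 2 + (Im (u n) - Im z) ^+ 2 @[n --> \oo] --> (0 : R).
    rewrite -[X in _ --> X]addr0 -[X in _ --> X + _](mulr0 0) -[X in _ --> _ + X](mulr0 0).
    by apply: cvgD; rewrite ?expr2; apply: cvgM; apply/subr_cvg0.
  by apply: (cvg_eq _ (cvg_comp _ _ c3 cs)) => n; rewrite /= nE.
have le n : `|Re (u n) - Re z| <= Normc.normc (u n - z) /\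
    `|Im (u n) - Im z| <= Normc.normc (u n - z).
  by rewrite nE -!sqrtr_sqr; split; apply: ler_wsqrtr; rewrite ?lerDl ?lerDr sqr_ge0.
split; apply/subr_cvg0; apply/norm_cvg0P; apply: (squeeze_cvgr _ (cvg_cst 0) c).
  by apply: nearW => n; rewrite normr_ge0 (le n).1.
by apply: nearW => n; rewrite normr_ge0 (le n).2.
Qed.

Lemma ccvgD u v z w : ccvg u z -> ccvg v w -> ccvg (fun n => u n + v n) (z + w).
Proof.
move=> [u1 u2] [v1 v2]; rewrite /ccvg cReD cImD.
by split; [apply: (cvg_eq (fun n => cReD _ _)) | apply: (cvg_eq (fun n => cImD _ _))]; exact: cvgD.
Qed.

Lemma ccvgZ w u z : ccvg u z -> ccvg (fun n => w * u n) (w * z).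
Proof.
move=> [u1 u2]; rewrite /ccvg cReM cImM; split.
  by apply: (cvg_eq (fun n => cReM _ _)); apply: cvgB; apply: cvgM => //; exact: cvg_cst.
by apply: (cvg_eq (fun n => cImM _ _)); apply: cvgD; apply: cvgM => //; exact: cvg_cst.
Qed.

Lemma ccvg_ext u v z : u =1 v -> ccvg u z -> ccvg v z.
Proof. by move=> /funext ->. Qed.

(** The product of the partial sums is a sum of truncated convolutions, namely
    the product of two polynomials at 1; it differs from the partial sum of
    the convolutions by terms of index between n and 2n, hence by at most a
    block of the series of exp (x + y). *)
Lemma cauchy_product a b x y (A B : R) : 0 <= x -> 0 <= y ->
  (forall k, `|a k| <= ecoef x k) -> (forall k, `|b k| <= ecoef y k) ->
  \sum_(k < n) a k @[n --> \oo] --> A -> \sum_(k < n) b k @[n --> \oo] --> B ->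
  \sum_(k < n) conv a b k @[n --> \oo] --> A * B.
Proof.
move=> x0 y0 ha hb ca cb.
pose e k := ecoef (x + y) k.
have tail : \sum_(k < (n + n)%N) e k - \sum_(k < n) e k @[n --> \oo] --> (0 : R).
  have ce : \sum_(k < n) e k @[n --> \oo] --> expR (x + y) := @exp_series R (x + y).
  rewrite -[X in _ --> X](subrr (expR (x + y))); apply: cvgB => //.
  have h : (n + n)%N @[n --> \oo] --> \oo.
    move=> P [N _ hN]; exists N => // n /= Nn; apply: hN => /=.
    by rewrite (leq_trans Nn)// leq_addr.
  exact: (cvg_comp _ _ h ce).
have key n : `|\sum_(k < n) conv a b k - (\sum_(k < n) a k) * (\sum_(k < n) b k)| <=
    \sum_(k < (n + n)%N) e k - \sum_(k < n) e k.
  pose an i := (i < n)%N%:R * a i; pose bn i := (i < n)%N%:R * b i.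
  have P (c : nat -> R) : \sum_(k < n) c k = (\poly_(i < n) c i).[1].
    by rewrite horner_poly; apply: eq_bigr => i _; rewrite expr1n mulr1.
  have PM : (\sum_(k < n) a k) * (\sum_(k < n) b k) = \sum_(k < (n + n)%N) conv an bn k.
    rewrite !P -hornerM (@horner_coef_wide _ (n + n)); last first.
      apply: leq_trans (size_polyMleq _ _) (leq_trans (leq_pred _) _).
      by apply: leq_add; exact: size_poly.
    apply: eq_bigr => k _; rewrite expr1n mulr1 coef_conv; apply: eq_conv => i.
      by rewrite coef_poly /an; case: ltnP; rewrite ?mul1r ?mul0r.
    by rewrite coef_poly /bn; case: ltnP; rewrite ?mul1r ?mul0r.
  rewrite PM !big_split_ord /= [X in _ <= X]addrC addKr.
  have -> : \sum_(k < n) conv an bn k = \sum_(k < n) conv a b k.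
    apply: eq_bigr => k _; apply: eq_bigr => i _; rewrite /an /bn.
    have ik : (i <= k)%N by rewrite -ltnS.
    rewrite (leq_ltn_trans ik)// (leq_ltn_trans (leq_subr _ _))// !mul1r//.
  rewrite opprD addNKr normrN; apply: le_trans (ler_norm_sum _ _ _) _.
  apply: ler_sum => k _; rewrite /e -conv_ecoef.
  apply: le_trans (ler_norm_sum _ _ _) _; apply: ler_sum => i _; rewrite normrM.
  have ind (c : nat -> R) (z : R) : 0 <= z -> (forall k, `|c k| <= ecoef z k) ->
      forall k, `|(k < n)%N%:R * c k| <= ecoef z k.
    move=> z0 hc j; case: ltnP => _; rewrite ?mul1r// mul0r normr0.
    exact: ecoef_ge0.
  by apply: ler_pM => //; exact: ind.
have cAB : (\sum_(k < n) a k) * (\sum_(k < n) b k) @[n --> \oo] --> A * B by exact: cvgM.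
have c0 : \sum_(k < n) conv a b k - (\sum_(k < n) a k) * (\sum_(k < n) b k) @[n --> \oo] --> 0.
  apply/norm_cvg0P; apply: (squeeze_cvgr _ (cvg_cst 0) tail).
  by apply: nearW => n; rewrite normr_ge0 key.
have := cvgD c0 cAB; rewrite add0r => c; apply: (cvg_eq _ (c _)) => n /=.
by rewrite subrK.
Qed.

Lemma imagX y k : (y *i) ^+ k = (cos_sign R k * y ^+ k) +i* (sin_sign R k * y ^+ k).
Proof.
elim: k => [|k IH]; first by rewrite !expr0 /cos_sign /sin_sign /=; apply: eq_ReIm => /=; ring.
have := cos_signD R 1 k; have := sin_signD R 1 k.
rewrite exprSr IH !add1n /= => -> ->.
by rewrite /cos_sign /sin_sign /=; apply: eq_ReIm; rewrite ?cReM ?cImM /= exprSr; ring.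
Qed.

Lemma imagX_add y k : (y *i) ^+ k + ((- y) *i) ^+ k = (2 * (cos_sign R k * y ^+ k))%:C.
Proof.
rewrite !imagX [(- y) ^+ k]exprNn -signr_odd /cos_sign /sin_sign.
by apply: eq_ReIm; rewrite ?cReD ?cImD /=; case: odd => /=; ring.
Qed.

(** exp x (cos y + i sin y) is the Cauchy product of the series of exp x and
    exp (i y). *)
Lemma cexp_series z : ccvg (fun n => \sum_(k < n) z ^+ k / k`!%:R) (cexp z).
Proof.
case: z => x y.
pose a k := ecoef x k; pose b k := cos_sign R k * ecoef y k; pose c k := sin_sign R k * ecoef y k.
have N (n : nat) : (n%:R : R[i]) = (n%:R : R)%:C by rewrite rmorph_nat.
have E k : (x +i* y) ^+ k / k`!%:R = conv a b k +i* conv a c k.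
  rewrite (_ : x +i* y = y *i + x%:C); last by apply: eq_ReIm; rewrite /= ?add0r ?addr0.
  rewrite exprDn mulr_suml.
  have T i : (i < k.+1)%N -> y *i ^+ (k - i) * x%:C ^+ i *+ 'C(k, i) / k`!%:R =
      (a i * b (k - i)%N) +i* (a i * c (k - i)%N) :> R[i].
    rewrite ltnS => ik; rewrite imagX -mulr_natr !N -rmorphXn -fmorphV.
    have f n : (n`!%:R : R) != 0 by rewrite pnatr_eq0 -lt0n fact_gt0.
    have B0 : ('C(k, i)%:R : R) != 0 by rewrite pnatr_eq0 -lt0n bin_gt0.
    have := bin_fact ik => /(congr1 (fun n => n%:R : R)); rewrite !natrM => <-.
    by apply: eq_ReIm; rewrite !(cReM, cImM) /= /a /b /c /ecoef; field; rewrite B0 !f.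
  under eq_bigr => i _ do rewrite T//.
  by rewrite /conv; elim/big_rec3: _ => // i p q r _ ->; apply: eq_ReIm; rewrite ?cReD ?cImD.
have hx k : `|a k| <= ecoef `|x| k by rewrite /a /ecoef normrM normrX normfV normr_nat.
have hy k : `|ecoef y k| <= ecoef `|y| k by rewrite /ecoef normrM normrX normfV normr_nat.
have hb k : `|b k| <= ecoef `|y| k.
  by rewrite /b normrM -[leRHS]mul1r; apply: ler_pM => //; exact: cos_sign_le1.
have hc k : `|c k| <= ecoef `|y| k.
  by rewrite /c normrM -[leRHS]mul1r; apply: ler_pM => //; exact: sin_sign_le1.
have cx : \sum_(k < n) a k @[n --> \oo] --> expR x := @exp_series R x.
have c1 := cauchy_product (normr_ge0 x) (normr_ge0 y) hx hb cx (@cos_series R y).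
have c2 := cauchy_product (normr_ge0 x) (normr_ge0 y) hx hc cx (@sin_series R y).
rewrite /ccvg /cexp cReM cImM /= !mul0r subr0 addr0; split.
  apply: (cvg_eq _ c1) => n; under eq_bigr => k _ do rewrite E.
  by elim/big_rec2: _ => // i p q _ <-; rewrite cReD.
apply: (cvg_eq _ c2) => n; under eq_bigr => k _ do rewrite E.
by elim/big_rec2: _ => // i p q _ <-; rewrite cImD.
Qed.

Lemma cexpD z w : cexp (z + w) = cexp z * cexp w.
Proof.
case: z w => [x y] [x' y']; rewrite /cexp /= expRD cosD sinD.
by apply: eq_ReIm; rewrite !(cReM, cImM) /=; ring.
Qed.

Lemma cexp0 : cexp 0 = 1 :> R[i].
Proof. by rewrite /cexp /= expR0 cos0 sin0; apply: eq_ReIm; rewrite /=; ring. Qed.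

Lemma sin2_symbolE s : sin2_symbol s =
  (2 * (pi : R) ^+ 2)^-1%:C * (1 - (cexp ((2 * pi) *i * s) + cexp ((- (2 * pi)) *i * s)) / 2).
Proof.
rewrite /sin2_symbol /csin; set z := 'i%C * (pi%:C * s).
have -> : (2 * pi) *i * s = z + z :> R[i].
  by rewrite /z; apply: eq_ReIm; rewrite !(cReD, cImD, cReM, cImM) /=; ring.
have -> : (- (2 * pi)) *i * s = - z + - z :> R[i].
  by rewrite -opprD /z; apply: eq_ReIm; case: s {z} => p q /=; ring.
rewrite !cexpD; have := cexpD z (- z); rewrite subrr cexp0.
move: (cexp z) (cexp (- z)) => p q pq.
have i2 : 'i%C * 'i%C = -1 :> R[i] by apply: eq_ReIm => /=; ring.
have i0 : 'i%C != 0 :> R[i] by rewrite eq_complex /= eqxx oner_eq0.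
have -> : ((p - q) / (2 * 'i%C)) ^+ 2 = (1 - (p * p + q * q) / 2) / 2.
  have e : (2 * 'i%C) ^+ 2 = - 4%:R :> R[i] by rewrite expr2 mulrACA i2; ring.
  rewrite expr_div_n e sqrrB -[p * q *+ 2]mulr_natr -pq; by field.
have -> : ((2 * (pi : R) ^+ 2)^-1)%:C = (pi ^- 2)%:C / 2.
  by rewrite !fmorphV rmorphM invfM mulrC rmorph_nat.
by rewrite -mulrA [2^-1 * _]mulrC.
Qed.

(** i^k + (-i)^k selects, up to the factor 2, the signs of the cosine series. *)
Lemma symcoef_entire : entire_expansion (@sin2_symbol R) (fun k => (symcoef R k)%:C).
Proof.
move=> s; apply/ccvgP; rewrite sin2_symbolE.
set w1 := _ *i * s; set w2 := _ *i * s.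
set K := (_^-1)%:C.
have c0 : ccvg (fun n => (n != 0%N)%:R) 1.
  split; rewrite -(cvg_shiftS (fun n => _ ((n != 0%N)%:R))) /=; exact: cvg_cst.
have := ccvgZ K (ccvgD c0 (ccvgZ (- 2^-1) (ccvgD (cexp_series w1) (cexp_series w2)))).
have -> : 1 + - 2^-1 * (cexp w1 + cexp w2) = 1 - (cexp w1 + cexp w2) / 2 by ring.
apply: ccvg_ext => n.
rewrite -big_split /= mulr_sumr.
have -> : (n != 0%N)%:R = \sum_(k < n) ((k == 0 :> nat)%N%:R : R[i]).
  case: n => [|n]; first by rewrite big_ord0.
  by rewrite big_ord_recl big1 ?addr0.
rewrite -big_split mulr_sumr; apply: eq_bigr => k _ /=.
rewrite !exprMn -!mulrDl imagX_add /symcoef /K.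
have -> : (k == 0 :> nat)%N%:R = ((k == 0 :> nat)%N%:R : R)%:C by rewrite rmorph_nat.
have -> : (k`!%:R)^-1 = ((k`!%:R)^-1)%:C :> R[i] by rewrite fmorphV rmorph_nat.
have -> : - 2^-1 = (- 2^-1)%:C :> R[i] by rewrite rmorphN fmorphV rmorph_nat.
have n0 : (k`!%:R : R) != 0 by rewrite pnatr_eq0 -lt0n fact_gt0.
have -> : (((k == 0 :> nat)%N%:R : R)%:C : R[i]) = ((k == 0 :> nat)%N%:R : R)%:C * s ^+ k.
  by case: (nat_of_ord k) => [|j] /=; rewrite ?expr0 ?mulr1 ?mul0r.
rewrite /ecoef; move: pi (lt0r_neq0 (pi_gt0 R)) (s ^+ k) ((k == 0 :> nat)%N%:R : R) => p p0 z b.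
by apply: eq_ReIm; rewrite !(cReM, cImM, cReD, cImD) /=; field; rewrite ?n0 ?p0.
Qed.

(** The existential expansion in the definition of the space is the Taylor series,
    by uniqueness of power series on the positive half-line. *)
Lemma symcoef_unique (d : nat -> R[i]) : entire_expansion (@sin2_symbol R) d ->
  forall k, d k = (symcoef R k)%:C.
Proof.
move=> ed k.
have cR x : \sum_(k < n) symcoef R k * x ^+ k @[n --> \oo] --> Re (sin2_symbol x%:C) /\
    (0 : R) = Im (sin2_symbol x%:C).
  have [c1 c2] := (ccvgP _ _).2 (symcoef_entire x%:C).
  have E n : \sum_(k < n) (symcoef R k)%:C * x%:C ^+ k = (\sum_(k < n) symcoef R k * x ^+ k)%:C.
    by rewrite rmorph_sum; apply: eq_bigr => i _; rewrite -rmorphXn -rmorphM.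
  split; first by apply: (cvg_eq _ c1) => n; rewrite E.
  have c3 : Im (\sum_(k < n) (symcoef R k)%:C * x%:C ^+ k) @[n --> \oo] --> (0 : R).
    by apply: (cvg_eq _ (cvg_cst 0)) => n; rewrite E.
  exact: (cvg_unique (@Rhausdorff R) c3 c2).
have cd x : \sum_(k < n) Re (d k) * x ^+ k @[n --> \oo] --> Re (sin2_symbol x%:C) /\
    \sum_(k < n) Im (d k) * x ^+ k @[n --> \oo] --> Im (sin2_symbol x%:C).
  have [c1 c2] := (ccvgP _ _).2 (ed x%:C).
  split; [apply: (cvg_eq _ c1) => n|apply: (cvg_eq _ c2) => n]; rewrite /=.
    by elim/big_rec2: _ => // i p q _ ->; rewrite cReD cReM -rmorphXn /= mulr0 subr0.
  by elim/big_rec2: _ => // i p q _ ->; rewrite cImD cImM -rmorphXn /= mulr0 add0r.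
have eR := @pseries_unique R (fun k => Re (d k)) _ _ (fun x _ => (cd x).1) (fun x _ => (cR x).1) k.
have eI := @pseries_unique R (fun k => Im (d k)) (fun=> 0) _ (fun x _ => (cd x).2) _ k.
apply: eq_ReIm => //=; apply: eI => x _; rewrite -(cR x).2.
by apply: (cvg_eq _ (cvg_cst 0)) => n; rewrite big1// => i _; rewrite mul0r.
Qed.

(** On the critical line the symbol is ch^2(pi tau) / pi^2. *)
Definition critcoef k : R := pi ^- 2 * gam2 R k.*2.

Lemma sin2_critical : critical_line_expansion (@sin2_symbol R) critcoef.
Proof.
move=> t; apply/ccvgP.
have V : sin2_symbol (2^-1 +i* t) = (pi ^- 2 * ((expR (2 * pi * t) + 2 + expR (- (2 * pi * t))) / 4))%:C.
  rewrite sin2_symbolE /cexp !cReM !cImM /=.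
  have -> : 2 * pi * 2^-1 = pi :> R by field.
  have -> : - (2 * pi) * 2^-1 = - pi :> R by field.
  rewrite !mul0r !sub0r !add0r cosN sinN cospi sinpi.
  have -> : 2^-1 = (2^-1)%:C :> R[i] by rewrite fmorphV rmorph_nat.
  rewrite mulNr opprK; move: pi (lt0r_neq0 (pi_gt0 R)) (expR _) (expR _) => p p0 u v.
  by apply: eq_ReIm; rewrite !(cReM, cImM, cReB, cImB, cReD, cImD) /=; field.
rewrite V.
have c : \sum_(k < n) gam2 R k * t ^+ k @[n --> \oo] -->
    (expR (2 * pi * t) + 2 + expR (- (2 * pi * t))) / 4.
  have es y : \sum_(k < n) ecoef y k * t ^+ k @[n --> \oo] --> expR (y * t).
    apply: (cvg_eq _ (@exp_series R (y * t))) => n; apply: eq_bigr => k _.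
    by rewrite /ecoef exprMn mulrAC.
  have e0 := es 0; rewrite mul0r expR0 in e0.
  have c : (\sum_(k < n) ecoef (2 * pi) k * t ^+ k + \sum_(k < n) ecoef 0 k * t ^+ k +
      \sum_(k < n) ecoef 0 k * t ^+ k + \sum_(k < n) ecoef (- (2 * pi)) k * t ^+ k) / 4
      @[n --> \oo] --> (expR (2 * pi * t) + 1 + 1 + expR (- (2 * pi) * t)) / 4.
    by apply: cvgM; [apply: cvgD; [apply: cvgD; [apply: cvgD|]|]|exact: cvg_cst].
  have <- : expR (2 * pi * t) + 1 + 1 + expR (- (2 * pi) * t) =
      expR (2 * pi * t) + 2 + expR (- (2 * pi * t)) by rewrite mulNr; ring.
  apply: (cvg_eq _ c) => n /=.
  rewrite -!big_split mulr_suml; apply: eq_bigr => k _ /=; rewrite gam2E; ring.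
have c2 : \sum_(k < n) critcoef k * t ^+ k.*2 @[n --> \oo] -->
    pi ^- 2 * ((expR (2 * pi * t) + 2 + expR (- (2 * pi * t))) / 4).
  have h : n.*2 @[n --> \oo] --> \oo.
    move=> P [N _ hN]; exists N => // n /= Nn; apply: hN => /=.
    by rewrite (leq_trans Nn)// -addnn leq_addr.
  have c2 : pi ^- 2 * \sum_(k < n.*2) gam2 R k * t ^+ k @[n --> \oo] -->
      pi ^- 2 * ((expR (2 * pi * t) + 2 + expR (- (2 * pi * t))) / 4).
    by apply: cvgM; [exact: cvg_cst|exact: (cvg_comp _ _ h c)].
  apply: (cvg_eq _ c2) => n /=.
  rewrite mulr_sumr; elim: n => [|n IH]; first by rewrite !big_ord0.
  by rewrite doubleS !big_ord_recr /= IH (@gam2_odd R n.*2.+1) ?mul0r ?mulr0 ?addr0 ?mulrA//= odd_double.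
by split; [exact: c2|exact: cvg_cst].
Qed.

End ComplexExponential.

(** * The inversion theorem *)

Section ComplexInversion.
Variable R : realType.
Implicit Types (f g G S : R -> R[i]) (x a : R) (k n : nat).
Local Notation mu := (@lebesgue_measure R).
Local Notation D := (@halfline R).

Lemma ReF_iter a f k : ReF (iter k (euler_op a) f) = iter k (real_euler a) (ReF f).
Proof.
elim: k => //= k <-; apply/funext => x.
by rewrite /euler_op ReFZ.
Qed.

Lemma ImF_iter a f k : ImF (iter k (euler_op a) f) = iter k (real_euler a) (ImF f).
Proof.
elim: k => //= k <-; apply/funext => x.
by rewrite /euler_op ImFZ.
Qed.

Lemma ReF_term G k : ReF (inversion_term G k) = rterm (ReF G) k.
Proof.
have e : ReF (sqrt_mul G) = fun y => Num.sqrt y * ReF G y.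
  by apply/funext => y; rewrite /sqrt_mul ReFZ.
by apply/funext => x; rewrite /inversion_term !ReFZ ReF_iter e.
Qed.

Lemma ImF_term G k : ImF (inversion_term G k) = rterm (ImF G) k.
Proof.
have e : ImF (sqrt_mul G) = fun y => Num.sqrt y * ImF G y.
  by apply/funext => y; rewrite /sqrt_mul ImFZ.
by apply/funext => x; rewrite /inversion_term !ImFZ ImF_iter e.
Qed.

Definition is_carleman2 (f G : R -> R) := sqint f /\ forall x, 0 < x -> G x = carleman2 f x.

Lemma is_carleman2_sqint (f G : R -> R) : is_carleman2 f G -> sqint G.
Proof.
by move=> [sf e]; apply: sqint_ext (sqint_carleman2 sf) => x x0; rewrite e.
Qed.

Lemma rms_cosine (f G : R -> R) : is_carleman2 f G ->
  rms_sum (fun k => rterm G k.+1) (fun x => pi ^+ 2 * f x - G x).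
Proof.
move=> h; have sG := is_carleman2_sqint h; have [sf e] := h.
have cT := tchain_sqchain sf; split.
- move=> k; apply: sqint_ext (sqintZ _ (cT.2 k.+1.*2)) => x x0.
  by rewrite (rtermE _ cT.1 e x0).
- by apply: sqintB => //; exact: sqintZ.
apply: (cvg_eq _ (cospoly_cvg sf)) => n; apply: sqnorm_ext => x x0.
by rewrite -(cosine_series n cT.1 e x0); ring.
Qed.

Lemma rms_symbol (f G : R -> R) : is_carleman2 f G ->
  rms_sum (fun k x => symcoef R k * iter k (real_euler (-1)) G x) f.
Proof.
move=> [sf e]; have cT := tchain_sqchain sf; split => //.
  move=> k; apply: sqintZ; apply: sqint_ext (sqint_act _ cT.2) => x x0.
  by rewrite (iter_euler (-1) k cT.1 e x0).
apply: (cvg_eq _ (sympoly_cvg sf)) => n; apply: sqnorm_ext => x x0.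
by rewrite (symbol_series n cT.1 e x0).
Qed.

Lemma is_carleman2_smooth (f G : R -> R) : is_carleman2 f G ->
  (forall n x, 0 < x -> derivable (derive1n n G) x 1) /\
  (forall k, sqint (iter k (real_euler (-1)) G)).
Proof.
move=> [sf e]; have cT := tchain_sqchain sf; split.
  by move=> n x x0; exact: chain_derive1n cT.1 e x0.
move=> k; apply: sqint_ext (sqint_act _ cT.2) => x x0.
by rewrite (iter_euler (-1) k cT.1 e x0).
Qed.

Definition is_carleman2C f G := is_carleman2 (ReF f) (ReF G) /\ is_carleman2 (ImF f) (ImF G).

Definition inversion_rest f G : R -> R[i] := fun x => (pi ^+ 2)%:C * f x - G x.

Lemma ms_cosine f G : is_carleman2C f G ->
  ms_sum (fun k => inversion_term G k.+1) (inversion_rest f G).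
Proof.
move=> [hr hi]; apply/ms_sumP; rewrite /inversion_rest.
have -> : (fun k => ReF (inversion_term G k.+1)) = fun k => rterm (ReF G) k.+1.
  by apply/funext => k; exact: ReF_term.
have -> : (fun k => ImF (inversion_term G k.+1)) = fun k => rterm (ImF G) k.+1.
  by apply/funext => k; exact: ImF_term.
have -> : ReF (fun x => (pi ^+ 2)%:C * f x - G x) = fun x => pi ^+ 2 * ReF f x - ReF G x.
  by apply/funext => x; rewrite ReFB ReFZ.
have -> : ImF (fun x => (pi ^+ 2)%:C * f x - G x) = fun x => pi ^+ 2 * ImF f x - ImF G x.
  by apply/funext => x; rewrite ImFB ImFZ.
by split; exact: rms_cosine.
Qed.

Lemma inversion_of_carleman2 f G : is_carleman2C f G -> inversion_formula G f.
Proof.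
move=> h; exists (inversion_rest f G); first exact: ms_cosine.
apply/aeW => x _; rewrite /inversion_rest addrC subrK mulrA -rmorphM mulVf ?mul1r//.
by rewrite expf_neq0// lt0r_neq0// pi_gt0.
Qed.

Lemma L2Phi_of_carleman2 f G : is_carleman2C f G -> L2Phi (@sin2_symbol R) G.
Proof.
move=> [hr hi]; exists (fun k => (symcoef R k)%:C), (@critcoef R).
have [smr sqr] := is_carleman2_smooth hr; have [smi sqi] := is_carleman2_smooth hi.
split.
- exact: symcoef_entire.
- exact: sin2_critical.
- split=> [|k _]; last first.
    by rewrite mulr_ge0 ?gam2_ge0// invr_ge0 exprn_ge0// pi_ge0.
  rewrite /critcoef mulr_gt0 ?invr_gt0 ?exprn_gt0 ?pi_gt0//.
  by have := cos_sign_gam2 R 0; rewrite /cos_sign /ecoef !expr0 fact0 /= => e; lra.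
- split; first by move=> n x x0; split; [exact: smr|exact: smi].
  by move=> k; apply/L2P; rewrite ReF_iter ImF_iter.
exists f; apply/ms_sumP.
have -> : (fun k => ReF (fun x => (symcoef R k)%:C * iter k (euler_op (-1)) G x)) =
    fun k x => symcoef R k * iter k (real_euler (-1)) (ReF G) x.
  by apply/funext => k; apply/funext => x; rewrite ReFZ ReF_iter.
have -> : (fun k => ImF (fun x => (symcoef R k)%:C * iter k (euler_op (-1)) G x)) =
    fun k x => symcoef R k * iter k (real_euler (-1)) (ImF G) x.
  by apply/funext => k; apply/funext => x; rewrite ImFZ ImF_iter.
by split; exact: rms_symbol.
Qed.

Lemma carleman2_of_L2Phi G : L2Phi (@sin2_symbol R) G -> exists f, is_carleman2C f G.
Proof.
move=> [d [c [ed _ _ [sm L] [f msf]]]]; exists f.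
have dE := symcoef_unique ed.
have /ms_sumP[[_ sr cr] [_ si ci]] := msf.
split; split => //.
  apply: (carleman2_of_symbol_series (G := ReF G)) => //.
  - by move=> n x x0; have [] := sm n x x0.
  - by move=> k; have /L2P[] := L k; rewrite ReF_iter.
  - apply: (cvg_eq _ cr) => n; apply: sqnorm_ext => x _; congr (_ - _).
    by apply: eq_bigr => k _; rewrite dE ReFZ ReF_iter.
apply: (carleman2_of_symbol_series (G := ImF G)) => //.
- by move=> n x x0; have [] := sm n x x0.
- by move=> k; have /L2P[] := L k; rewrite ImF_iter.
- apply: (cvg_eq _ ci) => n; apply: sqnorm_ext => x _; congr (_ - _).
  by apply: eq_bigr => k _; rewrite dE ImFZ ImF_iter.
Qed.

Lemma log_transform_carleman2 f x : L2 f -> 0 < x ->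
  cintegrable (log_integrand f x) /\
  ReF (log_transform f) x = carleman2 (ReF f) x /\ ImF (log_transform f) x = carleman2 (ImF f) x.
Proof.
move=> /L2P[sr si] x0.
have eR : ReF (log_integrand f x) = fun t => log_kernel x t * ReF f t.
  by apply/funext => t; rewrite /log_integrand ReFZ.
have eI : ImF (log_integrand f x) = fun t => log_kernel x t * ImF f t.
  by apply/funext => t; rewrite /log_integrand ImFZ.
have [ir hr] := log_kernel_op sr x0; have [ii hi] := log_kernel_op si x0.
split; first by rewrite /cintegrable eR eI.
by split; [rewrite -hr -eR|rewrite -hi -eI].
Qed.

Lemma log_transform_is_carleman2C f : L2 f -> is_carleman2C f (log_transform f).
Proof.
move=> Lf; have /L2P[sr si] := Lf.
by split; split => // x x0; have [_ []] := log_transform_carleman2 Lf x0.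
Qed.

Lemma sqint_ae (f g : R -> R) : meas f -> sqint g ->
  {ae mu, forall x : R, 0 < x -> f x = g x} -> sqint f /\ sqnorm (fun x => f x - g x) = 0.
Proof.
move=> mf sg fg.
have [mg _] := sg; have md := measB mf mg; have m := measX 2 md.
have ae : ae_eq mu D (EFin \o (fun x => (f x - g x) ^+ 2)) (cst 0%E).
  by move: fg; apply: (@filterS _ _ (ae_filter_ringOfSetsType mu)) => x h; rewrite halflineE => x0 /=; rewrite h// subrr expr0n.
have E := @ae_eq_integral _ _ _ mu D (cst 0%E) _ (@measurable_halfline_lebesgue R) (meas_EFin m)
  (measurable_cst _) ae.
rewrite integral0 in E.
have i : integ (fun x => (f x - g x) ^+ 2).
  by apply: integ_ge0P => //; [move=> x _; exact: sqr_ge0|rewrite E ltry].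
have s : sqint (fun x => f x - g x) by split.
split; last by apply: EFin_inj; rewrite (EFin_hint i).
by apply: sqint_ext (sqintD s sg) => x _; rewrite subrK.
Qed.

Lemma carleman2_sqnorm_0 (f : R -> R) x : sqint f -> sqnorm f = 0 -> 0 < x -> carleman2 f x = 0.
Proof.
move=> sf f0 x0; apply/eqP; rewrite -normr_le0.
have z y : 0 < y -> sop 1 f y = 0.
  by move=> y0; rewrite /sop -/(inner (ker 1 y) f) innerC; exact: inner_sqnorm_0 sf (sqint_ker 1 y0) f0.
rewrite normr_le0 /carleman2 /sop -[eqbRHS]hint0; apply/eqP/hint_ext => y y0.
by rewrite -/(sop 1 f y) z// mulr0.
Qed.

(** The inversion series has the mean-square sum pi^2 h - G by the direct theorem
    for h, so f = h almost everywhere; an integral operator does not see the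
    difference, whence the equality at every x. *)
Lemma is_carleman2_ae (f h G S : R -> R) : is_carleman2 h G -> meas f ->
  rms_sum (fun k => rterm G k.+1) S ->
  {ae mu, forall x : R, 0 < x -> f x = pi ^- 2 * (G x + S x)} -> is_carleman2 f G.
Proof.
move=> hG mf [st sS cS] fE; have sG := is_carleman2_sqint hG; have [sh e] := hG.
have [_ sS' cS'] := rms_cosine hG.
have sGS : sqint (fun x => pi ^- 2 * (G x + S x)) by apply: sqintZ; exact: sqintD.
have [sf n0] := sqint_ae mf sGS fE.
have su n : sqint (fun x => \sum_(k < n) rterm G k.+1 x).
  by apply: (sqint_sum (f := fun k => rterm G k.+1)) => k _; exact: st.
have u0 := sqnorm_cvg_unique su sS sS' cS cS'.
have n1 : sqnorm (fun x => f x - h x) = 0.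
  have p0 : pi != 0 :> R by rewrite lt0r_neq0// pi_gt0.
  have sd := sqintB sf sGS; have sS2 := sqintB sS sS'.
  apply/eqP; rewrite eq_le sqnorm_ge0 andbT.
  have := sqnormD_le sd (sqintZ (pi ^- 2) sS2).
  rewrite n0 (sqnormZ _ sS2) u0 !mulr0 addr0; apply: le_trans.
  rewrite le_eqVlt; apply/orP; left; apply/eqP; apply: sqnorm_ext => x _.
  by move: (pi : R) p0 => p p0; field.
split; first exact: sf.
move=> x x0; have := carleman2_sqnorm_0 (sqintB sf sh) n1 x0.
by rewrite (carleman2B sf sh x0) -(e x x0) => /eqP; rewrite subr_eq0 => /eqP.
Qed.

End ComplexInversion.

Theorem theorem1 (R : realType) :
  (forall f : R -> R[i], L2 f ->
     [/\ forall x : R, 0 < x -> cintegrable (log_integrand f x),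
         L2Phi (@sin2_symbol R) (log_transform f)
       & inversion_formula (log_transform f) f])
  /\
  (forall G : R -> R[i], L2Phi (@sin2_symbol R) G ->
     (exists2 f : R -> R[i], L2 f & inversion_formula G f) /\
     (forall f : R -> R[i], cmeasurable f -> inversion_formula G f ->
        L2 f /\
        (forall x : R, 0 < x ->
           cintegrable (log_integrand f x) /\ G x = log_transform f x))).
Proof.
split=> [f Lf|G /carleman2_of_L2Phi[h hG]].
  have hf := log_transform_is_carleman2C Lf; split.
  - by move=> x x0; have [] := log_transform_carleman2 Lf x0.
  - exact: L2Phi_of_carleman2 hf.
  - exact: inversion_of_carleman2.
split.
  exists h; last exact: inversion_of_carleman2.
  by apply/L2P; have [[sr _] [si _]] := hG.
move=> f [mr mi] [S /ms_sumP[cR cI] fE].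
have termR : (fun k => ReF (inversion_term G k.+1)) = fun k => rterm (ReF G) k.+1.
  by apply/funext => k; exact: ReF_term.
have termI : (fun k => ImF (inversion_term G k.+1)) = fun k => rterm (ImF G) k.+1.
  by apply/funext => k; exact: ImF_term.
rewrite termR in cR; rewrite termI in cI.
have hR : is_carleman2 (ReF f) (ReF G).
  apply: is_carleman2_ae hG.1 mr cR _; move: fE; apply: (@filterS _ _ (ae_filter_ringOfSetsType _)) => x fx x0.
  by rewrite /ReF fx// cReM cReD /= mul0r subr0.
have hI : is_carleman2 (ImF f) (ImF G).
  apply: is_carleman2_ae hG.2 mi cI _; move: fE; apply: (@filterS _ _ (ae_filter_ringOfSetsType _)) => x fx x0.
  by rewrite /ImF fx// cImM cImD /= mul0r addr0.
have Lf : L2 f by apply/L2P; split; [case: hR|case: hI].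
split=> // x x0; have [i [eR eI]] := log_transform_carleman2 Lf x0; split=> //.
by apply: eq_ReIm; [rewrite -[LHS]/(ReF G x) hR.2//|rewrite -[LHS]/(ImF G x) hI.2//].
Qed.
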